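(* Let $p_1\ge p_2\ge\cdots>0$ with $\sum_{j\ge1}p_j=1$, and let $n_0$ be as defined in the context. Let $r\ge1$ be an integer, and let $K_{n,r}$ be the number of boxes containing exactly $r$ balls when $n$ balls are thrown independently into boxes $1,2,\ldots$, each ball hitting box $j$ with probability $p_j$. Set $\mu_{n,r}:=\mathbb E K_{n,r}$ and $\sigma_{n,r}^2:=\mathrm{Var}\,K_{n,r}$. Then $$d_{\rm TV}\bigl(\mathcal L(K_{n,r}),\mathrm{TP}(\mu_{n,r},\sigma_{n,r}^2)\bigr)=O(\sigma_{n,r}^{-1}),\qquad d_{\rm loc}\bigl(\mathcal L(K_{n,r}),\mathrm{TP}(\mu_{n,r},\sigma_{n,r}^2)\bigr)=O(\sigma_{n,r}^{-2}),$$ uniformly in $n\ge\max\{n_0,e^{r/4},2r\}$; that is, for each $r\ge1$ there is a constant $C_r<\infty$, not depending on $n$, such that for all integers $n\ge\max\{n_0,e^{r/4},2r\}$ the first distance is at most $C_r\sigma_{n,r}^{-1}$ and the second is at most $C_r\sigma_{n,r}^{-2}$.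
   Context: Occupancy scheme: $n$ balls are thrown independently into boxes $1,2,\ldots$ with probabilities $p_j$; $N_j$ is the number of balls in box $j$, and $K_{n,r}=\#\{j\ge1: N_j=r\}$. $\mathcal L(X)$ denotes the distribution of $X$. Distances: for probability distributions $P,Q$ on the integers, $d_{\rm TV}(P,Q):=\sup_A|P(A)-Q(A)|$ and $d_{\rm loc}(P,Q):=\sup_{j\in\mathbb Z}|P\{j\}-Q\{j\}|$. Translated Poisson distribution: $\mathrm{TP}(\mu,\sigma^2)$ is the distribution of $a+Z$, where $a$ is an integer and $Z$ has the Poisson distribution with mean $\lambda$, with $a$ and $\lambda$ chosen so that $a+\lambda=\mu$ and $\sigma^2\le\lambda<\sigma^2+1$. Definition of $j_0$, $P_0$, $j_n$, $n_0$: $j_0$ is defined by $\sum_{j\ge j_0-1}p_j\ge 1/2>\sum_{j\ge j_0}p_j=:P_0$. For each $n$, $j_n\ge1$ is defined by $p_{j_n-1}\ge 4n^{-1}\log n>p_{j_n}$ (the first inequality being vacuous if $j_n=1$). The integer $n_0\ge3$ is such that $j_n\ge j_0$ for all $n\ge n_0$, and also $n_0/\log^2 n_0\ge 16/P_0$. *)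

(* Defs.v *)
From HB Require Import structures.
From mathcomp Require Import all_boot all_order all_algebra finmap.
From mathcomp Require Import lra.
From mathcomp Require Import all_classical all_reals all_analysis.

Set Implicit Arguments.
Unset Strict Implicit.
Unset Printing Implicit Defensive.

Import Order.TTheory GRing.Theory Num.Theory.

Local Open Scope classical_set_scope.
Local Open Scope ring_scope.

(* The discrete sigma-algebra on int: every set of integers is measurable. *)
HB.instance Definition _ := isPointed.Build int 0.
HB.instance Definition _ := @isMeasurable.Build default_measure_display
  int discrete_measurable discrete_measurable0
  discrete_measurableC discrete_measurableU.

Section distances.
Local Open Scope ereal_scope.
Context {R : realType}.
Implicit Types P Q : probability int R.

Definition dTV P Q : \bar R :=
  ereal_sup [set `|P A - Q A| | A in [set: set int]].

Definition dloc P Q : \bar R :=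
  ereal_sup [set `|P [set j] - Q [set j]| | j in [set: int]].

End distances.

Definition shiftz (a : int) (k : nat) : int := a + k%:Z.

Lemma measurable_shiftz (a : int) : measurable_fun [set: nat] (shiftz a).
Proof. by []. Qed.

HB.instance Definition _ (a : int) :=
  isMeasurableFun.Build _ _ _ _ (shiftz a) (measurable_shiftz a).

Section translated_poisson.
Context {R : realType}.
Variables mu v : R.

(* The integer a and the real lambda of TP(mu, v); by TP_specP they are the
   only ones such that a + lambda = mu and v <= lambda < v + 1. *)
Definition TP_shift : int := Num.floor (mu - v).
Definition TP_rate : R := mu - TP_shift%:~R.

Lemma TP_specP (a : int) (l : R) :
  (a = TP_shift /\ l = TP_rate) <-> (a%:~R + l = mu /\ v <= l < v + 1).
Proof.
rewrite /TP_rate /TP_shift; split=> [[-> ->]|[<- /andP[h1 h2]]].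
  have := floor_itv (mu - v); rewrite intrD => /andP[h1 h2].
  by split; [lra|apply/andP; split; lra].
suff -> : Num.floor (a%:~R + l - v) = a by split=> //; lra.
by apply: floor_def; rewrite intrD; apply/andP; split; lra.
Qed.

(* The argument 0 of poisson_prob is a dummy of the library. For a rate > 0,
   which is the case as soon as v > 0, poisson_prob rate 0 is the Poisson
   distribution on nat; for a rate <= 0 it is the Dirac mass at 0. *)
Definition TP : probability int R :=
  distribution (poisson_prob TP_rate 0) (shiftz TP_shift).

End translated_poisson.

Section occupancy.
Context d (T : measurableType d) {R : realType} (P : probability T R).

Definition mutually_independent d' (T' : measurableType d') (I : finType)
    (X : I -> {RV P >-> T'}) : Prop :=
  forall (J : {set I}) (A : I -> set T'), (forall i, measurable (A i)) ->
    P (\bigcap_(i in [set` J]) (X i @^-1` A i)) =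
    (\prod_(i in J) P (X i @^-1` A i))%E.

(* X i is the box hit by ball i. Boxes are numbered from 1: p 0 is never used,
   and box 0 is hit with probability 0 when the p j, j >= 1, add up to 1. *)
Definition is_occupancy_scheme (p : nat -> R) n (X : 'I_n -> {RV P >-> nat}) :
    Prop :=
  mutually_independent X /\
  forall i j, (1 <= j)%N -> P (X i @^-1` [set j]) = (p j)%:E.

Variables (n : nat) (X : 'I_n -> {RV P >-> nat}).

Definition balls_in (j : nat) (w : T) : nat := #|[pred i | X i w == j]|.

(* The cardinal is the true one for r >= 1, by finite_boxes_with (fset_set maps
   infinite sets to fset0). *)
Definition boxes_with (r : nat) (w : T) : nat :=
  #|` fset_set [set j | (1 <= j)%N /\ balls_in j w = r] |.

Lemma finite_boxes_with r w : (1 <= r)%N ->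
  finite_set [set j | (1 <= j)%N /\ balls_in j w = r].
Proof.
move=> r1; apply: (@sub_finite_set _ _ [set X i w | i in [set: 'I_n]]).
  move=> j [_ jr]; move: r1; rewrite -jr => /card_gt0P[i].
  by rewrite inE => /eqP <-; exists i.
exact/finite_image/finite_finset.
Qed.

Lemma measurable_boxes_with r : measurable_fun [set: T] (boxes_with r).
Proof.
pose f (t : n.-tuple nat) :=
  #|` fset_set [set j | (1 <= j)%N /\ #|[pred i | tnth t i == j]| = r] |.
have boxesE w : boxes_with r w = f [tuple X i w | i < n].
  rewrite /boxes_with /f /balls_in; congr #|` fset_set _|; apply/funext => j /=.
  by congr (_ /\ _ = r); apply: eq_card => i; rewrite !inE tnth_mktuple.
move=> _ A _; rewrite setTI.
have -> : boxes_with r @^-1` A = \bigcup_t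
    (if f t \in A then \bigcap_(i in [set: 'I_n]) (X i @^-1` [set tnth t i])
     else set0).
  apply/seteqP; split=> [w /= Aw|w [t _]].
    exists [tuple X i w | i < n] => //; rewrite -boxesE mem_set//.
    by move=> i _ /=; rewrite tnth_mktuple.
  case: ifPn => // /set_mem At Xt; rewrite /= boxesE.
  suff -> : [tuple X i w | i < n] = t by [].
  by apply: eq_from_tnth => i; rewrite tnth_mktuple; exact: Xt.
apply: countable_bigcupT_measurable => [|t]; first exact: countableP.
case: ifPn => // _; apply: fin_bigcap_measurable => [|i _].
  exact: finite_finset.
exact: measurable_funPTI.
Qed.

HB.instance Definition _ r :=
  isMeasurableFun.Build _ _ _ _ (boxes_with r) (measurable_boxes_with r).

Definition law_boxes_with (r : nat) : probability int R :=
  distribution P (shiftz 0 \o boxes_with r).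

Definition mean_boxes_with (r : nat) : R :=
  fine 'E_P[fun w => (boxes_with r w)%:R].

Definition var_boxes_with (r : nat) : R :=
  fine 'V_P[fun w => (boxes_with r w)%:R].

End occupancy.

Section thresholds.
Context {R : realType} (p : nat -> R).

Definition tail_sum (k : nat) : \bar R := (\sum_(k <= j <oo) (p j)%:E)%E.

Definition is_j0 (j0 : nat) : Prop :=
  (2 <= j0)%N /\ (tail_sum j0 < (2^-1)%:E <= tail_sum j0.-1)%E.

Definition is_jn (n j : nat) : Prop :=
  let t := 4 * n%:R^-1 * ln (n%:R : R) in
  [/\ (1 <= j)%N, j = 1%N \/ t <= p j.-1 & p j < t].

Definition is_n0 (j0 n0 : nat) : Prop :=
  [/\ (3 <= n0)%N,
      forall n j, (n0 <= n)%N -> is_jn n j -> (j0 <= j)%N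
    & 16 / fine (tail_sum j0) <= n0%:R / ln (n0%:R : R) ^+ 2].

End thresholds.

(* Main.v *)
Require Import Defs.
From mathcomp Require Import all_boot all_order all_algebra finmap.
From mathcomp Require Import ring lra zify.
From mathcomp Require Import all_classical all_reals all_analysis.

Set Implicit Arguments.
Unset Strict Implicit.
Unset Printing Implicit Defensive.

Import Order.TTheory GRing.Theory Num.Theory.
Local Open Scope classical_set_scope.
Local Open Scope ring_scope.
Import numFieldNormedType.Exports.

(** With mu and v the mean and the variance of the number V of boxes holding
    exactly r balls, and a and lam the shift and the rate of the translated
    Poisson law, Stein's method applies: since a + lam = mu, a variable Z with
    that law satisfies E (lam * fdiff f Z - (Z - mu) * f Z) = 0 for bounded f,
    where fdiff is the forward difference. Solving the Poisson equation for f
    and evaluating it at V bounds both distances by the defect E (V - mu) f(V) -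
    v * E (fdiff f V), up to errors of order 1/v: one from 0 <= lam - v < 1, one
    from the event V < a ([law_tp_le], [law_tp_pt_le]). The differences of f are
    at most 1/lam for total variation ([stein_sol_diff]), and summable with sum
    at most 2/lam for a single point ([stein_pt_variation]). So it suffices to
    bound the defect by a constant times sup |fdiff f| * sqrt v, and by a
    constant times the sum of |fdiff f| ([defect_bounds]).

    These bounds rest on an explicit formula. Expanding f(V) in differences of f
    at 0 and using the probability that all boxes of a set A receive r balls, E
    f(V) becomes a finite sum ([occ]) that makes sense for any number s of balls
    and any total mass T. In this form, removing a box, size-biasing by a box,
    adding a ball and differentiating in T all lead back to the same functional,
    with one more difference of f. Hence E V g(V) - mu * E g(V) is a sum over
    boxes j, weighted by the probability q_j of r balls in j, of the effect on E
    g of withdrawing r balls and the mass p_j, plus (1 - q_j) E (fdiff g)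
    ([size_bias_eq]). Subtract from g a multiple of the identity so that E
    (fdiff g V) = 0: this removes exactly v * E (fdiff g V), and every remaining
    term is governed by expectations of second differences of g over nearby
    configurations ([stein_approx]).

    Second differences gain a factor because V is a binomial (K, 1/2) variable
    with K random. To see it, put each box inside a region of twice its mass; a
    ball of the region goes to the box with probability 1/2, so r out of m balls
    do with probability at most 1/2, and that event can be realised by first
    declaring the region active with probability 2 * C(m, r) / 2^m, and then
    tossing a fair coin ([occ_thin], [occ_thin_ge0]). The expectation of fdiff h
    under binomial (K, 1/2) is at most 2 sup |h| / sqrt (K + 1), and at most 8
    (sum of |h|) / (K + 1); the mean of 1 / (K + 1) is of order 1/mu by a second
    moment computation ([psi_inv_le]).

    The argument needs boxes whose regions fit together, so V is first replaced
    by the number of boxes j < M with p_j <= 1 / sqrt n that hold r balls. The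
    boxes left out matter with negligible probability ([truncation_error]), the
    total mass of those retained tends to 0 as n grows, and as a consequence the
    variance of the truncated count is comparable to its mean ([eocc_var]). All
    this holds for n and v large. Otherwise v is bounded, and the claim is
    trivial, or v = 0, V is constant and the translated Poisson law is the same
    point mass ([law_tp_degenerate]). *)

(** The context of many proofs below is full of real inequalities, which lia would
    try to use; only the hypotheses on natural numbers are kept. *)
Ltac nlia := repeat match goal with
  | H : is_true (leq _ _) |- _ => revert H
  | H : is_true (andb (leq _ _) (leq _ _)) |- _ => revert H
  | H : @eq nat _ _ |- _ => revert H
  end; clear; lia.

(** * The inclusion-exclusion functional *)

Definition fdiff {R : zmodType} (f : nat -> R) : nat -> R :=
  fun k => f k.+1 - f k.

Lemma ffactD s a b : s ^_ (a + b) = (s ^_ a * (s - a) ^_ b)%N.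
Proof.
elim: b => [|b IH]; first by rewrite addn0 muln1.
by rewrite addnS !ffactnSr IH -mulnA -subnDA.
Qed.

Lemma sum_subsets_setU1 (R : nmodType) (I : finType) (J : {set I}) j
    (F : {set I} -> R) : j \notin J ->
  \sum_(A : {set I} | A \subset j |: J) F A =
  \sum_(A : {set I} | A \subset J) F A +
  \sum_(A : {set I} | A \subset J) F (j |: A).
Proof.
move=> jJ; rewrite (bigID (fun A : {set I} => j \in A)) /= addrC; congr +%R.
  apply: eq_bigl => A; apply/andP/idP => [[AJ jA]|AJ].
    by apply/fintype.subsetP => x xA; have := fintype.subsetP AJ _ xA;
      rewrite !inE => /orP[/eqP xj|//]; rewrite -xj xA in jA.
  split; first exact: (fintype.subset_trans AJ (finset.subsetUr _ _)).
  by apply: contra jJ => /(fintype.subsetP AJ).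
rewrite (reindex_onto (fun A => j |: A) (fun A => A :\ j)) /=.
  apply: eq_bigl => A; rewrite finset.setU11 andbT; apply/andP/idP => [[AJ /eqP jA]|AJ].
    apply/fintype.subsetP => x xA; have := fintype.subsetP AJ x.
    rewrite !inE xA orbT => /(_ isT) /orP[/eqP xj|//].
    by move: xA; rewrite -jA xj !inE eqxx.
  split; first by rewrite finset.setUS.
  by rewrite finset.setU1K//; apply: contra jJ => /(fintype.subsetP AJ).
by move=> A /andP[_ jA]; rewrite finset.setD1K.
Qed.

(** Double counting of the pairs of a subset and a marked element of it; this is
    how a factor linear in the subset turns into a sum over a removed box. *)
Lemma sum_subsets_mark (R : pzRingType) (I : finType) (J : {set I})
    (w : I -> R) (F : {set I} -> R) :
  \sum_(A : {set I} | A \subset J) (\sum_(a in A) w a) * F A =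
  \sum_(j in J) w j * \sum_(A : {set I} | A \subset J :\ j) F (j |: A).
Proof.
under eq_bigr do rewrite big_distrl /=.
rewrite (exchange_big_dep (mem J)) /=; last first.
  by move=> A a /fintype.subsetP AJ /AJ.
apply: eq_bigr => j jJ; rewrite -big_distrr /=; congr *%R.
rewrite (reindex_onto (fun A => j |: A) (fun A => A :\ j)) /=; last first.
  by move=> A /andP[_ jA]; rewrite finset.setD1K.
apply: eq_bigl => A; rewrite finset.setU11 andbT; apply/andP/idP => [[AJ /eqP jA]|AJ].
  by rewrite -jA finset.setSD.
have jA : j \notin A.
  by apply/negP => /(fintype.subsetP AJ); rewrite !inE eqxx.
by rewrite finset.setU1K// -(finset.setD1K jJ) finset.setUS.
Qed.

Section inclusion_exclusion.
Variables (R : realType) (I : finType) (r : nat) (c p : I -> R).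
Implicit Types (J A : {set I}) (s : nat) (T : R) (f g : nat -> R).

(** With c_a = p_a^r / r! and T = 1, this is the probability that s independent
    balls put exactly r in each box of A: the falling factorial over the
    products of r! counts the ways of choosing the balls. *)
Definition ie_coef s T A : R :=
  (s ^_ (r * #|A|))%:R * (\prod_(a in A) c a) *
  (T - \sum_(a in A) p a) ^+ (s - r * #|A|).

(** Since f of a number of events is the sum over sets A of iter #|A| fdiff f 0
    times the indicator that all events of A occur, this is the inclusion-exclusion
    form of the expectation of f at the number of boxes of J with r balls, for s
    balls and total mass T, multiplied by T^s. Leaving out the division by T^s
    makes it a polynomial in T. The weights c are free, because doubling them is
    what thinning amounts to. *)
Definition occ J s T f : R :=
  \sum_(A : {set I} | A \subset J) ie_coef s T A * iter #|A| fdiff f 0%N.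

Lemma iter_fdiffE f k x : iter k.+1 fdiff f x = iter k fdiff (fdiff f) x.
Proof. by rewrite iterSr. Qed.

Lemma ie_coef_setU1 s T A j : j \notin A ->
  ie_coef s T (j |: A) =
  c j * (s ^_ r)%:R * ie_coef (s - r) (T - p j) A.
Proof.
move=> jA; rewrite /ie_coef cardsU1 jA !big_setU1 //= mulnDr muln1.
rewrite ffactD natrM subnDA opprD addrA; ring.
Qed.

(** Whether the new box has r balls changes f by its difference, and given that
    it has, s - r balls and the mass T - p j are left for the other boxes. *)
Lemma occ_setU1 J s T f j : j \notin J ->
  occ (j |: J) s T f =
  occ J s T f + c j * (s ^_ r)%:R * occ J (s - r) (T - p j) (fdiff f).
Proof.
move=> jJ; rewrite /occ sum_subsets_setU1 //; congr +%R.
rewrite mulr_sumr; apply: eq_bigr => A AJ.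
have jA : j \notin A by apply: contra jJ => /(fintype.subsetP AJ).
by rewrite ie_coef_setU1 // cardsU1 jA -iter_fdiffE mulrA.
Qed.

Lemma occ_setD1 J s T f j : j \in J ->
  occ J s T f = occ (J :\ j) s T f +
    c j * (s ^_ r)%:R * occ (J :\ j) (s - r) (T - p j) (fdiff f).
Proof. by move=> jJ; rewrite -occ_setU1 ?finset.setD1K// !inE eqxx. Qed.

Lemma iter_fdiffD k f g x : iter k fdiff (fun n => f n + g n) x =
  iter k fdiff f x + iter k fdiff g x.
Proof.
elim: k f g x => [//|k IH] f g x; rewrite !iterS /fdiff !IH; ring.
Qed.

Lemma iter_fdiffZ k a f x : iter k fdiff (fun n => a * f n) x =
  a * iter k fdiff f x.
Proof.
elim: k f x => [//|k IH] f x; rewrite !iterS /fdiff !IH; ring.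
Qed.

Lemma occD J s T f g :
  occ J s T (fun n => f n + g n) = occ J s T f + occ J s T g.
Proof.
by rewrite /occ -big_split /=; apply: eq_bigr => A _; rewrite iter_fdiffD mulrDr.
Qed.

Lemma occZ J s T a f : occ J s T (fun n => a * f n) = a * occ J s T f.
Proof.
rewrite /occ mulr_sumr; apply: eq_bigr => A _; rewrite iter_fdiffZ; ring.
Qed.

Lemma occB J s T f g :
  occ J s T (fun n => f n - g n) = occ J s T f - occ J s T g.
Proof.
rewrite (_ : (fun n => f n - g n) = fun n => f n + -1 * g n).
  by rewrite occD occZ mulN1r.
by apply/funext => n; rewrite mulN1r.
Qed.

Lemma occ_cst J s T (a : R) : occ J s T (fun=> a) = a * T ^+ s.
Proof.
rewrite /occ (bigD1 finset.set0) ?finset.sub0set //= big1.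
  rewrite /ie_coef cards0 muln0 ffactn0 !finset.big_set0 subn0 subr0 addr0 /=; ring.
move=> A /andP[_]; rewrite -card_gt0; case: #|A| => // k _.
suff -> : iter k.+1 fdiff (fun=> a) 0%N = 0 by rewrite mulr0.
elim: k (0%N) => [|k IH] x; first by rewrite /= /fdiff subrr.
by rewrite iterS /fdiff !IH subrr.
Qed.

(** Leibniz rule: second differences of the identity vanish, so only one extra
    term survives. *)
Lemma iter_fdiff_mulid k f x : iter k.+1 fdiff (fun w => w%:R * f w) x =
  x%:R * iter k.+1 fdiff f x + k.+1%:R * iter k fdiff f x.+1.
Proof.
elim: k x => [|k IH] x; first by rewrite /= /fdiff -natr1; ring.
have e y : iter k.+1 fdiff f y = iter k fdiff f y.+1 - iter k fdiff f y by [].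
have e2 y : iter k.+2 fdiff f y = iter k.+1 fdiff f y.+1 - iter k.+1 fdiff f y.
  by [].
rewrite iterS [LHS]/fdiff !IH e2 !e -!natr1; ring.
Qed.

Lemma iter_fdiff_shift k f x :
  iter k fdiff (fun w => f w.+1) x = iter k fdiff f x.+1.
Proof. by elim: k x => [//|k IH] x; rewrite !iterS /fdiff !IH. Qed.

(** Size-biasing: multiplying by the count selects one of the counted boxes. *)
Lemma occ_mulid J s T f :
  occ J s T (fun w => w%:R * f w) =
  \sum_(j in J) c j * (s ^_ r)%:R *
    occ (J :\ j) (s - r) (T - p j) (fun w => f w.+1).
Proof.
transitivity (\sum_(A : {set I} | A \subset J) (\sum_(a in A) 1) *
    (ie_coef s T A * iter #|A|.-1 fdiff (fun w => f w.+1) 0%N)).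
  apply: eq_bigr => A _; rewrite sumr_const.
  case: #|A| => [|k]; first by rewrite /= mul0r !mul0r mulr0.
  by rewrite iter_fdiff_mulid mul0r add0r iter_fdiff_shift /=; ring.
rewrite sum_subsets_mark; apply: eq_bigr => j jJ; rewrite mul1r /occ mulr_sumr.
apply: eq_bigr => A AJ.
have jA : j \notin A.
  by apply/negP => /(fintype.subsetP AJ); rewrite !inE eqxx.
by rewrite ie_coef_setU1 // cardsU1 jA /= mulrA.
Qed.

Lemma ffactSl s k : (s.+1 ^_ k = s ^_ k + k * s ^_ k.-1)%N.
Proof.
case: k => [|k] //=; rewrite ffactSS ffactnSr.
have [ks|sk] := leqP k s; last by rewrite ffact_small // !muln0 !mul0n.
have -> : s.+1 = ((s - k) + k.+1)%N by rewrite addnS subnK.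
by rewrite mulnDl [X in (X + _)%N]mulnC.
Qed.

(** Conditioning on the last ball: either it lands in a box of A, which supplies
    the first term, or outside A, with mass T minus that of A. *)
Lemma ie_coefS s T A :
  ie_coef s.+1 T A - T * ie_coef s T A =
  (r * #|A|)%:R * ((s ^_ (r * #|A|).-1)%:R * (\prod_(a in A) c a) *
     (T - \sum_(a in A) p a) ^+ (s.+1 - r * #|A|)) -
  (\sum_(a in A) p a) * ie_coef s T A.
Proof.
rewrite /ie_coef; set k := (r * #|A|)%N; set P := \sum_(a in A) p a.
set C := \prod_(a in A) c a.
rewrite ffactSl natrD natrM.
have [ks|sk] := leqP k s; first by rewrite subSn // exprS; ring.
by rewrite (ffact_small sk); ring.
Qed.

(** The effect of one more ball is a sum over the boxes it may complete or
    spoil. *)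
Lemma occS J s T f : (0 < r)%N ->
  occ J s.+1 T f - T * occ J s T f =
  \sum_(j in J)
    (c j * r%:R * (s ^_ r.-1)%:R *
       occ (J :\ j) (s.+1 - r) (T - p j) (fdiff f) -
     c j * p j * (s ^_ r)%:R * occ (J :\ j) (s - r) (T - p j) (fdiff f)).
Proof.
move=> r0; transitivity
  (\sum_(A : {set I} | A \subset J) (\sum_(a in A) r%:R) *
     ((s ^_ (r * #|A|).-1)%:R * (\prod_(a in A) c a) *
      (T - \sum_(a in A) p a) ^+ (s.+1 - r * #|A|) * iter #|A| fdiff f 0%N) -
   \sum_(A : {set I} | A \subset J) (\sum_(a in A) p a) *
     (ie_coef s T A * iter #|A| fdiff f 0%N)).
  rewrite /occ mulr_sumr -!sumrB; apply: eq_bigr => A _.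
  rewrite mulrA -mulrBl ie_coefS sumr_const -(mulr_natr r%:R) -natrM; ring.
rewrite !sum_subsets_mark sumrB; congr (_ - _); apply: eq_bigr => j jJ.
  rewrite /occ !mulr_sumr; apply: eq_bigr => A AJ.
  have jA : j \notin A.
    by apply/negP => /(fintype.subsetP AJ); rewrite !inE eqxx.
  rewrite cardsU1 jA !big_setU1 // [(_ + #|A|)%N]add1n mulnS.
  rewrite iter_fdiffE /= /ie_coef subnDA opprD addrA.
  have -> : (r + r * #|A|).-1 = (r.-1 + r * #|A|)%N by case: (r) r0.
  rewrite ffactD natrM.
  have -> : (s - r.-1 = s.+1 - r)%N by lia.
  ring.
rewrite /occ !mulr_sumr; apply: eq_bigr => A AJ.
have jA : j \notin A.
  by apply/negP => /(fintype.subsetP AJ); rewrite !inE eqxx.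
by rewrite ie_coef_setU1 // cardsU1 jA [(_ + #|A|)%N]add1n iter_fdiffE; ring.
Qed.

Lemma bin_ffact_sub s m k : (m + k <= s)%N ->
  ('C(s, m) * (s - m) ^_ k = s ^_ k * 'C(s - k, m))%N.
Proof.
move=> mk; apply/eqP; rewrite -(eqn_pmul2r (fact_gt0 m)).
rewrite mulnAC bin_ffact -mulnA bin_ffact -!ffactD.
by rewrite addnC.
Qed.

Lemma ie_coef_convolution s T x A :
  \sum_(m < s.+1) 'C(s, m)%:R * x ^+ m * ie_coef (s - m) (T - x) A =
  ie_coef s T A.
Proof.
rewrite /ie_coef; set k := (r * #|A|)%N; set P := \sum_(a in A) p a.
set C := \prod_(a in A) c a.
have [ks|sk] := leqP k s; last first.
  rewrite (ffact_small sk) !mul0r big1 // => m _.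
  by rewrite ffact_small ?(leq_ltn_trans (leq_subr _ _)) // !mul0r mulr0.
rewrite -(big_mkord xpredT (fun m => 'C(s, m)%:R * x ^+ m *
  (((s - m) ^_ k)%:R * C * (T - x - P) ^+ (s - m - k)))).
rewrite (@big_cat_nat _ _ _ (s - k).+1) //=; last by rewrite ltnS leq_subr.
rewrite [X in _ + X]big_nat_cond [X in _ + X]big1 ?addr0; last first.
  move=> m /andP[/andP[h1 h2] _]; rewrite ffact_small; first by rewrite !(mul0r,mulr0).
  by lia.
have -> : T - P = (T - x - P) + x by ring.
rewrite exprDn big_mkord mulr_sumr; apply: eq_bigr => m _.
have mk : (m + k <= s)%N by have := ltn_ord m; lia.
have -> : (s - m - k = s - k - m)%N by lia.
have := congr1 (fun n => n%:R : R) (bin_ffact_sub mk); rewrite !natrM => e.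
rewrite -(mulr_natl _ 'C(_, _)).
transitivity (('C(s, m)%:R * ((s - m) ^_ k)%:R) * C * x ^+ m * (T - x - P) ^+ (s - k - m)); first ring.
by rewrite e; ring.
Qed.

(** Splitting off a region of mass x that meets no box of J: m is the number of
    balls falling in it. *)
Lemma occ_convolution J s T x f :
  \sum_(m < s.+1) 'C(s, m)%:R * x ^+ m * occ J (s - m) (T - x) f =
  occ J s T f.
Proof.
rewrite /occ; under eq_bigr do rewrite mulr_sumr.
rewrite exchange_big /=; apply: eq_bigr => A _.
rewrite -(ie_coef_convolution s T x A) mulr_suml.
by apply: eq_bigr => m _; rewrite mulrA.
Qed.

End inclusion_exclusion.

(** * Averages over fair coin tosses *)

Section averaging.
Variable R : realType.
Implicit Types (f g h : nat -> R).

(** iter a avg f k is the mean of f (k + S) with S binomial of parameters a and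
    1/2. *)
Definition avg f : nat -> R := fun k => (f k + f k.+1) / 2.

Lemma iter_avgD a f g x : iter a avg (fun k => f k + g k) x =
  iter a avg f x + iter a avg g x.
Proof. by elim: a x => [//|a IH] x; rewrite !iterS /avg !IH; field. Qed.

Lemma iter_avgZ a b f x : iter a avg (fun k => b * f k) x = b * iter a avg f x.
Proof. by elim: a x => [//|a IH] x; rewrite !iterS /avg !IH; field. Qed.

Lemma iter_avg_cst a b x : iter a avg (fun=> b) x = b.
Proof. by elim: a x => [//|a IH] x; rewrite !iterS /avg !IH; field. Qed.

Lemma iter_avg_shift a f y x :
  iter a avg (fun k => f (y + k)%N) x = iter a avg f (y + x)%N.
Proof. by elim: a x => [//|a IH] x; rewrite !iterS /avg !IH addnS. Qed.

Lemma ler_iter_avg a f g x : (forall k, f k <= g k) ->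
  iter a avg f x <= iter a avg g x.
Proof.
move=> fg; elim: a x => [//|a IH] x; rewrite !iterS /avg.
by rewrite ler_pM2r ?invr_gt0 // lerD.
Qed.

Lemma ler_norm_iter_avg a f x :
  `|iter a avg f x| <= iter a avg (fun k => `|f k|) x.
Proof.
elim: a x => [//|a IH] x; rewrite !iterS /avg normrM (ger0_norm (_ : 0 <= 2^-1)) //.
by rewrite ler_pM2r ?invr_gt0 // (le_trans (ler_normD _ _)) // lerD.
Qed.

Lemma fdiff_iter_avg a f : fdiff (iter a avg f) = iter a avg (fdiff f).
Proof.
elim: a => [//|a IH]; rewrite !iterS -IH; apply/funext => k.
by rewrite /fdiff /avg; field.
Qed.

(** The averaging counterpart of the Leibniz rule: the mean of S * f (S) for S
    binomial is its mean times that of f shifted by 1. *)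
Lemma iter_avg_mulid a f x : iter a.+1 avg (fun k => k%:R * f k) x =
  x%:R * iter a.+1 avg f x + a.+1%:R / 2 * iter a avg (fun k => f k.+1) x.
Proof.
elim: a x => [|a IH] x; first by rewrite /= /avg -natr1; field.
have e b g y : iter b.+1 avg g y = (iter b avg g y + iter b avg g y.+1) / 2 by [].
have sh y : iter a avg (fun k => f k.+1) y = iter a avg f y.+1.
  by have := iter_avg_shift a f 1 y.
have shS y : iter a.+1 avg (fun k => f k.+1) y = iter a.+1 avg f y.+1.
  by have := iter_avg_shift a.+1 f 1 y.
rewrite e !IH shS !sh !e -!natr1; by field.
Qed.

(** Integration by parts for the symmetric binomial law: summation against a
    difference becomes summation against the centred variable. *)
Lemma iter_avg_fdiff a h :
  iter a avg (fdiff h) 0%N = 2 / a.+1%:R *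
    iter a.+1 avg (fun k => (2 * k%:R - a.+1%:R) * h k) 0%N.
Proof.
have -> : (fun k : nat => (2 * k%:R - a.+1%:R) * h k) =
    (fun k => 2 * (k%:R * h k) + - a.+1%:R * h k).
  by apply/funext => k; ring.
rewrite (iter_avgD _ (fun k => 2 * (k%:R * h k)) (fun k => - a.+1%:R * h k)).
rewrite (iter_avgZ _ 2 (fun k => k%:R * h k)) (iter_avgZ _ (- _) h).
rewrite iter_avg_mulid mul0r add0r.
have -> : iter a avg (fun k => h k.+1) 0%N = iter a avg h 1%N.
  by have := iter_avg_shift a h 1 0.
rewrite -fdiff_iter_avg /fdiff iterS /avg.
have : a.+1%:R != 0 :> R by rewrite pnatr_eq0.
by move=> ?; field.
Qed.

Lemma iter_avg_var a :
  iter a.+1 avg (fun k => (2 * k%:R - a.+1%:R) ^+ 2) 0%N = a.+1%:R :> R.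
Proof.
have a0 : a.+1%:R != 0 :> R by rewrite pnatr_eq0.
apply: (@mulfI _ (2 / a.+1%:R)); first by rewrite mulf_neq0 ?invr_eq0.
under [in LHS]eq_fun do rewrite expr2.
rewrite -iter_avg_fdiff.
have -> : fdiff (fun k => 2 * k%:R - a.+1%:R) = fun=> 2 :> R.
  by apply/funext => k; rewrite /fdiff -natr1; ring.
by rewrite iter_avg_cst divfK.
Qed.

(** By the integration by parts, h is tested against the centred binomial
    variable, whose mean modulus is at most its standard deviation. *)
Lemma ler_iter_avg_fdiff a h L x : (forall k, `|h k| <= L) ->
  `|iter a avg (fdiff h) x| <= 2 * L / Num.sqrt a.+1%:R.
Proof.
move=> hL; rewrite -{1}(addn0 x) -iter_avg_shift.
have -> : (fun k => fdiff h (x + k)%N) = fdiff (fun k => h (x + k)%N).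
  by apply/funext => k; rewrite /fdiff addnS.
rewrite iter_avg_fdiff normrM; set N : R := a.+1%:R.
have N0 : 0 < N by rewrite ltr0n.
have sN : 0 < Num.sqrt N by rewrite sqrtr_gt0.
have L0 : 0 <= L by apply: le_trans (hL 0%N).
have key : `|iter a.+1 avg (fun k => (2 * k%:R - N) * h (x + k)%N) 0%N| <=
    L * Num.sqrt N.
  apply: (le_trans (ler_norm_iter_avg _ _ _)).
  apply: (@le_trans _ _ (iter a.+1 avg (fun k => L / 2 * Num.sqrt N +
      L / 2 / Num.sqrt N * (2 * k%:R - N) ^+ 2) 0%N)).
    apply: ler_iter_avg => k; rewrite normrM.
    set y := 2 * k%:R - N; apply: (@le_trans _ _ (`|y| * L)).
      by rewrite ler_wpM2l.
    rewrite -[y ^+ 2]real_normK ?num_real //.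
    rewrite -subr_ge0 (_ : _ - _ = L / 2 / Num.sqrt N * (`|y| - Num.sqrt N) ^+ 2).
      by rewrite mulr_ge0 ?sqr_ge0 // !divr_ge0 // ltW.
    by field; rewrite gt_eqF.
  rewrite iter_avgD iter_avg_cst iter_avgZ iter_avg_var -/N.
  rewrite -{3}(sqr_sqrtr (ltW N0)) le_eqVlt; apply/orP; left; apply/eqP.
  by field; rewrite gt_eqF.
rewrite (ger0_norm (_ : 0 <= 2 / N)); last by rewrite divr_ge0 // ltW.
apply: (le_trans (ler_wpM2l _ key)); first by rewrite divr_ge0 // ltW.
rewrite -{1}(sqr_sqrtr (ltW N0)) le_eqVlt; apply/orP; left; apply/eqP.
by field; rewrite gt_eqF.
Qed.

(** Half of the coins smooth h itself: the sums of |h| are a bounded primitive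
    of it, so each half gains a factor of order the inverse square root. *)
Lemma ler_iter_avg_fdiff1 a h L x : (forall N, \sum_(k < N) `|h k| <= L) ->
  `|iter a avg (fdiff h) x| <= 8 * L / a.+1%:R.
Proof.
move=> hL.
have L0 : 0 <= L by apply: le_trans (hL 0%N); rewrite big_ord0.
(* Both halves of the coins count at least (a + 1) / 2 after adding 1. *)
pose a1 := a./2; pose a2 := (a - a./2)%N.
have -> : iter a avg (fdiff h) x = iter a1 avg (fdiff (iter a2 avg h)) x.
  rewrite fdiff_iter_avg -iterD; suff -> : (a1 + a2)%N = a by [].
  by rewrite /a1 /a2; lia.
have h2 k : `|iter a2 avg h k| <= 2 * L / Num.sqrt a2.+1%:R.
  pose H k := \sum_(i < k) `|h i|.
  have fH : fdiff H = fun k => `|h k|.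
    by apply/funext => i; rewrite /fdiff /H big_ord_recr /=; ring.
  apply: (le_trans (ler_norm_iter_avg _ _ _)); rewrite -fH.
  apply: (le_trans (ler_norm _)); apply: ler_iter_avg_fdiff => i.
  by rewrite ger0_norm ?hL // sumr_ge0.
apply: (le_trans (ler_iter_avg_fdiff _ _ h2)).
set u := Num.sqrt a1.+1%:R; set v := Num.sqrt a2.+1%:R; set N : R := a.+1%:R.
have N0 : 0 < N by rewrite ltr0n.
have sN : 0 < Num.sqrt N by rewrite sqrtr_gt0.
have u0 : 0 < u by rewrite sqrtr_gt0 ltr0n.
have v0 : 0 < v by rewrite sqrtr_gt0 ltr0n.
have uN : Num.sqrt N <= Num.sqrt 2 * u.
  by rewrite -sqrtrM // ler_sqrt ?mulr_ge0 // -natrM ler_nat /a1; lia.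
have vN : Num.sqrt N <= Num.sqrt 2 * v.
  by rewrite -sqrtrM // ler_sqrt ?mulr_ge0 // -natrM ler_nat /a2; lia.
have uvN : N <= 2 * (u * v).
  rewrite -(sqr_sqrtr (ltW N0)) expr2.
  have -> : 2 * (u * v) = (Num.sqrt 2 * u) * (Num.sqrt 2 * v).
    by rewrite -{1}(@sqr_sqrtr R 2) //; ring.
  by apply: ler_pM => //; apply: ltW.
have -> : 2 * (2 * L / v) / u = 4 * L / (u * v) by field; rewrite !gt_eqF.
rewrite ler_pdivlMr // mulrAC ler_pdivrMr ?mulr_gt0 //.
have -> : 8 * L * (u * v) = 4 * L * (2 * (u * v)) by ring.
by rewrite ler_wpM2l // mulr_ge0.
Qed.

(** As avg is the identity plus half of fdiff, each difference in the number of
    coins contributes a factor 1/2 and a difference of f. *)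
Lemma iter_fdiff_avg k (f : nat -> R) x a :
  iter k fdiff (fun a => iter a avg f x) a = 2 ^- k * iter a avg (iter k fdiff f) x.
Proof.
elim: k f a => [|k IH] f a; first by rewrite /= expr0 invr1 mul1r.
rewrite iter_fdiffE.
have -> : fdiff (fun a => iter a avg f x) =
    fun a => iter a avg (fun y => 2^-1 * fdiff f y) x.
  apply/funext => b; rewrite {1}/fdiff iterSr.
  have -> : avg f = fun y => f y + 2^-1 * fdiff f y.
    by apply/funext => y; rewrite /avg /fdiff; field.
  by rewrite (iter_avgD _ f); ring.
rewrite IH.
have -> : iter k fdiff (fun y => 2^-1 * fdiff f y) =
    fun y => 2^-1 * iter k.+1 fdiff f y.
  by apply/funext => y; rewrite iter_fdiffZ iter_fdiffE.
by rewrite iter_avgZ exprSr invfM mulrA.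
Qed.

End averaging.
Arguments avg {R} f k.

(** * Thinning by fair coins *)

Lemma mul_bin_bin_ffact s r m :
  ('C(s, r + m) * 'C(r + m, r) * r`! = s ^_ r * 'C(s - r, m))%N.
Proof.
apply/eqP; rewrite -(eqn_pmul2r (fact_gt0 m)); apply/eqP.
rewrite -[in RHS]mulnA bin_ffact -ffactD -bin_ffact -!mulnA; congr muln.
by have := bin_fact (leq_addr m r); rewrite addKn.
Qed.

(** Pascal's rule: C(m, r) is a sum of two distinct terms of a row of sum
    2^(m-1), so that twice it is at most 2^m. *)
Lemma double_bin_le m r : (0 < r)%N -> (2 * 'C(m, r) <= 2 ^ m)%N.
Proof.
move=> r0; case: m => [|m]; first by case: r r0.
case: r r0 => // r _; rewrite binS expnS leq_pmul2l //.
have -> : (2 ^ m = \sum_(i < m.+1) 'C(m, i))%N.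
  rewrite -[2%N]/(1 + 1)%N Pascal; apply: eq_bigr => i _.
  by rewrite !exp1n !muln1.
have bin_le k : (k <= m)%N -> ('C(m, k) <= \sum_(i < m.+1) 'C(m, i))%N.
  by rewrite -ltnS => km; rewrite (bigD1 (Ordinal km)) //= leq_addr.
have [rm|mr] := ltnP r m; last first.
  rewrite bin_small // add0n; move: mr; rewrite leq_eqVlt => /predU1P[<-|mr].
    exact: bin_le.
  by rewrite bin_small.
have rm1 : (r.+1 < m.+1)%N by [].
rewrite (bigD1 (Ordinal rm1)) //= (bigD1 (Ordinal (ltnW rm1))) /=.
  by rewrite addnA leq_addr.
by rewrite -val_eqE /= neq_ltn ltnSn.
Qed.

Section thinning.
Variables (R : realType) (I : finType) (r : nat) (p : I -> R).
Hypothesis r_gt0 : (0 < r)%N.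
Hypothesis p_ge0 : forall i, 0 <= p i.
Implicit Types (J A : {set I}) (s : nat) (T : R) (f g : nat -> R).

Definition powfact (i : I) : R := p i ^+ r / r`!%:R.
(** Doubled weights: they give the law of a number of active regions, each of
    which is counted or not according to a fair coin. *)
Definition dpowfact (i : I) : R := 2 * powfact i.

Lemma occ_set0 c s T f : occ r c p finset.set0 s T f = T ^+ s * f 0%N.
Proof.
rewrite /occ (big_pred1 finset.set0) ?finset.sub0set //; last first.
  by move=> A; rewrite finset.subset0.
rewrite /ie_coef cards0 muln0 ffactn0 !finset.big_set0 subn0 subr0 /=; ring.
Qed.

(** The count is a binomial thinning of the count of active regions: the factor
    2^-#|A| of the averaged function compensates for the doubled weights. *)
Lemma occ_thin J s T f : occ r powfact p J s T f =
  occ r dpowfact p J s T (fun a => iter a avg f 0%N).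
Proof.
rewrite /occ; apply: eq_bigr => A _; rewrite (iter_fdiff_avg _ _ 0%N 0%N) /=.
rewrite /ie_coef.
have -> : \prod_(a in A) dpowfact a = 2 ^+ #|A| * \prod_(a in A) powfact a.
  by rewrite -prodr_const -big_split.
have : 2 ^+ #|A| != 0 :> R by rewrite expf_neq0.
by move=> ?; field.
Qed.

(** A region of mass 2 * p j around box j receives m balls, and is then active
    with probability 2 * C(m, r) / 2^m. *)
Lemma occ_thin_split J s T f j :
  dpowfact j * (s ^_ r)%:R * occ r dpowfact p J (s - r) (T - p j) f =
  \sum_(m < s.+1) 'C(s, m)%:R * (2 * p j) ^+ m *
     ((2 * 'C(m, r))%:R / 2 ^+ m * occ r dpowfact p J (s - m) (T - 2 * p j) f).
Proof.
have [rs|sr] := leqP r s; last first.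
  rewrite ffact_small // mulr0 mul0r big1 // => m _.
  rewrite (bin_small (_ : m < r)%N) ?muln0 ?mul0r ?mulr0 //.
  by apply: leq_trans sr; rewrite ltn_ord.
rewrite -(occ_convolution r dpowfact p J (s - r) (T - p j) (p j) f) mulr_sumr.
rewrite -(big_mkord xpredT (fun m => 'C(s, m)%:R * (2 * p j) ^+ m *
     ((2 * 'C(m, r))%:R / 2 ^+ m * occ r dpowfact p J (s - m) (T - 2 * p j) f))).
rewrite (@big_cat_nat _ _ _ r) ?(leqW rs) //=.
rewrite [X in _ = X + _]big_nat_cond [X in _ = X + _]big1 ?add0r; last first.
  move=> m; rewrite andbT => mr.
  by rewrite (bin_small (_ : m < r)%N) ?muln0 ?mul0r ?mulr0.
rewrite [in RHS](big_addn 0 s.+1 r) subSn // big_mkord; apply: eq_bigr => m _.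
rewrite subnDA -subnAC (_ : T - p j - p j = T - 2 * p j); last ring.
rewrite (addnC m r); set X := occ _ _ _ _ _ _ _.
have := congr1 (fun n => n%:R : R) (mul_bin_bin_ffact s r m); rewrite !natrM => e.
rewrite exprMn /dpowfact /powfact.
have r0 : r`!%:R != 0 :> R by rewrite pnatr_eq0 -lt0n fact_gt0.
have tr : 2 ^+ r != 0 :> R by rewrite expf_neq0.
have tm : 2 ^+ m != 0 :> R by rewrite expf_neq0.
apply: (@mulIf _ r`!%:R) => //.
transitivity (2 * p j ^+ r * ((s ^_ r)%:R * 'C(s - r, m)%:R) * p j ^+ m * X).
  by field.
by rewrite -e !exprD; field; apply/andP.
Qed.

(** The doubled weights define a positive functional, the law of the number of
    active regions, as long as the regions fit into the total mass: removing a
    region replaces f by a convex combination of f and its shift, because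
    2 * C(m, r) <= 2^m. *)
Lemma occ_thin_ge0 J s T f : (forall k, 0 <= f k) ->
  2 * \sum_(i in J) p i <= T -> 0 <= occ r dpowfact p J s T f.
Proof.
move: {2}#|J| (erefl #|J|) => n; elim: n J s T f => [|n IH] J s T f.
  move=> /eqP; rewrite cards_eq0 => /eqP -> f0; rewrite finset.big_set0 mulr0.
  by move=> T0; rewrite occ_set0 mulr_ge0 ?exprn_ge0.
move=> Jn f0 pT; have /card_gt0P[j jJ] : (0 < #|J|)%N by rewrite Jn.
have Jn' : #|J :\ j| = n by move: Jn; rewrite (cardsD1 j) jJ add1n => -[].
have pT' : 2 * \sum_(i in J :\ j) p i <= T - 2 * p j.
  by move: pT; rewrite (big_setD1 j) //= mulrDr; lra.
rewrite (occ_setD1 _ _ _ _ _ _ jJ) occ_thin_split.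
rewrite -(occ_convolution r dpowfact p (J :\ j) s T (2 * p j) f) -big_split /=.
apply: sumr_ge0 => m _; rewrite -mulrDr -occZ -occD mulr_ge0 //.
  by rewrite mulr_ge0 ?exprn_ge0 ?mulr_ge0.
apply: IH => // k; rewrite /fdiff; set y := _ / _.
have y0 : 0 <= y by rewrite divr_ge0 ?exprn_ge0.
have y1 : y <= 1.
  by rewrite ler_pdivrMr ?exprn_gt0 // mul1r -natrX ler_nat double_bin_le.
have := f0 k; have := f0 k.+1; nra.
Qed.

End thinning.

(** * Smoothness of the number of occupied boxes *)

Section elementary.
Variable R : realFieldType.
Implicit Types (x y u v : R).

Lemma exprD1_le v k : 0 <= v <= 1 -> (1 + v) ^+ k <= 1 + (2 ^+ k - 1) * v.
Proof.
move=> /andP[v0 v1]; elim: k => [|k IH]; first by rewrite !expr0 subrr mul0r addr0.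
rewrite !exprSr; apply: (@le_trans _ _ ((1 + (2 ^+ k - 1) * v) * (1 + v))).
  by rewrite ler_pM2r //; lra.
have : 1 <= 2 ^+ k :> R by rewrite exprn_ege1 // ler1n.
set a := 2 ^+ k => a1.
have : 0 <= (a - 1) * v * (1 - v) by rewrite !mulr_ge0 //; lra.
nra.
Qed.

(** Two disjoint boxes of masses x and y are nearly independent: the left side is
    the chance to avoid both. *)
Lemma expr_subD_le x y r k : 0 <= x <= 1 / 4 -> 0 <= y <= 1 / 4 ->
  (1 - x - y) ^+ k <=
  (1 - x) ^+ (k + r) * (1 - y) ^+ (k + r) * (1 + 2 ^+ r.+1 * (x + y)).
Proof.
move=> /andP[x0 x1] /andP[y0 y1]; rewrite -exprMn exprD -mulrA.
set w := (1 - x) * (1 - y).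
have w0 : 0 <= w by rewrite /w mulr_ge0 //; lra.
have h1 : (1 - x - y) ^+ k <= w ^+ k.
  by rewrite lerXn2r // ?nnegrE /w; nra.
have h2 : 1 <= w ^+ r * (1 + 2 ^+ r.+1 * (x + y)).
  apply: (@le_trans _ _ (w ^+ r * (1 + 2 * (x + y)) ^+ r)).
    by rewrite -exprMn exprn_ege1 // /w; nra.
  apply: ler_wpM2l; first exact: exprn_ge0.
  apply: (le_trans (exprD1_le _ _)); first by apply/andP; split; lra.
  have : 1 <= 2 ^+ r :> R by rewrite exprn_ege1 // ler1n.
  by rewrite exprS; nra.
apply: (le_trans h1); rewrite -[leLHS]mulr1; apply: ler_wpM2l => //.
exact: exprn_ge0.
Qed.

Lemma binomial_pmf_le1 x s k : 0 <= x <= 1 -> (k <= s)%N ->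
  'C(s, k)%:R * x ^+ k * (1 - x) ^+ (s - k) <= 1.
Proof.
move=> /andP[x0 x1] ks.
have := exprDn (1 - x) x s; rewrite subrK expr1n => e; rewrite [leRHS]e.
have kS : (k < s.+1)%N by [].
rewrite (bigD1 (Ordinal kS)) //= -[X in _ <= X + _]mulr_natl.
rewrite -mulrA [x ^+ k * _]mulrC lerDl; apply: sumr_ge0 => i _; rewrite mulrn_wge0 // mulr_ge0 ?exprn_ge0 //; lra.
Qed.

(** A bound of 1 / (1 + a) in terms of moments of a: if a is below half of m then
    its deviation from m is large. *)
Lemma inv1D_le (a m : R) : 0 <= a -> 0 < m ->
  (1 + a)^-1 <= 2 / m + 4 / m ^+ 2 * (a - m) ^+ 2.
Proof.
move=> a0 m0; have [am|ma] := leP (m / 2) a.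
  apply: (@le_trans _ _ (2 / m)); last first.
    by rewrite lerDl mulr_ge0 ?sqr_ge0 // divr_ge0 // sqr_ge0.
  rewrite -[2 / m]invf_div lef_pV2 ?posrE ?divr_gt0 //; lra.
apply: (@le_trans _ _ 1).
  by rewrite invf_le1; lra.
apply: (@le_trans _ _ (4 / m ^+ 2 * (a - m) ^+ 2)); last first.
  by rewrite lerDr divr_ge0 // ltW.
rewrite mulrAC ler_pdivlMr ?exprn_gt0 // mul1r.
have : m / 2 <= m - a by lra.
by rewrite !expr2; nra.
Qed.

End elementary.

Section smoothing.
Variables (R : realType) (I : finType) (r : nat) (p : I -> R).
Hypothesis r_gt0 : (0 < r)%N.
Hypothesis p_ge0 : forall i, 0 <= p i.
Implicit Types (J A : {set I}) (s : nat) (T : R) (f g h : nat -> R).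

(** The probability that box i receives exactly r of s balls, when the total mass
    is T. *)
Definition hit s T i : R :=
  powfact r p i * (s ^_ r)%:R * (T - p i) ^+ (s - r) / T ^+ s.

(** The expectation of f at the number of boxes of J with r balls, for s balls
    thrown with the probabilities p i / T. *)
Definition eocc J s T f : R := occ r (powfact r p) p J s T f / T ^+ s.

Lemma powfact_ge0 i : 0 <= powfact r p i.
Proof. by rewrite divr_ge0 // exprn_ge0. Qed.

Lemma hit_ge0 s T i : 0 <= T -> p i <= T -> 0 <= hit s T i.
Proof.
move=> T0 pT; rewrite /hit divr_ge0 ?exprn_ge0 //.
by rewrite !mulr_ge0 ?powfact_ge0 // exprn_ge0 // subr_ge0.
Qed.

Lemma hitE s T i : 0 < T -> (r <= s)%N ->
  hit s T i = 'C(s, r)%:R * (p i / T) ^+ r * (1 - p i / T) ^+ (s - r).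
Proof.
move=> T0 rs; rewrite /hit /powfact -bin_ffact natrM.
have -> : 1 - p i / T = (T - p i) / T by field; rewrite gt_eqF.
rewrite !expr_div_n -{3}(subnK rs) exprD.
have r0 : r`!%:R != 0 :> R by rewrite pnatr_eq0 -lt0n fact_gt0.
have T1 : T ^+ r != 0 by rewrite expf_neq0 // gt_eqF.
have T2 : T ^+ (s - r) != 0 by rewrite expf_neq0 // gt_eqF.
by field; apply/and3P.
Qed.

Lemma hit_le1 s T i : 0 < T -> p i <= T -> hit s T i <= 1.
Proof.
move=> T0 pT; have [rs|sr] := leqP r s; last first.
  by rewrite /hit ffact_small // mulr0 !mul0r.
rewrite hitE // binomial_pmf_le1 // divr_ge0 ?(ltW T0) //=.
by rewrite ler_pdivrMr // mul1r.
Qed.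

(** Two boxes hold r balls each with a probability not much larger than the
    product; the left side is that joint probability. *)
Lemma pair_hit_le s T i j : 0 < T -> 4 * p i <= T -> 4 * p j <= T ->
  powfact r p j * (s ^_ r)%:R * (powfact r p i * ((s - r) ^_ r)%:R *
    (T - p j - p i) ^+ (s - r - r)) / T ^+ s <=
  hit s T j * hit s T i * (1 + 2 ^+ r.+1 * (p j / T + p i / T)).
Proof.
move=> T0 pi pj; have pi0 := p_ge0 i; have pj0 := p_ge0 j.
have rhs0 : 0 <= hit s T j * hit s T i * (1 + 2 ^+ r.+1 * (p j / T + p i / T)).
  apply: mulr_ge0; first by apply: mulr_ge0; apply: hit_ge0; lra.
  by rewrite addr_ge0 // mulr_ge0 ?exprn_ge0 // addr_ge0 // divr_ge0 // ltW.
have [rs|sr] := leqP (r + r) s; last first.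
  by rewrite (@ffact_small (s - r)) ?mulr0 ?mul0r ?mulr0 ?mul0r //; lia.
pose k := (s - (r + r))%N.
have sE : s = (k + r + r)%N by rewrite /k; lia.
have -> : (s - r - r = k)%N by rewrite /k; lia.
have x1 : 0 <= p j / T <= 1 / 4.
  by rewrite divr_ge0 ?(ltW T0) //= ler_pdivrMr //; lra.
have y1 : 0 <= p i / T <= 1 / 4.
  by rewrite divr_ge0 ?(ltW T0) //= ler_pdivrMr //; lra.
have := expr_subD_le r k x1 y1.
set x := p j / T in x1 *; set y := p i / T in y1 *; set F := 1 + 2 ^+ r.+1 * (x + y) => key.
have ej : T - p j - p i = T * (1 - x - y) by rewrite /x /y; field; rewrite gt_eqF.
have h z : hit s T z = powfact r p z * (s ^_ r)%:R * (1 - p z / T) ^+ (k + r) / T ^+ r.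
  rewrite /hit (_ : T - p z = T * (1 - p z / T)); last by field; rewrite gt_eqF.
  rewrite (_ : s - r = k + r)%N; last by rewrite {1}sE; clear; lia.
  rewrite {2}sE exprMn (exprD T (k + r)).
  have T1 : T ^+ r != 0 by rewrite expf_neq0 // gt_eqF.
  have T2 : T ^+ (k + r) != 0 by rewrite expf_neq0 // gt_eqF.
  by field; apply/andP.
have Ts : T ^+ s = T ^+ k * (T ^+ r * T ^+ r).
  by rewrite {1}sE -addnA !exprD.
rewrite !h ej -/x -/y -/F exprMn Ts.
have T1 : T ^+ r != 0 by rewrite expf_neq0 // gt_eqF.
have T2 : T ^+ k != 0 by rewrite expf_neq0 // gt_eqF.
have -> : powfact r p j * (s ^_ r)%:R * (powfact r p i * ((s - r) ^_ r)%:R *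
    (T ^+ k * (1 - x - y) ^+ k)) / (T ^+ k * (T ^+ r * T ^+ r)) =
   (powfact r p j * powfact r p i / (T ^+ r * T ^+ r)) *
   ((s ^_ r)%:R * ((s - r) ^_ r)%:R * (1 - x - y) ^+ k).
  by field; apply/andP.
have -> : powfact r p j * (s ^_ r)%:R * (1 - x) ^+ (k + r) / T ^+ r *
  (powfact r p i * (s ^_ r)%:R * (1 - y) ^+ (k + r) / T ^+ r) * F =
  (powfact r p j * powfact r p i / (T ^+ r * T ^+ r)) *
   ((s ^_ r)%:R * (s ^_ r)%:R * ((1 - x) ^+ (k + r) * (1 - y) ^+ (k + r) * F)).
  by field.
apply: ler_wpM2l.
  by rewrite divr_ge0 ?mulr_ge0 ?powfact_ge0 // exprn_ge0 // ltW.
apply: ler_pM => //; first by apply: exprn_ge0; lra.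
apply: ler_pM => //.
rewrite ler_nat; clear; elim: r => [//|q IH].
rewrite !ffactnSr; apply: leq_mul; last by rewrite leq_sub2r // leq_subr.
have : ((s - q.+1) ^_ q <= (s - q) ^_ q)%N.
  by rewrite -!bin_ffact leq_mul2r leq_bin2l ?orbT // leq_sub2l.
by move=> /leq_trans; apply.
Qed.

(** Expectation with respect to the number of active regions. *)
Let psi J s T f := occ r (dpowfact r p) p J s T f / T ^+ s.

Lemma psi_ge0 J s T f : 0 < T -> 2 * \sum_(i in J) p i <= T ->
  (forall k, 0 <= f k) -> 0 <= psi J s T f.
Proof.
move=> T0 pT f0; rewrite /psi divr_ge0 ?exprn_ge0 ?(ltW T0) //.
exact: occ_thin_ge0.
Qed.

Lemma psiD J s T f g : psi J s T (fun n => f n + g n) = psi J s T f + psi J s T g.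
Proof. by rewrite /psi occD mulrDl. Qed.

Lemma psiZ J s T a f : psi J s T (fun n => a * f n) = a * psi J s T f.
Proof. by rewrite /psi occZ mulrA. Qed.

Lemma psi_cst J s T a : 0 < T -> psi J s T (fun=> a) = a.
Proof. by move=> T0; rewrite /psi occ_cst mulfK // expf_neq0 // gt_eqF. Qed.

Lemma ler_psi J s T f g : 0 < T -> 2 * \sum_(i in J) p i <= T ->
  (forall k, f k <= g k) -> psi J s T f <= psi J s T g.
Proof.
move=> T0 pT fg; rewrite -subr_ge0 -mulN1r -psiZ -psiD psi_ge0 // => k.
by rewrite mulN1r subr_ge0.
Qed.

Lemma ler_norm_psi J s T f : 0 < T -> 2 * \sum_(i in J) p i <= T ->
  `|psi J s T f| <= psi J s T (fun k => `|f k|).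
Proof.
move=> T0 pT; rewrite ler_norml; apply/andP; split.
  rewrite -mulN1r -psiZ; apply: ler_psi => // k; rewrite mulN1r lerNl.
  by rewrite -normrN ler_norm.
by apply: ler_psi => // k; exact: ler_norm.
Qed.

Lemma psi_mean J s T : psi J s T (fun k => k%:R) = 2 * \sum_(i in J) hit s T i.
Proof.
rewrite /psi (_ : (fun k => k%:R) = fun k : nat => k%:R * 1); last first.
  by apply/funext => k; rewrite mulr1.
rewrite (occ_mulid r (dpowfact r p) p J s T (fun=> 1)) mulr_suml mulr_sumr.
by apply: eq_bigr => j jJ; rewrite occ_cst /hit /dpowfact; ring.
Qed.

(** The square of the count, minus the count, is the number of ordered pairs of
    distinct active regions. *)
Lemma psi_sqr J s T : psi J s T (fun k => k%:R * k%:R) =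
  2 * \sum_(i in J) hit s T i + 4 * \sum_(j in J) \sum_(i in J :\ j)
  powfact r p j * (s ^_ r)%:R * (powfact r p i * ((s - r) ^_ r)%:R *
    (T - p j - p i) ^+ (s - r - r)) / T ^+ s.
Proof.
rewrite /psi (occ_mulid r (dpowfact r p) p J s T (fun k => k%:R)).
rewrite mulr_suml !mulr_sumr -big_split /=.
apply: eq_bigr => j jJ.
have -> : (fun w : nat => w.+1%:R) = fun w : nat => w%:R * 1 + 1 :> R.
  by apply/funext => k; rewrite -natr1 mulr1.
rewrite (occD _ _ _ _ _ _ (fun w : nat => w%:R * 1)).
rewrite (occ_mulid r (dpowfact r p) p (J :\ j) (s - r) (T - p j) (fun=> 1)).
rewrite occ_cst mulrDr mulrDl [LHS]addrC; congr (_ + _).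
  by rewrite /hit /dpowfact; ring.
rewrite !mulr_sumr mulr_suml; apply: eq_bigr => i iJ.
by rewrite occ_cst /dpowfact; ring.
Qed.

(** Near independence of pairs makes the variance of order the mean; the excess is
    summed with the help of the total mass at most T / 2. *)
Lemma psi_var_le J s T (m := 2 * \sum_(i in J) hit s T i) : 0 < T -> 2 * \sum_(i in J) p i <= T ->
  (forall i, i \in J -> 4 * p i <= T) ->
  psi J s T (fun k => (k%:R - m) ^+ 2) <= (1 + 2 ^+ r.+2) * m.
Proof.
move=> T0 pT p4.
have -> : (fun k : nat => (k%:R - m) ^+ 2) =
    (fun k => (k%:R * k%:R + (- 2 * m) * k%:R) + m ^+ 2).
  by apply/funext => k; ring.
rewrite psiD psiD psiZ psi_cst // psi_mean psi_sqr -/m.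
set P := \sum_(j in J) _.
have h0 i : i \in J -> 0 <= hit s T i.
  by move=> iJ; rewrite hit_ge0 ?(ltW T0) //; have := p4 _ iJ; have := p_ge0 i; lra.
have h1 i : i \in J -> hit s T i <= 1.
  by move=> iJ; rewrite hit_le1 //; have := p4 _ iJ; have := p_ge0 i; lra.
set S := \sum_(i in J) hit s T i in m *.
have S0 : 0 <= S by apply: sumr_ge0.
pose X := \sum_(i in J) hit s T i * (p i / T).
have X1 : X <= 2^-1.
  apply: (@le_trans _ _ (\sum_(i in J) p i / T)).
    apply: ler_sum => i iJ; rewrite ler_piMl ?h1 // divr_ge0 // ltW //.
  by rewrite -mulr_suml ler_pdivrMr //; lra.
have P_le : P <= S * S + 2 ^+ r.+1 * (2 * S * X).
  apply: (@le_trans _ _ (\sum_(j in J) \sum_(i in J) hit s T j * hit s T i *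
      (1 + 2 ^+ r.+1 * (p j / T + p i / T)))).
    apply: ler_sum => j jJ; rewrite [leRHS](big_setD1 j) //=.
    apply: (@le_trans _ _ (\sum_(i in J :\ j) hit s T j * hit s T i *
      (1 + 2 ^+ r.+1 * (p j / T + p i / T)))).
      by apply: ler_sum => i; rewrite !inE => /andP[_ iJ]; apply: pair_hit_le; rewrite ?p4.
    rewrite lerDr; apply: mulr_ge0; first by apply: mulr_ge0; apply: h0.
    by rewrite addr_ge0 // mulr_ge0 ?exprn_ge0 // addr_ge0 // divr_ge0 // ltW.
  rewrite le_eqVlt; apply/orP; left; apply/eqP.
  transitivity (\sum_(j in J) (hit s T j * S + 2 ^+ r.+1 * (hit s T j * (p j / T)) * S
     + 2 ^+ r.+1 * X * hit s T j)).
    apply: eq_bigr => j jJ; rewrite /S /X !mulr_sumr !mulr_suml -!big_split /=.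
    by apply: eq_bigr => i iJ; ring.
  have E1 : \sum_(j in J) hit s T j * S = S * S by rewrite {3}/S mulr_suml.
  rewrite !big_split /= E1 -!mulr_suml -!mulr_sumr -/S -/X; ring.
have e2 : (2 ^+ r.+2 : R) = 2 * 2 ^+ r.+1 by rewrite exprS.
have t0 : 0 <= 2 ^+ r.+1 :> R by rewrite exprn_ge0.
have SX : S * X <= S * 2^-1 by rewrite ler_wpM2l.
rewrite e2; set K := 2 ^+ r.+1 in t0 P_le *.
have : K * (2 * S * X) <= K * S by rewrite ler_wpM2l //; lra.
by rewrite /m; nra.
Qed.

Lemma psi_inv_le J s T (S := \sum_(i in J) hit s T i) : 0 < T -> 2 * \sum_(i in J) p i <= T ->
  (forall i, i \in J -> 4 * p i <= T) ->
  0 < S ->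
  psi J s T (fun k => k.+1%:R^-1) <= (3 + 2 ^+ r.+3) / S.
Proof.
move=> T0 pT p4 S0; pose m := 2 * S.
have m0 : 0 < m by rewrite /m; lra.
apply: (@le_trans _ _ (psi J s T (fun k => 2 / m + 4 / m ^+ 2 * (k%:R - m) ^+ 2))).
  by apply: ler_psi => // k; rewrite -natr1 addrC; apply: inv1D_le.
rewrite psiD psi_cst // psiZ.
apply: (@le_trans _ _ (2 / m + 4 / m ^+ 2 * ((1 + 2 ^+ r.+2) * m))).
  by rewrite lerD2l ler_wpM2l ?psi_var_le // divr_ge0 // sqr_ge0.
rewrite le_eqVlt; apply/orP; left; apply/eqP.
by rewrite /m (exprS _ r.+2); field; rewrite gt_eqF.
Qed.

Definition smooth_cst : R := 8 * (3 + 2 ^+ r.+3).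

Lemma ler_eocc_fdiff1 J s T h L (S := \sum_(i in J) hit s T i) : 0 < T -> 2 * \sum_(i in J) p i <= T ->
  (forall i, i \in J -> 4 * p i <= T) ->
  0 < S ->
  (forall N, \sum_(k < N) `|h k| <= L) ->
  `|eocc J s T (fdiff h)| <= smooth_cst * L / S.
Proof.
move=> T0 pT p4 S0 hL.
have L0 : 0 <= L by apply: le_trans (hL 0%N); rewrite big_ord0.
rewrite /eocc occ_thin -/(psi J s T _).
apply: (le_trans (ler_norm_psi _ _ T0 pT)).
apply: (@le_trans _ _ (psi J s T (fun k => 8 * L * k.+1%:R^-1))).
  by apply: ler_psi => // k; exact: ler_iter_avg_fdiff1.
rewrite psiZ; apply: (@le_trans _ _ (8 * L * ((3 + 2 ^+ r.+3) / S))).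
  by rewrite ler_wpM2l ?mulr_ge0 ?psi_inv_le.
by rewrite /smooth_cst le_eqVlt; apply/orP; left; apply/eqP; ring.
Qed.

(** Given the number k of active regions, the difference costs 1 / sqrt (k + 1);
    the inequality of arithmetic and geometric means reduces the expectation of this to
    that of 1 / (k + 1). *)
Lemma ler_eocc_fdiff J s T h L (S := \sum_(i in J) hit s T i) : 0 < T -> 2 * \sum_(i in J) p i <= T ->
  (forall i, i \in J -> 4 * p i <= T) ->
  0 < S ->
  (forall k, `|h k| <= L) ->
  `|eocc J s T (fdiff h)| <= smooth_cst * L / Num.sqrt S.
Proof.
move=> T0 pT p4 S0 hL.
have L0 : 0 <= L by apply: le_trans (hL 0%N).
have S1 : 0 < Num.sqrt S by rewrite sqrtr_gt0.
rewrite /eocc occ_thin -/(psi J s T _).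
apply: (le_trans (ler_norm_psi _ _ T0 pT)).
apply: (@le_trans _ _ (psi J s T (fun k => L * Num.sqrt S * k.+1%:R^-1 +
    L / Num.sqrt S))).
  apply: ler_psi => // k; apply: (le_trans (ler_iter_avg_fdiff _ _ hL)).
  set v := Num.sqrt k.+1%:R; set u := Num.sqrt S.
  have v0 : 0 < v by rewrite sqrtr_gt0 ltr0n.
  have -> : k.+1%:R^-1 = v ^-2 by rewrite sqr_sqrtr.
  rewrite -subr_ge0 (_ : _ - _ = L / u * (u / v - 1) ^+ 2).
    by rewrite mulr_ge0 ?sqr_ge0 // divr_ge0 // ltW.
  by field; rewrite !gt_eqF.
rewrite psiD psiZ psi_cst //.
apply: (@le_trans _ _ (L * Num.sqrt S * ((3 + 2 ^+ r.+3) / S) + L / Num.sqrt S)).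
  by rewrite lerD2r ler_wpM2l ?psi_inv_le // mulr_ge0 // ltW.
have -> : L * Num.sqrt S * ((3 + 2 ^+ r.+3) / S) + L / Num.sqrt S =
    (4 + 2 ^+ r.+3) * (L / Num.sqrt S).
  by rewrite -{2}(sqr_sqrtr (ltW S0)); field; rewrite gt_eqF.
rewrite -[leRHS]mulrA ler_wpM2r ?divr_ge0 ?(ltW S1) // /smooth_cst.
have : 0 <= 2 ^+ r.+3 :> R by rewrite exprn_ge0.
lra.
Qed.

End smoothing.

(** * Varying the number of balls and the total mass *)

Section occ_derivative.
Variables (R : realType) (I : finType) (r : nat) (c p : I -> R).
Implicit Types (J A : {set I}) (s : nat) (T : R) (f g : nat -> R).

Lemma is_derive_bigsum (K : finType) (P : pred K) (h : K -> R -> R)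
    (dh : K -> R) T : (forall i, P i -> is_derive T 1 (h i) (dh i)) ->
  is_derive T 1 (fun x => \sum_(i | P i) h i x) (\sum_(i | P i) dh i).
Proof.
move=> hd; have -> : (fun x => \sum_(i | P i) h i x) = \sum_(i | P i) h i.
  by apply/funext => x; rewrite fct_sumE.
elim/big_ind2 : _ => // [|x y z t dx dy]; first exact: is_derive_cst.
exact: is_deriveD.
Qed.

Lemma is_derive_ie_coef s A T :
  is_derive T 1 (fun T => ie_coef r c p s.+1 T A) (s.+1%:R * ie_coef r c p s T A).
Proof.
rewrite /ie_coef; set P := \sum_(a in A) p a; set C := \prod_(a in A) c a.
set k := (r * #|A|)%N.
pose h : R -> R := id - cst P.
have dh : is_derive T 1 h 1.
  apply: is_derive_eq; exact: subr0.
have -> : (fun T => (s.+1 ^_ k)%:R * C * (T - P) ^+ (s.+1 - k)) =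
    ((s.+1 ^_ k)%:R * C) \*: (h ^+ (s.+1 - k)).
  by apply/funext => x; rewrite /= exprfctE.
apply: is_derive_eq.
rewrite /h /= -![_ *: _]/(_ * _) mulr1.
have [ks|sk] := leqP k s; last first.
  rewrite (ffact_small sk) !mul0r mulr0.
  have [->|ks1] := eqVneq k s.+1; first by rewrite subnn !mul0r mulr0.
  by rewrite ffact_small ?mul0r // ltn_neqAle eq_sym ks1.
rewrite subSn //= -[(id - cst P) T]/(T - P).
have e : ((s.+1 ^_ k)%:R * (s - k).+1%:R = s.+1%:R * (s ^_ k)%:R :> R).
  by rewrite -!natrM -subSn // -ffactnSr ffactSS.
set X := (T - P) ^+ _.
transitivity ((s.+1 ^_ k)%:R * (s - k).+1%:R * (C * X)); first ring.
by rewrite e; ring.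
Qed.

(** The functionals for successive numbers of balls form an Appell sequence in T:
    differentiating withdraws a ball. *)
Lemma is_derive_occ J s f T :
  is_derive T 1 (fun T => occ r c p J s.+1 T f) (s.+1%:R * occ r c p J s T f).
Proof.
rewrite /occ mulr_sumr; apply: is_derive_bigsum => A _.
have dA := is_derive_ie_coef s A T.
have -> : (fun x => ie_coef r c p s.+1 x A * iter #|A| fdiff f 0%N) =
  iter #|A| fdiff f 0%N \*: (fun x => ie_coef r c p s.+1 x A).
  by apply/funext => x /=; rewrite mulrC.
apply: is_derive_eq.
by rewrite -![_ *: _]/(_ * _); ring.
Qed.

End occ_derivative.

Section eocc_changes.
Variables (R : realType) (I : finType) (r : nat) (p : I -> R).
Implicit Types (J A : {set I}) (s : nat) (T : R) (f g h : nat -> R).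

Lemma eoccB J s T f g : eocc r p J s T (fun k => f k - g k) =
  eocc r p J s T f - eocc r p J s T g.
Proof. by rewrite /eocc occB mulrBl. Qed.

Lemma eoccD J s T f g : eocc r p J s T (fun k => f k + g k) =
  eocc r p J s T f + eocc r p J s T g.
Proof. by rewrite /eocc occD mulrDl. Qed.

Lemma eoccZ J s T a f : eocc r p J s T (fun k => a * f k) = a * eocc r p J s T f.
Proof. by rewrite /eocc occZ mulrA. Qed.

Lemma eocc_cst J s T (a : R) : 0 < T -> eocc r p J s T (fun=> a) = a.
Proof. by move=> T0; rewrite /eocc occ_cst mulfK // expf_neq0 // gt_eqF. Qed.

Lemma hit_eocc s T j X : 0 < T -> p j < T ->
  powfact r p j * (s ^_ r)%:R * X / T ^+ s =
  hit r p s T j * (X / (T - p j) ^+ (s - r)).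
Proof.
move=> T0 pT; rewrite /hit.
have h1 : (T - p j) ^+ (s - r) != 0 by rewrite expf_neq0 // gt_eqF // subr_gt0.
have h2 : T ^+ s != 0 by rewrite expf_neq0 // gt_eqF.
by field; rewrite h1 h2.
Qed.

Lemma eocc_setD1 J s T f j : j \in J -> 0 < T -> p j < T ->
  eocc r p J s T f = eocc r p (J :\ j) s T f +
    hit r p s T j * eocc r p (J :\ j) (s - r) (T - p j) (fdiff f).
Proof.
move=> jJ T0 pT; rewrite /eocc (occ_setD1 _ _ _ _ _ _ jJ) mulrDl.
by rewrite hit_eocc.
Qed.

Lemma eocc_mulid J s T f : 0 < T -> (forall j, j \in J -> p j < T) ->
  eocc r p J s T (fun w => w%:R * f w) =
  \sum_(j in J) hit r p s T j *
    eocc r p (J :\ j) (s - r) (T - p j) (fun w => f w.+1).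
Proof.
move=> T0 pT; rewrite /eocc occ_mulid mulr_suml; apply: eq_bigr => j jJ.
by rewrite hit_eocc // pT.
Qed.

(** Up to the factor T, the weight r * (T - p j) / (s + 1 - r) is the ratio of the
    probability of completing box j with the new ball to that of finding it
    already filled. *)
Lemma eocc_step J s T f : (0 < r)%N -> (r <= s)%N ->
  0 < T -> (forall j, j \in J -> p j < T) ->
  eocc r p J s.+1 T f - eocc r p J s T f =
  \sum_(j in J) hit r p s T j / T *
   (r%:R * (T - p j) / (s.+1 - r)%:R *
      eocc r p (J :\ j) (s.+1 - r) (T - p j) (fdiff f) -
    p j * eocc r p (J :\ j) (s - r) (T - p j) (fdiff f)).
Proof.
move=> r0 rs T0 pT.
have Tn : T != 0 by rewrite gt_eqF.
have Ts : T ^+ s != 0 by rewrite expf_neq0.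
have -> : eocc r p J s.+1 T f - eocc r p J s T f =
    (occ r (powfact r p) p J s.+1 T f - T * occ r (powfact r p) p J s T f) / T ^+ s.+1.
  by rewrite /eocc exprS; field; rewrite Ts Tn.
rewrite (occS _ _ _ _ _ _ r0) mulr_suml; apply: eq_bigr => j jJ.
have pj : 0 < T - p j by rewrite subr_gt0 pT.
have h1 : (T - p j) ^+ (s - r) != 0 by rewrite expf_neq0 // gt_eqF.
have h2 : T - p j != 0 by rewrite gt_eqF.
have h3 : (s.+1 - r)%:R != 0 :> R by rewrite pnatr_eq0; lia.
have e : ((s ^_ r)%:R = (s ^_ r.-1)%:R * (s.+1 - r)%:R :> R).
  by rewrite -natrM -[in LHS](prednK r0) ffactnSr; congr (_ * _)%:R; lia.
rewrite /eocc /hit subSn // !exprS e subSn //.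
rewrite subSn // in h3.
by field; rewrite Ts Tn h1 h2 [1 + _]addrC natr1 h3.
Qed.

Lemma is_derive_eocc J s f T : 0 < T ->
  is_derive T 1 (fun T => eocc r p J s.+1 T f)
    (- (s.+1%:R / T) * (eocc r p J s.+1 T f - eocc r p J s T f)).
Proof.
move=> T0; have Tn : T != 0 by rewrite gt_eqF.
have Ts : T ^+ s != 0 by rewrite expf_neq0.
pose u : R -> R := fun T => occ r (powfact r p) p J s.+1 T f.
pose v : R -> R := id ^+ s.+1.
have dv : is_derive T 1 v (s.+1%:R * T ^+ s).
  apply: is_derive_eq; exact: mulr1.
have vT : v T != 0 by rewrite /v exprfctE expf_neq0.
have du := is_derive_occ r (powfact r p) p J s f T.
have dw := is_deriveV vT dv.
have -> : (fun T => eocc r p J s.+1 T f) = u * (fun x => (v x)^-1).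
  by apply/funext => x; rewrite /eocc /v exprfctE.
apply: is_derive_eq.
rewrite -![_ *: _]/(_ * _) /eocc /u /v exprfctE /=.
have -> : T ^+ s.+1 = T * T ^+ s by rewrite exprS.
by field; rewrite Ts Tn.
Qed.

(** A change of mass is reduced to the effect of one ball, by the mean value
    theorem applied to the derivative of the previous lemma. *)
Lemma eocc_MVT J s f T : 0 < T -> T <= 1 ->
  exists2 x, T <= x <= 1 & eocc r p J s.+1 1 f - eocc r p J s.+1 T f =
    - (s.+1%:R / x) * (eocc r p J s.+1 x f - eocc r p J s x f) * (1 - T).
Proof.
move=> T0 T1; have [x|x|x xT e] := @MVT_segment R (fun T => eocc r p J s.+1 T f)
   (fun x => - (s.+1%:R / x) * (eocc r p J s.+1 x f - eocc r p J s x f)) T 1 T1.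
- rewrite in_itv /= => /andP[Tx _]; apply: is_derive_eocc.
  exact: lt_trans Tx.
- apply: derivable_within_continuous => y; rewrite in_itv /= => /andP[Ty _].
  by have [] := is_derive_eocc J s f (lt_le_trans T0 Ty).
- by exists x => //; move: xT; rewrite in_itv.
Qed.

End eocc_changes.

(** * The Stein identity for boxes of small mass *)

(** From 1 + x / k <= exp (x / k), raised to the power k. *)
Lemma expR_ge_pow (R : realType) (x : R) k : 0 <= x ->
  x ^+ k <= k%:R ^+ k * expR x.
Proof.
move=> x0; case: k => [|k]; first by rewrite !expr0 mul1r; apply: le_trans (expR_ge1Dx x); lra.
set K : R := k.+1%:R; have K0 : 0 < K by rewrite ltr0n.
have xE : x = K * (x / K) by field; rewrite gt_eqF.
rewrite [in leLHS]xE exprMn ler_wpM2l ?exprn_ge0 ?(ltW K0) //.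
rewrite [in leRHS]xE /K expRM_natl lerXn2r ?nnegrE ?expR_ge0 //.
  by rewrite divr_ge0.
by apply: le_trans (expR_ge1Dx _); rewrite lerDr.
Qed.

Lemma onem_expR_ge (R : realType) (y : R) : 0 <= y <= 1 / 2 ->
  expR (- (2 * y)) <= 1 - y.
Proof.
move=> /andP[y0 y1]; rewrite expRN -[leRHS]invrK lef_pV2 ?posrE ?expR_gt0 //; last first.
  by rewrite invr_gt0; lra.
apply: le_trans (expR_ge1Dx _); rewrite -[leLHS]mul1r ler_pdivrMr; [nra|lra].
Qed.

Section regime.
Variables (R : realType) (I : finType) (r : nat) (p : I -> R).
Variables (n : nat) (tau : R) (J0 : {set I}).
Hypothesis r_gt0 : (0 < r)%N.
Hypothesis p_ge0 : forall i, 0 <= p i.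
Hypothesis n_big : (16 * r <= n)%N.
Hypothesis tau_ge0 : 0 <= tau.
Hypothesis tau_le : tau <= 1 / 64.
Hypothesis ntau : n%:R * tau ^+ 2 <= 1.
Hypothesis p_le : forall i, i \in J0 -> p i <= tau.
Hypothesis pJ0 : \sum_(i in J0) p i <= 1 / 8.
Implicit Types (J A : {set I}) (s : nat) (T : R) (f g h : nat -> R).

Local Notation hit := (hit r p).
Local Notation E := (eocc r p).
Let q i := hit n 1 i.
Let m i : R := r%:R + n%:R * p i.
(** Changing the number of balls by at most 6 * r and the mass by a few multiples of
    tau changes the hitting probabilities by bounded factors, at most hit_ratio
    and at least hit_ratio_inv. *)
Definition hit_ratio : R := 2 ^+ (7 * r).
Local Notation B := hit_ratio.
Definition hit_ratio_inv : R := 2 ^- r * expR (- 32).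
Local Notation b := hit_ratio_inv.

Let n_gt0 : 0 < n%:R :> R.
Proof. by rewrite ltr0n; nlia. Qed.

Lemma hit_form s T i : 0 < T -> (r <= s)%N ->
  hit s T i = powfact r p i * (s ^_ r)%:R * (1 - p i / T) ^+ (s - r) / T ^+ r.
Proof.
move=> T0 rs; rewrite /hit.
rewrite (_ : T - p i = T * (1 - p i / T)); last by field; rewrite gt_eqF.
rewrite -{3}(subnK rs) exprMn (exprD T).
have T1 : T ^+ r != 0 by rewrite expf_neq0 // gt_eqF.
have T2 : T ^+ (s - r) != 0 by rewrite expf_neq0 // gt_eqF.
by field; apply/andP.
Qed.

Lemma q_ge0 i : i \in J0 -> 0 <= q i.
Proof. by move=> iJ; apply: hit_ge0 => //; have := p_le iJ; have := tau_le; lra. Qed.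

(** Positivity of the doubled weights for a single box, tested on the indicator of
    0, says precisely that the hitting probability is at most 1/2. *)
Lemma q_le_half i : i \in J0 -> q i <= 1 / 2.
Proof.
move=> iJ; have tl := tau_le; have nt := ntau; have pi := p_le iJ; have pi0 := p_ge0 i.
have := @occ_thin_ge0 R I r p r_gt0 p_ge0 [set i]%SET n 1 (fun k => (k == 0)%:R).
rewrite big_set1 => /(_ (fun k => ler0n _ _)) => /(_ ltac:(lra)).
rewrite (@occ_setD1 _ _ _ _ _ [set i]%SET n 1 _ i) ?inE // finset.setDv !occ_set0 /fdiff.
by rewrite /q /hit /dpowfact expr1n !divr1 /=; lra.
Qed.

Lemma hit_upper s T i : i \in J0 -> (s <= n <= s + 6 * r)%N -> 1 / 2 <= T <= 1 ->
  hit s T i <= B * q i.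
Proof.
move=> iJ /andP[sn ns] /andP[T1 T2]; have tl := tau_le; have nt := ntau; have pi := p_le iJ; have pi0 := p_ge0 i.
have T0 : 0 < T by lra.
rewrite /q !hit_form //; try nlia.
rewrite expr1n !divr1 /B.
have x0 : 0 <= 1 - p i / T by rewrite subr_ge0 ler_pdivrMr //; lra.
have h1 : 1 - p i / T <= 1 - p i.
  by rewrite lerD2l lerN2 ler_pdivlMr //; nra.
have h2 : (1 - p i / T) ^+ (s - r) <= (1 - p i) ^+ (s - r).
  by rewrite lerXn2r // nnegrE; lra.
have h3 : (1 - p i) ^+ (s - r) <= 2 ^+ (6 * r) * (1 - p i) ^+ (n - r).
  have -> : (n - r = (n - s) + (s - r))%N by nlia.
  rewrite exprD mulrA -[leLHS]mul1r ler_wpM2r ?exprn_ge0 //; try lra.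
  have -> : (6 * r = (6 * r - (n - s)) + (n - s))%N by nlia.
  rewrite exprD -mulrA -exprMn mulr_ege1 // exprn_ege1 //; lra.
have h4 : T ^- r <= 2 ^+ r.
  rewrite -[leRHS]invrK lef_pV2 ?posrE ?invr_gt0 ?exprn_gt0 //.
  by rewrite -exprVn lerXn2r ?nnegrE //; lra.
have h5 : (s ^_ r)%:R <= (n ^_ r)%:R :> R.
  by rewrite ler_nat -!bin_ffact leq_mul2r leq_bin2l ?orbT.
have c0 := powfact_ge0 r p_ge0 i.
rewrite (_ : 7 * r = 6 * r + r)%N; last nlia.
rewrite exprD; set c := powfact r p i in c0 *.
apply: (@le_trans _ _ (c * (n ^_ r)%:R * (2 ^+ (6 * r) * (1 - p i) ^+ (n - r)) * 2 ^+ r)).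
  apply: ler_pM => //; last 1 first.
  - apply: ler_pM => //; [by rewrite mulr_ge0|exact: exprn_ge0| |exact: le_trans h3].
    by rewrite ler_wpM2l.
  - by rewrite mulr_ge0 ?exprn_ge0 // mulr_ge0.
  - by rewrite invr_ge0 exprn_ge0 // ltW.
by rewrite le_eqVlt; apply/orP; left; apply/eqP; ring.
Qed.

(** The number of balls changes the falling factorial by a bounded factor. The
    mass changes the probability to avoid the box by a relative amount of order
    tau^2, to the power n; here n * tau^2 <= 1 is decisive. *)
Lemma hit_lower s T i : i \in J0 -> (s <= n <= s + 6 * r)%N ->
  1 - 4 * tau <= T <= 1 -> b * q i <= hit s T i.
Proof.
move=> iJ /andP[sn ns] /andP[T1 T2]; have tl := tau_le; have nt := ntau; have pi := p_le iJ; have pi0 := p_ge0 i.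
have T0 : 0 < T by lra.
rewrite /q !hit_form //; try nlia.
rewrite expr1n !divr1 /b.
have T3 : 1 / 2 <= T by lra.
have h1 : (1 - p i) * (1 - 16 * tau ^+ 2) <= 1 - p i / T.
  have : p i / T <= p i + 4 * (p i * (1 - T)) * (1 - p i).
    rewrite ler_pdivrMr //.
    have : 0 <= p i * (1 - T) * (T * 4 * (1 - p i) - 1).
      by rewrite mulr_ge0 //; [rewrite mulr_ge0; lra|nra].
    nra.
  have : p i * (1 - T) <= 4 * tau ^+ 2 by rewrite expr2; nra.
  have : 0 <= 1 - p i by lra.
  nra.
have t2 : 0 <= 16 * tau ^+ 2 <= 1 / 2.
  by rewrite mulr_ge0 ?sqr_ge0 //= expr2; nra.
have t3 : 0 <= 1 - 16 * tau ^+ 2 by lra.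
have h2 : (1 - p i) ^+ (n - r) * expR (- 32) <= (1 - p i / T) ^+ (s - r).
  apply: (@le_trans _ _ ((1 - p i) ^+ (s - r) * (1 - 16 * tau ^+ 2) ^+ (s - r))); last first.
    rewrite -exprMn lerXn2r ?nnegrE //; first by rewrite mulr_ge0 //; lra.
    by rewrite subr_ge0 ler_pdivrMr //; lra.
  apply: ler_pM; rewrite ?exprn_ge0 ?expR_ge0 //; try lra.
    by apply: ler_wiXn2l; [lra|lra|nlia].
  apply: (@le_trans _ _ ((1 - 16 * tau ^+ 2) ^+ n)); last first.
    by apply: ler_wiXn2l; [lra|lra|nlia].
  apply: (@le_trans _ _ (expR (- (2 * (16 * tau ^+ 2))) ^+ n)); last first.
    by rewrite lerXn2r ?nnegrE ?expR_ge0 // onem_expR_ge.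
  rewrite -expRM_natl ler_expR -[_ *+ n]mulr_natl; lra.
have h4 : 1 <= T ^- r.
  by rewrite invf_ge1 ?exprn_gt0 // exprn_ile1 // ltW.
have h5 : 2 ^- r * (n ^_ r)%:R <= (s ^_ r)%:R :> R.
  rewrite ler_pdivrMl ?exprn_gt0 // -natrX -natrM ler_nat.
  suff H k : (k <= r)%N -> (n ^_ k <= 2 ^ k * s ^_ k)%N by exact: H.
  elim: k => [//|k IH] kr.
  rewrite !ffactnSr expnSr -mulnACA leq_mul ?IH //; nlia.
have c0 := powfact_ge0 r p_ge0 i.
set c := powfact r p i in c0 *.
have -> : 2 ^- r * expR (-32) * (c * (n ^_ r)%:R * (1 - p i) ^+ (n - r)) =
  c * (2 ^- r * (n ^_ r)%:R) * ((1 - p i) ^+ (n - r) * expR (-32)) * 1 by ring.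
have e0 : 0 <= (1 - p i) ^+ (n - r) * expR (-32).
  by rewrite mulr_ge0 ?expR_ge0 // exprn_ge0 //; lra.
have f0 : 0 <= c * (2 ^- r * (n ^_ r)%:R).
  by rewrite mulr_ge0 // mulr_ge0 // invr_ge0 exprn_ge0.
apply: ler_pM => //; first by rewrite mulr_ge0.
by apply: ler_pM => //; apply: ler_wpM2l.
Qed.

(** The weight m l / n is the order of the chance that one ball completes or spoils
    box l, relative to its hitting probability. *)
Lemma step_le J s T f d : J \subset J0 -> (s < n <= s + 6 * r)%N ->
  1 / 2 <= T <= 1 ->
  (forall l, l \in J -> `|E (J :\ l) (s.+1 - r) (T - p l) (fdiff f)| <= d l) ->
  (forall l, l \in J -> `|E (J :\ l) (s - r) (T - p l) (fdiff f)| <= d l) ->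
  `|E J s.+1 T f - E J s T f| <= 2 * B / n%:R * \sum_(l in J) q l * m l * d l.
Proof.
move=> JJ /andP[sn ns] /andP[T1 T2] d1 d2.
have T0 : 0 < T by lra.
have inJ l : l \in J -> l \in J0 by move=> /(fintype.subsetP JJ).
rewrite eocc_step //; [|nlia|]; last first.
  by move=> j /inJ jJ; have := tau_le; have := p_le jJ; lra.
rewrite mulr_sumr; apply: (le_trans (ler_norm_sum _ _ _)); apply: ler_sum => l lJ.
have lJ0 := inJ _ lJ; have tl := tau_le; have pl := p_le lJ0; have pl0 := p_ge0 l.
have h0 : 0 <= hit s T l by apply: hit_ge0 => //; lra.
have h1 : hit s T l <= B * q l by apply: hit_upper => //; nlia || (apply/andP; split=> //; nlia).
have D1 := d1 _ lJ; have D2 := d2 _ lJ.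
set e1 := E _ _ _ _ in D1 *; set e2 := E _ _ _ _ in D2 *.
have d0 : 0 <= d l by apply: le_trans D1.
set N : R := (s.+1 - r)%:R.
have N0 : n%:R / 2 <= N by rewrite ler_pdivrMr // -natrM ler_nat; nlia.
have N1 : 0 < N by apply: lt_le_trans N0; rewrite divr_gt0.
rewrite normrM (ger0_norm (divr_ge0 h0 (ltW T0))).
have k1 : `|r%:R * (T - p l) / N * e1 - p l * e2| <=
    (r%:R * T / (n%:R / 2) + p l) * d l.
  apply: (le_trans (ler_normB _ _)).
    rewrite [X in X + _]normrM [X in _ + X]normrM mulrDl; apply: lerD.
    apply: ler_pM => //.
    rewrite ger0_norm; last by rewrite divr_ge0 ?mulr_ge0 //; lra.
    apply: ler_pM; rewrite ?mulr_ge0 ?invr_ge0 //; try lra.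
      by rewrite ler_wpM2l //; lra.
    by rewrite lef_pV2 // posrE divr_gt0.
  by apply: ler_pM => //; rewrite ger0_norm.
apply: (le_trans (ler_wpM2l (divr_ge0 h0 (ltW T0)) k1)).
have -> : hit s T l / T * ((r%:R * T / (n%:R / 2) + p l) * d l) =
   (hit s T l * d l) * (2 * r%:R / n%:R + p l / T) by field; rewrite !gt_eqF.
have -> : 2 * B / n%:R * (q l * m l * d l) =
   (B * q l * d l) * (2 * r%:R / n%:R + 2 * p l).
  by rewrite /m; field; rewrite gt_eqF.
apply: ler_pM => //; first by rewrite mulr_ge0.
- by rewrite addr_ge0 ?divr_ge0 ?mulr_ge0 // ltW.
- by rewrite ler_wpM2r.
- by rewrite lerD2l ler_pdivrMr //; nra.
Qed.

(** Moving from (s0, T0) to (n, 1) first in the mass, by the mean value theorem, and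
    then ball by ball. *)
Lemma eocc_lip J s0 T0 f d : J \subset J0 -> (s0 <= n <= s0 + 5 * r)%N ->
  1 / 2 <= T0 <= 1 ->
  (forall l s T, l \in J -> (s <= n)%N -> (s0 <= s + 2 * r)%N ->
     T0 - p l <= T <= 1 -> `|E (J :\ l) s T (fdiff f)| <= d l) ->
  `|E J s0 T0 f - E J n 1 f| <=
    ((n - s0)%:R + 2 * n%:R * (1 - T0)) *
    (2 * B / n%:R * \sum_(l in J) q l * m l * d l).
Proof.
move=> JJ /andP[sn ns] /andP[T1 T2] hd; set D := _ * \sum_(l in J) _.
have T00 : 0 < T0 by lra.
have stp s T : (s0 <= s.+1)%N -> (s < n)%N -> T0 <= T <= 1 ->
    `|E J s.+1 T f - E J s T f| <= D.
  move=> s0s sn' /andP[Ta Tb]; apply: step_le => //; first nlia.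
  - by apply/andP; split; lra.
  - by move=> l lJ; apply: hd => //; [nlia|nlia|have := p_ge0 l => ?; apply/andP; split; lra].
  - by move=> l lJ; apply: hd => //; [nlia|nlia|have := p_ge0 l => ?; apply/andP; split; lra].
have D0 : 0 <= D.
  have [s1|] := ltnP s0 n; first by apply: le_trans (stp s0 1 _ _ _) => //; lra || nlia.
  move=> ?; apply: le_trans (stp s0.-1 1 _ _ _); rewrite ?prednK //; try nlia.
  by apply/andP; split; lra.
have tele k : (s0 + k <= n)%N -> `|E J (s0 + k) 1 f - E J s0 1 f| <= k%:R * D.
  elim: k => [|k IH] kn; first by rewrite addn0 subrr normr0 mul0r.
  rewrite addnS -natr1 mulrDl mul1r.
  have -> : E J (s0 + k).+1 1 f - E J s0 1 f =
     (E J (s0 + k) 1 f - E J s0 1 f) + (E J (s0 + k).+1 1 f - E J (s0 + k) 1 f) by ring.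
  apply: (le_trans (ler_normD _ _)); apply: lerD; first by apply: IH; nlia.
  by apply: stp; [nlia|nlia|apply/andP; split; lra].
have h1 : `|E J s0 1 f - E J n 1 f| <= (n - s0)%:R * D.
  by have := tele (n - s0)%N; rewrite subnKC // distrC; apply.
have h2 : `|E J s0 T0 f - E J s0 1 f| <= 2 * n%:R * (1 - T0) * D.
  case: (s0) sn ns stp => [|s1] sn' ns' stp; first nlia.
  have [x /andP[xa xb] e] := @eocc_MVT R I r p J s1 f T0 T00 T2.
  rewrite distrC e normrM normrM normrN.
  have x0 : 0 < x by lra.
  rewrite (ger0_norm (_ : 0 <= s1.+1%:R / x)); last by rewrite divr_ge0 // ltW.
  rewrite (ger0_norm (_ : 0 <= 1 - T0)); last lra.
  rewrite mulrAC; apply: ler_pM => //.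
  - by rewrite mulr_ge0 // ?divr_ge0 ?(ltW x0) //; lra.
  - rewrite ler_wpM2r //; first lra.
    rewrite ler_pdivrMr //; apply: (@le_trans _ _ n%:R); first by rewrite ler_nat.
    rewrite -mulrA [n%:R * x]mulrC mulrA -[leLHS]mul1r ler_wpM2r //; lra.
  - by apply: stp; [nlia|nlia|apply/andP; split].
have -> : E J s0 T0 f - E J n 1 f = (E J s0 T0 f - E J s0 1 f) + (E J s0 1 f - E J n 1 f) by ring.
by apply: (le_trans (ler_normD _ _)); rewrite mulrDl addrC lerD.
Qed.

Let mu := \sum_(i in J0) q i.
Let S1 := \sum_(i in J0) q i * m i.
Let S2 := \sum_(i in J0) q i * m i ^+ 2.
Definition moment_cst : R := (2 * r.+1%:R) ^+ r.+1 * expR (r%:R / 2).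
Local Notation G := moment_cst.

Let m_ge0 i : 0 <= m i.
Proof. by rewrite /m addr_ge0 // mulr_ge0. Qed.

(** The exponential factor exp (- n p i / 2) of the hitting probability absorbs all
    but one of the powers of n p i. *)
Lemma q_m2_le i : i \in J0 -> q i * m i ^+ 2 <= G * (n%:R * p i).
Proof.
move=> iJ; have tl := tau_le; have pi := p_le iJ; have pi0 := p_ge0 i.
rewrite /q /hit expr1n divr1.
set x := n%:R * p i; have x0 : 0 <= x by rewrite mulr_ge0.
have h1 : powfact r p i * (n ^_ r)%:R <= x ^+ r.
  rewrite /powfact mulrAC ler_pdivrMr ?ltr0n ?fact_gt0 // /x exprMn -mulrA.
  rewrite [leRHS]mulrCA ler_wpM2l ?exprn_ge0 // -natrX -natrM ler_nat.
  apply: (@leq_trans (n ^ r)); last by rewrite leq_pmulr // fact_gt0.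
  by elim: (r) => [//|k IH]; rewrite ffactnSr expnSr leq_mul // leq_subr.
have h2 : (1 - p i) ^+ (n - r) <= expR (- (x / 2)).
  apply: (@le_trans _ _ (expR (- p i) ^+ (n - r))).
    by rewrite lerXn2r ?nnegrE ?expR_ge0 //; [lra|exact: expR_ge1Dx].
  rewrite -expRM_natl ler_expR mulrN lerN2 /x.
  have : n%:R <= 2 * (n - r)%:R :> R by rewrite -natrM ler_nat; nlia.
  by nra.
have xm : x <= m i by rewrite /m lerDr.
have h3 : x ^+ r.-1 * m i ^+ 2 <= m i ^+ r.+1.
  have -> : (r.+1 = r.-1 + 2)%N by nlia.
  by rewrite exprD ler_wpM2r ?exprn_ge0 // lerXn2r ?nnegrE.
have h4 : m i ^+ r.+1 <= G * expR (x / 2).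
  have e := @expR_ge_pow R (m i / 2) r.+1 (divr_ge0 (m_ge0 i) (ler0n _ 2)).
  have t0 : 0 < 2 ^+ r.+1 :> R by rewrite exprn_gt0.
  apply: (@le_trans _ _ (r.+1%:R ^+ r.+1 * expR (m i / 2) * 2 ^+ r.+1)).
    by rewrite -ler_pdivrMr // -expr_div_n.
  rewrite [m i / 2]mulrDl expRD.
  by rewrite /G exprMn le_eqVlt; apply/orP; left; apply/eqP; rewrite /x; ring.
apply: (@le_trans _ _ (x ^+ r * expR (- (x / 2)) * m i ^+ 2)).
  rewrite ler_wpM2r ?exprn_ge0 // ler_pM ?mulr_ge0 ?powfact_ge0 ?exprn_ge0 //.
  by lra.
have -> : x ^+ r * expR (- (x / 2)) * m i ^+ 2 =
    x * (x ^+ r.-1 * m i ^+ 2) * expR (- (x / 2)).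
  by rewrite -{1}(prednK r_gt0) exprS; ring.
rewrite expRN ler_pdivrMr ?expR_gt0 //.
have -> : G * x * expR (x / 2) = x * (G * expR (x / 2)) by ring.
by apply: ler_wpM2l => //; exact: le_trans h4.
Qed.

(** Cauchy-Schwarz for the weights q, through the sum of squares of the
    differences. *)
Lemma S1_sqr_le : S1 ^+ 2 <= mu * S2.
Proof.
suff : 0 <= 2 * (mu * S2 - S1 ^+ 2) by lra.
have -> : 2 * (mu * S2 - S1 ^+ 2) =
    \sum_(i in J0) \sum_(j in J0) q i * q j * (m i - m j) ^+ 2.
  transitivity (\sum_(i in J0) (q i * m i ^+ 2 * mu + q i * S2 - 2 * (q i * m i) * S1)).
    have e1 : \sum_(i in J0) q i * m i ^+ 2 * mu = S2 * mu by rewrite /S2 mulr_suml.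
    have e2 : \sum_(i in J0) q i * S2 = mu * S2 by rewrite [in RHS]/mu mulr_suml.
    have e3 : \sum_(i in J0) 2 * (q i * m i) * S1 = 2 * S1 * S1.
      by rewrite -mulr_suml -mulr_sumr.
    by rewrite !big_split /= sumrN e1 e2 e3; ring.
  apply: eq_bigr => i iJ; rewrite /mu /S1 /S2 !mulr_sumr -sumrN -!big_split /=.
  by apply: eq_bigr => j jJ; ring.
apply: sumr_ge0 => i iJ; apply: sumr_ge0 => j jJ.
by rewrite mulr_ge0 ?sqr_ge0 // mulr_ge0 // q_ge0.
Qed.

Let S1_ge0 : 0 <= S1.
Proof. by apply: sumr_ge0 => i iJ; rewrite mulr_ge0 ?q_ge0. Qed.

Let mu_ge0 : 0 <= mu.
Proof. by apply: sumr_ge0 => i iJ; rewrite q_ge0. Qed.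

Lemma S2_le : S2 <= G * n%:R * \sum_(i in J0) p i.
Proof.
rewrite mulr_sumr; apply: ler_sum => i iJ; rewrite -mulrA; exact: q_m2_le.
Qed.

(** Both expectations are conditioned on box j: the first has r balls in it, the
    second may or may not, and the difference is that between the two
    configurations of the remaining boxes. *)
Lemma size_bias_eq g :
  E J0 n 1 (fun w => w%:R * g w) - mu * E J0 n 1 g =
  \sum_(j in J0) q j *
    ((E (J0 :\ j) (n - r) (1 - p j) g - E (J0 :\ j) n 1 g) +
     (1 - q j) * E (J0 :\ j) (n - r) (1 - p j) (fdiff g)).
Proof.
have pj j : j \in J0 -> p j < 1.
  by move=> jJ; have := p_le jJ; have := tau_le; lra.
rewrite eocc_mulid // /mu mulr_suml -sumrB; apply: eq_bigr => j jJ.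
rewrite (@eocc_setD1 R I r p J0 n 1 g j jJ) ?pj //.
have -> : (fun w => g w.+1) = fun w => g w + fdiff g w.
  by apply/funext => w; rewrite /fdiff; ring.
by rewrite eoccD -/(q j); ring.
Qed.

Let B_ge0 : 0 <= B. Proof. exact: exprn_ge0. Qed.
Let G_ge0 : 0 <= G.
Proof. by rewrite mulr_ge0 ?expR_ge0 // exprn_ge0 // mulr_ge0. Qed.

Let rho := 2 * B / n%:R * S1.

Let rho_ge0 : 0 <= rho.
Proof. by rewrite mulr_ge0 // divr_ge0 ?mulr_ge0 // ltW. Qed.

Let sub_sum J (F : I -> R) : J \subset J0 -> (forall i, i \in J0 -> 0 <= F i) ->
  \sum_(i in J) F i <= \sum_(i in J0) F i.
Proof.
move=> JJ F0; rewrite [leRHS](big_setID J) /= (finset.setIidPr JJ) lerDl.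
by apply: sumr_ge0 => i; rewrite inE => /andP[_ iJ]; apply: F0.
Qed.

(** The expectation of f is 0 at the full configuration of boxes, balls and mass;
    going from there to a nearby one, by removing boxes and changing (s, T), is paid
    for by expectations of the difference of f. *)
Section centred.
Variables (f : nat -> R) (delta : R).
Hypothesis f0 : E J0 n 1 f = 0.
Hypothesis df : forall J s T, J \subset J0 -> (#|J0| <= #|J| + 3)%N ->
  (s <= n <= s + 5 * r)%N -> 1 - 3 * tau <= T <= 1 ->
  `|E J s T (fdiff f)| <= delta.

Let delta_ge0 : 0 <= delta.
Proof.
apply: le_trans (normr_ge0 _) (@df J0 n 1 _ _ _ _) => //; first by rewrite leq_addr.
  by rewrite leqnn leq_addr.
by have := tau_ge0 => t0; apply/andP; split; lra.
Qed.

Let cmp1 j : j \in J0 -> `|E (J0 :\ j) n 1 f| <= delta.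
Proof.
move=> jJ; have tl := tau_le; have pj := p_le jJ; have pj0 := p_ge0 j.
have := @eocc_setD1 R I r p J0 n 1 f j jJ ltr01.
rewrite f0 => /(_ ltac:(lra)) /eqP; rewrite eq_sym addr_eq0 => /eqP ->.
rewrite normrN normrM (ger0_norm (q_ge0 jJ)).
rewrite -[leRHS]mul1r ler_pM //; first exact: q_ge0.
  by have := q_le_half jJ; rewrite -/(q j); lra.
apply: df; first exact: finset.subD1set.
- by rewrite (cardsD1 j J0) jJ; nlia.
- by nlia.
- by apply/andP; split; lra.
Qed.

Let cmp2 j l : j \in J0 -> l \in J0 :\ j -> `|E (J0 :\ j :\ l) n 1 f| <= 2 * delta.
Proof.
move=> jJ lJ; have lJ0 : l \in J0 by move: lJ; rewrite !inE => /andP[].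
have tl := tau_le; have pl := p_le lJ0; have pl0 := p_ge0 l.
have -> : E (J0 :\ j :\ l) n 1 f = E (J0 :\ j) n 1 f -
    q l * E (J0 :\ j :\ l) (n - r) (1 - p l) (fdiff f).
  by rewrite (@eocc_setD1 R I r p (J0 :\ j) n 1 f l lJ ltr01) ?addrK //; lra.
apply: (le_trans (ler_normB _ _)).
rewrite mulr_natl mulr2n lerD ?cmp1 // normrM (ger0_norm (q_ge0 lJ0)).
rewrite -[leRHS]mul1r ler_pM //; first exact: q_ge0.
  by have := q_le_half lJ0; rewrite -/(q l); lra.
apply: df.
- by rewrite !(fintype.subset_trans (finset.subD1set _ _)).
- by rewrite (cardsD1 j J0) jJ (cardsD1 l (J0 :\ j)) lJ; nlia.
- by nlia.
- by apply/andP; split; lra.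
Qed.

Let lip_rho J s0 T0 : J \subset J0 -> (#|J0| <= #|J| + 2)%N ->
  (s0 <= n <= s0 + 3 * r)%N -> 1 - 2 * tau <= T0 <= 1 ->
  `|E J s0 T0 f - E J n 1 f| <=
    ((n - s0)%:R + 2 * n%:R * (1 - T0)) * (rho * delta).
Proof.
move=> JJ Jc /andP[sn ns] /andP[T1 T2]; have tl := tau_le.
have lip := @eocc_lip J s0 T0 f (fun=> delta) JJ.
apply: (le_trans (lip _ _ _)).
- by nlia.
- by apply/andP; split; lra.
- move=> l s T lJ sn' s0s /andP[Ta Tb].
  have lJ0 := fintype.subsetP JJ _ lJ; have pl := p_le lJ0.
  apply: df => //.
  + exact: fintype.subset_trans (finset.subD1set _ _) JJ.
  + by move: Jc; rewrite (cardsD1 l J) lJ; clear; lia.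
  + by apply/andP; split => //; nlia.
  + by apply/andP; split; lra.
- apply: ler_wpM2l; first by rewrite addr_ge0 // mulr_ge0 ?mulr_ge0 //; lra.
  have -> : rho * delta = 2 * B / n%:R * (S1 * delta) by rewrite /rho; ring.
  apply: ler_wpM2l; first by rewrite divr_ge0 ?mulr_ge0 // ltW.
  rewrite -mulr_suml; apply: ler_wpM2r => //; apply: sub_sum => // i iJ.
  by rewrite mulr_ge0 // q_ge0.
Qed.

Lemma centred_setD1_le j : j \in J0 ->
  `|E (J0 :\ j) (n - r) (1 - p j) f| <= delta * (1 + 2 * m j * rho).
Proof.
move=> jJ; have tl := tau_le; have pj := p_le jJ; have pj0 := p_ge0 j.
have L : `|E (J0 :\ j) (n - r) (1 - p j) f - E (J0 :\ j) n 1 f| <=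
    ((n - (n - r))%:R + 2 * n%:R * (1 - (1 - p j))) * (rho * delta).
  apply: lip_rho; first exact: finset.subD1set.
  - by rewrite (cardsD1 j J0) jJ; nlia.
  - by nlia.
  - by apply/andP; split; lra.
have := ler_normD (E (J0 :\ j) (n - r) (1 - p j) f - E (J0 :\ j) n 1 f) (E (J0 :\ j) n 1 f).
rewrite subrK => /le_trans; apply.
have -> : delta * (1 + 2 * m j * rho) = 2 * m j * (rho * delta) + delta by ring.
apply: lerD; last exact: cmp1.
apply: (le_trans L); apply: ler_wpM2r; first exact: mulr_ge0.
have -> : (n - (n - r) = r)%N by nlia.
have r0 : 0 <= r%:R :> R by [].
by rewrite /m; lra.
Qed.

Lemma centred_setD2_le j l s T : j \in J0 -> l \in J0 :\ j ->
  (s <= n <= s + 3 * r)%N -> 1 - p j - p l <= T <= 1 ->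
  `|E (J0 :\ j :\ l) s T f| <= delta * (2 + 3 * (m j + m l) * rho).
Proof.
move=> jJ lJ sn /andP[T1 T2].
have lJ0 : l \in J0 by move: lJ; rewrite !inE => /andP[].
have tl := tau_le; have pj := p_le jJ; have pj0 := p_ge0 j.
have pl := p_le lJ0; have pl0 := p_ge0 l.
have L : `|E (J0 :\ j :\ l) s T f - E (J0 :\ j :\ l) n 1 f| <=
    ((n - s)%:R + 2 * n%:R * (1 - T)) * (rho * delta).
  apply: lip_rho => //.
  - by rewrite !(fintype.subset_trans (finset.subD1set _ _)).
  - by rewrite (cardsD1 j J0) jJ (cardsD1 l (J0 :\ j)) lJ; nlia.
  - by apply/andP; split; lra.
have := ler_normD (E (J0 :\ j :\ l) s T f - E (J0 :\ j :\ l) n 1 f) (E (J0 :\ j :\ l) n 1 f).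
rewrite subrK => /le_trans; apply.
have -> : delta * (2 + 3 * (m j + m l) * rho) =
  3 * (m j + m l) * (rho * delta) + 2 * delta by ring.
apply: lerD; last exact: cmp2.
apply: (le_trans L); apply: ler_wpM2r; first exact: mulr_ge0.
have r0 : 0 <= r%:R :> R by [].
have nT : n%:R * (1 - T) <= n%:R * (p j + p l) by rewrite ler_wpM2l //; lra.
have ns : (n - s)%:R <= 3 * r%:R :> R by rewrite -natrM ler_nat; nlia.
have := mulr_ge0 (ltW n_gt0) pj0; have := mulr_ge0 (ltW n_gt0) pl0.
by rewrite /m; lra.
Qed.

End centred.

Let S1_sqr_le' : S1 ^+ 2 <= G * n%:R * (\sum_(i in J0) p i) * mu.
Proof.
by apply: (le_trans S1_sqr_le); rewrite mulrC ler_wpM2r // S2_le.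
Qed.

Let shift_le j g d : j \in J0 ->
  (forall l s T, l \in J0 :\ j -> (s <= n <= s + 3 * r)%N -> 1 - p j - p l <= T <= 1 ->
     `|E (J0 :\ j :\ l) s T (fdiff g)| <= d l) ->
  `|E (J0 :\ j) (n - r) (1 - p j) g - E (J0 :\ j) n 1 g| <=
    2 * m j * (2 * B / n%:R * \sum_(l in J0 :\ j) q l * m l * d l).
Proof.
move=> jJ hd; have tl := tau_le; have pj := p_le jJ; have pj0 := p_ge0 j.
apply: (@le_trans _ _ (((n - (n - r))%:R + 2 * n%:R * (1 - (1 - p j))) *
   (2 * B / n%:R * \sum_(l in J0 :\ j) q l * m l * d l))).
  apply: eocc_lip; first exact: finset.subD1set.
  - by nlia.
  - by apply/andP; split; lra.
  - by move=> l s T lJ sn s0s Tl; apply: hd => //; nlia.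
apply: ler_wpM2r.
  rewrite mulr_ge0 ?divr_ge0 ?mulr_ge0 ?(ltW n_gt0) //.
  apply: sumr_ge0 => l lJ; have lJ0 : l \in J0 by move: lJ; rewrite !inE => /andP[].
  apply: mulr_ge0; first by apply: mulr_ge0 => //; exact: q_ge0.
  apply: le_trans (normr_ge0 _) (hd l n 1 lJ _ _); first nlia.
  by have := p_ge0 l => ?; apply/andP; split; lra.
have -> : (n - (n - r) = r)%N by nlia.
have r0 : 0 <= r%:R :> R by [].
by rewrite /m; lra.
Qed.

Let V := E J0 n 1 (fun w => w%:R * w%:R) - mu ^+ 2.

Lemma eocc_mean : E J0 n 1 (fun w => w%:R) = mu.
Proof.
have pj j : j \in J0 -> p j < 1.
  by move=> jJ; have := p_le jJ; have := tau_le; lra.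
rewrite (_ : (fun w => w%:R) = fun w => w%:R * 1); last first.
  by apply/funext => w; rewrite mulr1.
rewrite (eocc_mulid r n (fun=> 1) ltr01 pj); apply: eq_bigr => j jJ.
by rewrite eocc_cst ?mulr1 // subr_gt0 pj.
Qed.

(** The variance is the sum of q_j (1 - q_j), between mu / 2 and mu, up to the
    effect on the mean of withdrawing box j; the latter is at most mu / 4 if the
    total mass is small. *)
Lemma eocc_var : 16 * B * G * (\sum_(i in J0) p i) <= 1 ->
  mu / 4 <= V <= 2 * mu.
Proof.
move=> eta_le; have mm := mu_ge0.
have -> : V = \sum_(j in J0) q j *
    ((E (J0 :\ j) (n - r) (1 - p j) (fun w => w%:R) -
      E (J0 :\ j) n 1 (fun w => w%:R)) + (1 - q j)).
  rewrite /V expr2 -{2}eocc_mean size_bias_eq; apply: eq_bigr => j jJ.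
  have -> : fdiff (fun w => w%:R) = fun=> 1 :> R.
    by apply/funext => w; rewrite /fdiff -natr1; ring.
  rewrite eocc_cst ?mulr1 //.
  by have := p_le jJ; have := tau_le; lra.
have A_le j : j \in J0 -> `|E (J0 :\ j) (n - r) (1 - p j) (fun w => w%:R) -
      E (J0 :\ j) n 1 (fun w => w%:R)| <= 2 * m j * rho.
  move=> jJ; apply: (le_trans (@shift_le j _ (fun=> 1) jJ _)).
    move=> l s T lJ _ /andP[T1 T2].
    have lJ0 : l \in J0 by move: lJ; rewrite !inE => /andP[].
    have -> : fdiff (fun w => w%:R) = fun=> 1 :> R.
      by apply/funext => w; rewrite /fdiff -natr1; ring.
    rewrite eocc_cst ?normr1 //.
    by have := p_le jJ; have := p_le lJ0; have := tau_le; lra.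
  rewrite ler_wpM2l ?mulr_ge0 // /rho ler_wpM2l ?divr_ge0 ?mulr_ge0 ?(ltW n_gt0) //.
  under eq_bigr do rewrite mulr1.
  by apply: sub_sum; [exact: finset.subD1set|move=> i iJ; rewrite mulr_ge0 ?q_ge0].
have key : \sum_(j in J0) q j * (2 * m j * rho) <= mu / 4.
  have -> : \sum_(j in J0) q j * (2 * m j * rho) = 2 * S1 * rho.
    by rewrite /S1 mulr_sumr mulr_suml; apply: eq_bigr => j jJ; ring.
  have -> : 2 * S1 * rho = 4 * B / n%:R * S1 ^+ 2 by rewrite /rho; ring.
  apply: (@le_trans _ _ (4 * B / n%:R * (G * n%:R * (\sum_(i in J0) p i) * mu))).
    by rewrite ler_wpM2l ?divr_ge0 ?mulr_ge0 ?(ltW n_gt0).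
  have -> : 4 * B / n%:R * (G * n%:R * (\sum_(i in J0) p i) * mu) =
    (16 * B * G * \sum_(i in J0) p i) * (mu / 4) by field; rewrite gt_eqF.
  by rewrite -[leRHS]mul1r ler_wpM2r // divr_ge0.
apply/andP; split.
  have -> : mu / 4 = mu / 2 - mu / 4 by lra.
  apply: (@le_trans _ _ (mu / 2 - \sum_(j in J0) q j * (2 * m j * rho))).
    by rewrite lerD2l lerN2.
  rewrite /mu mulr_suml -sumrB; apply: ler_sum => j jJ.
  have := A_le _ jJ; rewrite ler_norml => /andP[h1 _].
  have := q_le_half jJ; have := q_ge0 jJ; rewrite -/(q j) => h2 h3.
  have : q j * (- (2 * m j * rho)) <= q j *
    (E (J0 :\ j) (n - r) (1 - p j) (fun w : nat => w%:R) -
     E (J0 :\ j) n 1 (fun w : nat => w%:R)) by rewrite ler_wpM2l.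
  set Z := E _ _ _ _ - _; nra.
apply: (@le_trans _ _ (\sum_(j in J0) q j * (2 * m j * rho) + mu)); last lra.
rewrite /mu -big_split /=; apply: ler_sum => j jJ.
have := A_le _ jJ; rewrite ler_norml => /andP[_ h1].
have := q_ge0 jJ => h2.
have -> : q j * (2 * m j * rho) + q j = q j * (2 * m j * rho + 1) by ring.
by apply: ler_wpM2l => //; lra.
Qed.

Definition stein_cst : R := 1 + 12 * B * G + 48 * B ^+ 2 * G ^+ 2.

(** Subtracting c times the identity, c the expectation of fdiff g, changes the
    left side by nothing, since for the identity it vanishes, but it centres the
    difference of the test function. The comparison of configurations is then
    used twice: for the difference itself, and for the Lipschitz bound of the
    function. *)
Lemma stein_approx g delta :
  (forall J s T, J \subset J0 -> (#|J0| <= #|J| + 3)%N ->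
    (s <= n <= s + 5 * r)%N -> 1 - 3 * tau <= T <= 1 ->
    `|E J s T (fdiff (fdiff g))| <= delta) ->
  `|E J0 n 1 (fun w => w%:R * g w) - mu * E J0 n 1 g - V * E J0 n 1 (fdiff g)|
    <= stein_cst * delta * mu.
Proof.
move=> dg; set c := E J0 n 1 (fdiff g).
(* h has the same second differences as g, and a centred first difference. *)
pose h w : R := g w - c * w%:R.
have fh : fdiff h = fun w => fdiff g w - c.
  by apply/funext => w; rewrite /fdiff /h -natr1; ring.
have ffh : fdiff (fdiff h) = fdiff (fdiff g).
  by rewrite fh; apply/funext => w; rewrite /fdiff; ring.
have h0 : E J0 n 1 (fdiff h) = 0.
  by rewrite fh (eoccB _ _ _ _ _ _ (fun=> c)) eocc_cst // subrr.
have dh J s T : J \subset J0 -> (#|J0| <= #|J| + 3)%N ->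
    (s <= n <= s + 5 * r)%N -> 1 - 3 * tau <= T <= 1 ->
    `|E J s T (fdiff (fdiff h))| <= delta by rewrite ffh; exact: dg.
have d0 : 0 <= delta.
  apply: le_trans (normr_ge0 _) (@dh J0 n 1 _ _ _ _) => //; first by rewrite leq_addr.
    by rewrite leqnn leq_addr.
  by have := tau_ge0 => t0; apply/andP; split; lra.
have -> : E J0 n 1 (fun w => w%:R * g w) - mu * E J0 n 1 g - V * c =
    E J0 n 1 (fun w => w%:R * h w) - mu * E J0 n 1 h.
  have -> : (fun w => w%:R * h w) = fun w => w%:R * g w - c * (w%:R * w%:R).
    by apply/funext => w; rewrite /h; ring.
  rewrite (eoccB _ _ _ _ _ _ (fun w => c * (w%:R * w%:R))).
  rewrite (eoccB _ _ _ _ _ _ (fun w => c * w%:R)) !eoccZ eocc_mean /V; ring.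
rewrite size_bias_eq; apply: (le_trans (ler_norm_sum _ _ _)).
apply: (@le_trans _ _ (\sum_(j in J0) q j * (delta * (1 + 2 * m j * rho) +
    2 * m j * (2 * B / n%:R * (delta * (2 * S1 + 3 * m j * rho * S1 + 3 * rho * S2)))))).
  apply: ler_sum => j jJ; rewrite normrM (ger0_norm (q_ge0 jJ)) ler_wpM2l ?q_ge0 //.
  apply: (le_trans (ler_normD _ _)); rewrite addrC; apply: lerD.
    rewrite normrM -[leRHS]mul1r; apply: ler_pM => //.
      have := q_le_half jJ; have := q_ge0 jJ => h1 h2.
      by rewrite ger0_norm; lra.
    exact: centred_setD1_le.
  apply: (le_trans (@shift_le j _ (fun l => delta * (2 + 3 * (m j + m l) * rho)) jJ _)).
    by move=> l s T lJ sn Tl; apply: centred_setD2_le.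
  rewrite ler_wpM2l ?mulr_ge0 // ler_wpM2l ?divr_ge0 ?mulr_ge0 ?(ltW n_gt0) //.
  apply: (@le_trans _ _ (\sum_(l in J0) q l * m l * (delta * (2 + 3 * (m j + m l) * rho)))).
    apply: sub_sum; first exact: finset.subD1set.
    move=> i iJ; apply: mulr_ge0; first exact: mulr_ge0 (q_ge0 iJ) _.
    by rewrite mulr_ge0 // addr_ge0 // mulr_ge0 // mulr_ge0 // addr_ge0.
  rewrite le_eqVlt; apply/orP; left; apply/eqP.
  rewrite /S1 /S2 !mulr_sumr -!big_split /= mulr_sumr.
  by apply: eq_bigr => l lJ; ring.
have -> : \sum_(j in J0) q j * (delta * (1 + 2 * m j * rho) +
    2 * m j * (2 * B / n%:R * (delta * (2 * S1 + 3 * m j * rho * S1 + 3 * rho * S2)))) =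
  delta * (mu + 2 * S1 * rho +
    2 * (2 * B / n%:R) * (2 * S1 * S1 + 3 * S2 * rho * S1 + 3 * rho * S2 * S1)).
  have gen (a b c1 d : R) : \sum_(j in J0) q j * (delta * (1 + 2 * m j * a) +
      2 * m j * (b * (delta * (c1 + 3 * m j * d)))) =
    delta * (\sum_(j in J0) q j + 2 * a * (\sum_(j in J0) q j * m j) +
      2 * b * c1 * (\sum_(j in J0) q j * m j) +
      6 * b * d * (\sum_(j in J0) q j * m j ^+ 2)).
    rewrite !mulr_sumr -!big_split /= mulr_sumr.
    by apply: eq_bigr => j jJ; ring.
  transitivity (\sum_(j in J0) q j * (delta * (1 + 2 * m j * rho) +
      2 * m j * (2 * B / n%:R * (delta * ((2 * S1 + 3 * rho * S2) + 3 * m j * (rho * S1)))))).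
    by apply: eq_bigr => j jJ; ring.
  by rewrite gen -/mu -/S1 -/S2; ring.
have pJ1 : \sum_(i in J0) p i <= 1 by have := pJ0; lra.
have pJ_ge0 : 0 <= \sum_(i in J0) p i by apply: sumr_ge0.
have nn := n_gt0.
have a1 : S1 ^+ 2 / n%:R <= G * mu.
  rewrite ler_pdivrMr // (le_trans S1_sqr_le') //.
  rewrite [leRHS]mulrAC ler_wpM2r // -[leRHS]mulr1 ler_wpM2l // mulr_ge0 // ltW //.
have a2 : S2 / n%:R <= G.
  rewrite ler_pdivrMr // (le_trans S2_le) //.
  by rewrite -[leRHS]mulr1 ler_wpM2l // mulr_ge0 // ltW.
have S2_ge0 : 0 <= S2.
  by apply: sumr_ge0 => i iJ; rewrite mulr_ge0 ?q_ge0 // exprn_ge0.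
have -> : mu + 2 * S1 * rho +
    2 * (2 * B / n%:R) * (2 * S1 * S1 + 3 * S2 * rho * S1 + 3 * rho * S2 * S1) =
  mu + 12 * B * (S1 ^+ 2 / n%:R) + 48 * B ^+ 2 * ((S1 ^+ 2 / n%:R) * (S2 / n%:R)).
  by rewrite /rho; field; rewrite gt_eqF.
rewrite /stein_cst.
have -> : (1 + 12 * B * G + 48 * B ^+ 2 * G ^+ 2) * delta * mu =
  delta * (mu + 12 * B * (G * mu) + 48 * B ^+ 2 * ((G * mu) * G)) by ring.
apply: ler_wpM2l => //; apply: lerD.
  by rewrite lerD2l ler_wpM2l // mulr_ge0.
apply: ler_wpM2l; first by rewrite mulr_ge0 // exprn_ge0.
by apply: ler_pM => //; rewrite divr_ge0 // ?exprn_ge0 // ltW.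
Qed.

Let b_gt0 : 0 < b.
Proof. by rewrite mulr_gt0 ?expR_gt0 // invr_gt0 exprn_gt0. Qed.

(** Three boxes are withdrawn at most, and each accounts for at most 1/2 of the
    mean. *)
Lemma hit_sum_lower J s T : J \subset J0 -> (#|J0| <= #|J| + 3)%N ->
  (s <= n <= s + 5 * r)%N -> 1 - 3 * tau <= T <= 1 -> 6 <= mu ->
  b * mu / 2 <= \sum_(i in J) hit s T i.
Proof.
move=> JJ Jc /andP[sn ns] /andP[T1 T2] mu6; have t0 := tau_ge0.
apply: (@le_trans _ _ (\sum_(i in J) b * q i)); last first.
  apply: ler_sum => i iJ; apply: hit_lower.
  - exact: fintype.subsetP JJ _ iJ.
  - by nlia.
  - by apply/andP; split; lra.
have -> : \sum_(i in J) b * q i = b * \sum_(i in J) q i by rewrite mulr_sumr.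
rewrite -mulrA; apply: ler_wpM2l; first exact: ltW.
have e : mu = \sum_(i in J) q i + \sum_(i in J0 :\: J) q i.
  by rewrite /mu (big_setID J) /= (finset.setIidPr JJ).
have h : \sum_(i in J0 :\: J) q i <= 2.
  apply: (@le_trans _ _ (\sum_(i in J0 :\: J) (1 / 2))).
    by apply: ler_sum => i; rewrite inE => /andP[_ iJ]; exact: q_le_half.
  rewrite sumr_const -[leLHS]mulr_natr.
  have : #|J0 :\: J|%:R <= 3 :> R.
    rewrite ler_nat cardsD (finset.setIidPr JJ).
    by move: Jc; clear; lia.
  by lra.
by move: e h; set x := \sum_(i in J) q i; lra.
Qed.

Lemma stein_approx_inf g L : 6 <= mu -> (forall k, `|fdiff g k| <= L) ->
  `|E J0 n 1 (fun w => w%:R * g w) - mu * E J0 n 1 g - V * E J0 n 1 (fdiff g)|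
    <= stein_cst * (smooth_cst R r * L / Num.sqrt (b * mu / 2)) * mu.
Proof.
move=> mu6 gL.
have L0 : 0 <= L by apply: le_trans (gL 0%N).
have Dc : 0 <= smooth_cst R r by rewrite mulr_ge0 // addr_ge0 // exprn_ge0.
apply: stein_approx => J s T JJ Jc sn /andP[T1 T2].
have tl := tau_le; have t0 := tau_ge0.
have T0 : 0 < T by lra.
have SJ := hit_sum_lower JJ Jc sn (introT andP (conj T1 T2)) mu6.
have bm : 0 < b * mu / 2 by rewrite divr_gt0 // mulr_gt0 //; lra.
have S0 := lt_le_trans bm SJ.
have pJ : \sum_(i in J) p i <= 1 / 8 by apply: le_trans pJ0; apply: sub_sum.
apply: (@le_trans _ _ (smooth_cst R r * L / Num.sqrt (\sum_(i in J) hit s T i))).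
  apply: ler_eocc_fdiff => //; first lra.
  by move=> i /(fintype.subsetP JJ) /p_le; lra.
rewrite ler_wpM2l ?mulr_ge0 // lef_pV2 ?posrE ?sqrtr_gt0 // ler_sqrt //.
exact: ltW.
Qed.

Lemma stein_approx_one g L : 6 <= mu ->
  (forall N, \sum_(k < N) `|fdiff g k| <= L) ->
  `|E J0 n 1 (fun w => w%:R * g w) - mu * E J0 n 1 g - V * E J0 n 1 (fdiff g)|
    <= stein_cst * (smooth_cst R r * L / (b * mu / 2)) * mu.
Proof.
move=> mu6 gL.
have L0 : 0 <= L by apply: le_trans (gL 0%N); rewrite big_ord0.
have Dc : 0 <= smooth_cst R r by rewrite mulr_ge0 // addr_ge0 // exprn_ge0.
apply: stein_approx => J s T JJ Jc sn /andP[T1 T2].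
have tl := tau_le; have t0 := tau_ge0.
have T0 : 0 < T by lra.
have SJ := hit_sum_lower JJ Jc sn (introT andP (conj T1 T2)) mu6.
have bm : 0 < b * mu / 2 by rewrite divr_gt0 // mulr_gt0 //; lra.
have S0 := lt_le_trans bm SJ.
have pJ : \sum_(i in J) p i <= 1 / 8 by apply: le_trans pJ0; apply: sub_sum.
apply: (@le_trans _ _ (smooth_cst R r * L / (\sum_(i in J) hit s T i))).
  apply: ler_eocc_fdiff1 => //; first lra.
  by move=> i /(fintype.subsetP JJ) /p_le; lra.
by rewrite ler_wpM2l ?mulr_ge0 // lef_pV2 ?posrE.
Qed.

End regime.

(** * Solutions of the Poisson equation *)

Section poisson_stein.
Variables (R : realType) (lam : R).
Hypothesis lam_gt0 : 0 < lam.

Let w k := poisson_pmf lam k.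
Let F k := \sum_(l < k) w l.

Let wE k : w k = lam ^+ k / k`!%:R * expR (- lam).
Proof. by rewrite /w /poisson_pmf lam_gt0. Qed.

Let w_gt0 k : 0 < w k.
Proof. by rewrite wE !mulr_gt0 ?expR_gt0 ?invr_gt0 ?exprn_gt0 // ltr0n fact_gt0. Qed.

Let wS k : k.+1%:R * w k.+1 = lam * w k.
Proof.
rewrite !wE factS natrM exprS.
have h1 : k`!%:R != 0 :> R by rewrite pnatr_eq0 -lt0n fact_gt0.
have h2 : k.+1%:R != 0 :> R by rewrite pnatr_eq0.
by field; rewrite h1 [1 + _]addrC natr1 h2.
Qed.

Let FS k : F k.+1 = F k + w k.
Proof. by rewrite /F big_ord_recr. Qed.

Let F_ge0 k : 0 <= F k.
Proof. by apply: sumr_ge0 => i _; exact: ltW. Qed.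

Let F_cvg : F @ \oo --> (1 : R).
Proof.
have -> : F = (fun k => expR (- lam) * series (exp_coeff lam) k).
  apply/funext => k; rewrite /F /series /= big_mkord mulr_sumr.
  by apply: eq_bigr => i _; rewrite wE /exp_coeff /= mulrC.
have -> : (1 : R) = expR (- lam) * expR lam by rewrite -expRD addNr expR0.
apply: cvgMr; exact: is_cvg_series_exp_coeff.
Qed.

Let F_mono k : F k <= F k.+1.
Proof. by rewrite FS lerDl ltW. Qed.

Let F_le1 k : F k <= 1.
Proof.
have ndF : nondecreasing_seq F by apply/nondecreasing_seqP.
have := nondecreasing_cvgn_le ndF (cvgP _ F_cvg) k.
by rewrite (cvg_lim _ F_cvg).
Qed.

(** The ratio w l / w (l + 1) = (l + 1) / lam increases with l; this is the
    source of the monotonicity of u. *)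
Let lamF_le k : lam * F k <= k%:R * F k.+1.
Proof.
elim: k => [|k IH]; first by rewrite /F big_ord0 mulr0 mul0r.
rewrite FS mulrDr -wS; apply: (@le_trans _ _ (k%:R * F k.+1 + k.+1%:R * w k.+1)).
  by rewrite lerD2r.
by rewrite (FS k.+1) -natr1; have := F_ge0 k.+1; nra.
Qed.

Let tail_le k : k%:R * (1 - F k.+1) <= lam * (1 - F k).
Proof.
have step N : k%:R * (F (N + k).+1 - F k.+1) <= lam * (F (N + k)%N - F k).
  elim: N => [|N IH]; first by rewrite add0n !subrr !mulr0.
  rewrite addSn (FS (N + k).+1) [in leRHS](FS (N + k)%N).
  have -> : lam * (F (N + k)%N + w (N + k)%N - F k) =
    lam * (F (N + k)%N - F k) + (N + k).+1%:R * w (N + k).+1 by rewrite wS; ring.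
  have -> : k%:R * (F (N + k).+1 + w (N + k).+1 - F k.+1) =
     k%:R * (F (N + k).+1 - F k.+1) + k%:R * w (N + k).+1 by ring.
  by apply: lerD => //; apply: ler_wpM2r; [exact: ltW|rewrite ler_nat; lia].
have cvg1 : (fun N => k%:R * (F (N + k).+1 - F k.+1)) @ \oo --> k%:R * (1 - F k.+1).
  apply: cvgMr; apply: cvgB; last exact: cvg_cst.
  by have := F_cvg; rewrite -(cvg_shiftn k.+1); under eq_fun do rewrite addnS.
rewrite -(cvg_lim _ cvg1) //; apply: limr_le; first exact: cvgP cvg1.
apply: nearW => N; apply: (le_trans (step N)); apply: ler_wpM2l; first exact: ltW.
by rewrite lerD2r.
Qed.

(* At k = 0 the denominators vanish, so that u 0 = v 0 = 0; this makes the
   solutions of the Poisson equation below start at 0. *)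
Let u k := F k / (k%:R * w k).
Let v k := (1 - F k) / (k%:R * w k).

Let uS k : u k.+1 = (F k + w k) / (lam * w k).
Proof. by rewrite /u wS FS. Qed.
Let vS k : v k.+1 = (1 - F k - w k) / (lam * w k).
Proof. by rewrite /v wS FS opprD addrA. Qed.

Let lw_gt0 k : 0 < lam * w k. Proof. exact: mulr_gt0. Qed.
Let kw_gt0 k : 0 < k.+1%:R * w k.+1. Proof. by rewrite wS. Qed.

Let u_ge0 k : 0 <= u k.
Proof. by rewrite /u divr_ge0 // mulr_ge0 // ltW. Qed.
Let v_ge0 k : 0 <= v k.
Proof. by rewrite /v divr_ge0 ?subr_ge0 // mulr_ge0 // ltW. Qed.

Let u_mono k : u k <= u k.+1.
Proof.
case: k => [|k]; first by rewrite {1}/u mul0r invr0 mulr0 u_ge0.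
rewrite (uS k.+1) -FS /u ler_pdivlMr // mulrAC ler_pdivrMr //.
by have := ler_wpM2r (ltW (w_gt0 k.+1)) (lamF_le k.+1); lra.
Qed.

Let v_anti k : v k.+2 <= v k.+1.
Proof.
rewrite (vS k.+1) -addrA -opprD -FS /v ler_pdivrMr // mulrAC ler_pdivlMr //.
by have := ler_wpM2r (ltW (w_gt0 k.+1)) (tail_le k.+1); lra.
Qed.

(** The solution of the Poisson equation for the point j, as the quotient of
    partial sums by the Poisson weight; above j the tail of the weights is used
    in place of the partial sum, as both sum up to 1. *)
Definition stein_pt j k : R := if (k <= j)%N then - (w j * u k) else w j * v k.

Lemma stein_pt0 j : stein_pt j 0 = 0.
Proof. by rewrite /stein_pt leq0n /u mul0r invr0 !mulr0 oppr0. Qed.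

Lemma stein_ptP j k :
  lam * stein_pt j k.+1 - k%:R * stein_pt j k = (k == j)%:R - w j.
Proof.
have wk := w_gt0 k; have l0 := lam_gt0.
have ku : k%:R * u k = F k / w k.
  case: k wk => [|k] wk; first by rewrite mul0r /F big_ord0 mul0r.
  by rewrite /u invfM; field; rewrite !gt_eqF.
have kv : (0 < k)%N -> k%:R * v k = (1 - F k) / w k.
  case: k wk {ku} => [//|k] wk _.
  by rewrite /v invfM; field; rewrite !gt_eqF.
rewrite /stein_pt; have [kj|jk|->] := ltngtP k j.
- rewrite mulrN mulrN opprK mulrCA [k%:R * _]mulrCA ku uS.
  by rewrite /=; field; rewrite !gt_eqF.
- rewrite mulrCA [k%:R * _]mulrCA kv ?vS; last by lia.
  by rewrite /=; field; rewrite !gt_eqF.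
- have wj := w_gt0 j; rewrite mulrN opprK mulrCA [j%:R * _]mulrCA -/(u j).
  have -> : j%:R * u j = F j / w j.
    case: j wj {ku kv wk} => [|j] wj; first by rewrite mul0r /F big_ord0 mul0r.
    by rewrite /u invfM; field; rewrite !gt_eqF.
  by rewrite vS /=; field; rewrite !gt_eqF.
Qed.

Let dlt j k : (k < j)%N -> fdiff (stein_pt j) k = - (w j * (u k.+1 - u k)).
Proof. by move=> kj; rewrite /fdiff /stein_pt kj (ltnW kj); ring. Qed.

Let dgt j k : (j < k)%N -> fdiff (stein_pt j) k = - (w j * (v k - v k.+1)).
Proof.
move=> jk; rewrite /fdiff /stein_pt leqNgt (leqW jk) /= leqNgt jk /=; ring.
Qed.

Let deq j : fdiff (stein_pt j) j = w j * (v j.+1 + u j).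
Proof. by rewrite /fdiff /stein_pt ltnn leqnn; ring. Qed.

Let du_ge0 k : 0 <= u k.+1 - u k. Proof. by rewrite subr_ge0. Qed.
Let dv_ge0 k : (0 < k)%N -> 0 <= v k - v k.+1.
Proof. by case: k => // k _; rewrite subr_ge0. Qed.

(** Up to and after j the solution decreases; this bounds its only increase. *)
Let peak_le j : w j * (v j.+1 + u j) <= lam^-1.
Proof.
have wj := w_gt0 j; have l0 := lam_gt0.
have e : w j * v j.+1 = (1 - F j.+1) / lam.
  by rewrite vS FS; field; rewrite !gt_eqF.
have h : w j * u j <= F j.+1 / lam.
  case: j wj {e} => [|j] wj; first by rewrite /u mul0r invr0 !mulr0 divr_ge0 // ltW.
  have -> : w j.+1 * u j.+1 = F j.+1 / j.+1%:R.
    by rewrite /u invfM; field; rewrite !gt_eqF.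
  rewrite ler_pdivrMr ?ltr0n // mulrAC ler_pdivlMr //.
  by rewrite mulrC (le_trans (lamF_le _)) // mulrC.
rewrite mulrDr e; apply: (le_trans (lerD (lexx _) h)).
by rewrite -mulrDl subrK mul1r.
Qed.

(** The solution decreases from 0, jumps up at j, and decreases to 0 again; its
    variation is thus at most twice the jump. *)
Lemma stein_pt_variation j N : \sum_(k < N) `|fdiff (stein_pt j) k| <= 2 / lam.
Proof.
have wj := w_gt0 j.
have e : \sum_(k < N) `|fdiff (stein_pt j) k| =
    if (N <= j)%N then w j * u N else w j * (2 * (u j + v j.+1) - v N).
  elim: N => [|N IH]; first by rewrite big_ord0 /= /u mul0r invr0 !mulr0.
  rewrite big_ord_recr /= IH; have [Nj|jN|->] := ltngtP N j.
  - rewrite dlt // normrN ger0_norm ?mulr_ge0 ?(ltW wj) //; ring.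
  - rewrite dgt // normrN ger0_norm; first ring.
    by rewrite mulr_ge0 ?(ltW (w_gt0 _)) // dv_ge0 //; lia.
  - rewrite deq ger0_norm; first ring.
    by rewrite mulr_ge0 ?(ltW (w_gt0 _)) // addr_ge0.
have pk := peak_le j.
apply: (@le_trans _ _ (2 * (w j * (v j.+1 + u j)))); last by lra.
rewrite e; case: ifPn => [Nj|_].
  have h : u N <= u j.
    by have /nondecreasing_seqP := u_mono; apply.
  have := v_ge0 j.+1; have := u_ge0 j; have := wj; nra.
by have := v_ge0 N; have := wj; nra.
Qed.

Definition stein_sol N (h : nat -> R) k : R := \sum_(j < N) h j * stein_pt j k.

Lemma stein_solP N h k :
  lam * stein_sol N h k.+1 - k%:R * stein_sol N h k =
  (if (k < N)%N then h k else 0) - \sum_(j < N) h j * poisson_pmf lam j.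
Proof.
rewrite /stein_sol !mulr_sumr -sumrB.
transitivity (\sum_(j < N) (h j * (k == j)%:R - h j * w j)).
  by apply: eq_bigr => j _; rewrite -mulrBr -stein_ptP; ring.
rewrite sumrB; congr (_ - _); case: ltnP => [kN|Nk].
  rewrite (bigD1 (Ordinal kN)) //= eqxx mulr1 big1 ?addr0 // => j jk.
  by rewrite (_ : (k == j) = false) ?mulr0 //; apply: contraNF jk => /eqP kj;
    apply/eqP/val_inj.
rewrite big1 // => j _; rewrite (_ : (k == j) = false) ?mulr0 //.
by apply/eqP => kj; have := ltn_ord j; rewrite -kj ltnNge Nk.
Qed.

Let fdiff_sol N h k : fdiff (stein_sol N h) k = \sum_(j < N) h j * fdiff (stein_pt j) k.
Proof.
by rewrite /fdiff /stein_sol -sumrB; apply: eq_bigr => j _; rewrite mulrBr.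
Qed.

(** At a given k only the solution for the point k increases. So the upper bound is
    the jump at k; and as the sum over all points of the differences is 0, because
    the constant test function has solution 0, the decreases add up to at most the
    same jump. *)
Lemma stein_sol_diff N h k : (forall j, 0 <= h j <= 1) ->
  `|fdiff (stein_sol N h) k| <= lam^-1.
Proof.
move=> h01; rewrite fdiff_sol ler_norml.
pose c j := if (j < k)%N then w j * (v k - v k.+1)
  else if j == k then 0 else w j * (u k.+1 - u k).
have c_ge0 j : 0 <= c j.
  rewrite /c; case: ltngtP => // jk; rewrite mulr_ge0 ?(ltW (w_gt0 _)) // ?du_ge0 //.
  by rewrite dv_ge0 //; lia.
have dle j : fdiff (stein_pt j) k <= (if j == k then w k * (v k.+1 + u k) else 0).
  case: ltngtP => [jk|kj|->]; last by rewrite deq.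
    by rewrite dgt // oppr_le0 mulr_ge0 ?(ltW (w_gt0 _)) // dv_ge0 //; lia.
  by rewrite dlt // oppr_le0 mulr_ge0 ?(ltW (w_gt0 _)) // du_ge0.
have dge j : - c j <= fdiff (stein_pt j) k.
  rewrite /c; case: ltngtP => [jk|kj|->]; [by rewrite dgt|by rewrite dlt|].
  by rewrite deq oppr0 mulr_ge0 ?(ltW (w_gt0 _)) // addr_ge0.
have Z : \sum_(j < N) c j <= w k * (v k.+1 + u k).
  have wk := w_gt0 k; have l0 := lam_gt0.
  have e : \sum_(j < N) c j = if (N <= k)%N then F N * (v k - v k.+1)
      else F k * (v k - v k.+1) + (F N - F k.+1) * (u k.+1 - u k).
    elim: N => [|N IH]; first by rewrite big_ord0 /= /F big_ord0 mul0r.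
    rewrite big_ord_recr /= IH /c; case: (ltngtP N k) => [Nk|kN|->].
    - by rewrite FS; ring.
    - by rewrite (FS N); ring.
    - by rewrite subrr; ring.
  (* The limit of e as N grows. *)
  have final : F k * (v k - v k.+1) + (1 - F k.+1) * (u k.+1 - u k) =
      w k * (v k.+1 + u k).
    rewrite FS; case: k wk {c c_ge0 dle dge e} => [|k] wk.
      have F00 : F 0 = 0 by rewrite /F big_ord0.
      by rewrite uS vS /u F00 !mul0r; field; rewrite !gt_eqF.
    by rewrite (uS k.+1) (vS k.+1) /u /v invfM; field; rewrite !gt_eqF.
  have A : 0 <= F k * (v k - v k.+1).
    have [->|k0] := posnP k; first by rewrite /F big_ord0 mul0r.
    by rewrite mulr_ge0 // dv_ge0.
  rewrite -final e; case: ifPn => [Nk|kN].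
    have hF : F N * (v k - v k.+1) <= F k * (v k - v k.+1).
      have [k0|k0] := posnP k.
        by move: Nk; rewrite k0 leqn0 => /eqP ->.
      apply: ler_wpM2r; first exact: dv_ge0.
      by have /nondecreasing_seqP := F_mono; apply.
    by apply: (le_trans hF); rewrite lerDl mulr_ge0 // subr_ge0.
  by rewrite lerD2l ler_wpM2r // lerD2r.
apply/andP; split.
  rewrite lerNl; apply: le_trans (peak_le k); apply: le_trans Z.
  rewrite -sumrN; apply: ler_sum => j _; rewrite -mulrN.
  have := dge j; have := c_ge0 j; have /andP[a b] := h01 j.
  set x := fdiff _ _; nra.
apply: le_trans (peak_le k).
apply: (@le_trans _ _ (\sum_(j < N) (if j == k :> nat then w k * (v k.+1 + u k) else 0))).
  apply: ler_sum => j _; have /andP[a b] := h01 j.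
  have := dle j; case: ifP => _ hd.
    have : 0 <= w k * (v k.+1 + u k) by rewrite mulr_ge0 ?(ltW (w_gt0 _)) // addr_ge0.
    set x := fdiff _ _ in hd *; set y := w k * _ in hd *; nra.
  set x := fdiff _ _ in hd *; nra.
have pk0 : 0 <= w k * (v k.+1 + u k) by rewrite mulr_ge0 ?(ltW (w_gt0 _)) // addr_ge0.
rewrite -big_mkcond /=; have [kN|Nk] := ltnP k N.
  by rewrite (big_pred1 (Ordinal kN)).
rewrite big_pred0 // => j; apply/eqP => jk.
by have := ltn_ord j; rewrite jk ltnNge Nk.
Qed.

End poisson_stein.

(** * Expectation of functions of the balls *)

(** Newton's expansion at 0, with the binomial coefficient in the number of true
    b i written as the number of sets A of true indices. *)
Lemma expansion_at_count (R : realType) (I : finType) (J : {set I})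
    (b : I -> bool) (f : nat -> R) :
  f (\sum_(i in J) b i)%N =
  \sum_(A : {set I} | A \subset J) (\prod_(a in A) (b a)%:R) * iter #|A| fdiff f 0%N.
Proof.
move: {2}#|J| (erefl #|J|) => n; elim: n J f => [|n IH] J f.
  move=> /eqP; rewrite cards_eq0 => /eqP ->.
  rewrite !finset.big_set0 (big_pred1 finset.set0) ?finset.big_set0 ?cards0 ?mul1r //.
  by move=> A; rewrite finset.subset0.
move=> Jn; have /card_gt0P[j jJ] : (0 < #|J|)%N by rewrite Jn.
have Jn' : #|J :\ j| = n by move: Jn; rewrite (cardsD1 j) jJ add1n => -[].
have jJ' : j \notin J :\ j by rewrite !inE eqxx.
rewrite -(finset.setD1K jJ) sum_subsets_setU1 // big_setU1 //=.
have -> : \sum_(A : {set I} | A \subset J :\ j)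
   (\prod_(a in j |: A) (b a)%:R) * iter #|j |: A| fdiff f 0%N =
   (b j)%:R * \sum_(A : {set I} | A \subset J :\ j)
     (\prod_(a in A) (b a)%:R) * iter #|A| fdiff (fdiff f) 0%N.
  rewrite mulr_sumr; apply: eq_bigr => A AJ.
  have jA : j \notin A by apply: contra jJ' => /(fintype.subsetP AJ).
  by rewrite cardsU1 jA [(_ + #|A|)%N]add1n iter_fdiffE big_setU1 //= mulrA.
rewrite -!IH //; case: (b j) => /=; last by rewrite add0n mul0r addr0.
by rewrite add1n mul1r /fdiff; ring.
Qed.

Section scheme_expectation.
Context d (T : measurableType d) {R : realType} (P : probability T R).
Variables (n : nat) (X : 'I_n -> {RV P >-> nat}).

(** Functions of the sequence of boxes hit; the range of that sequence is
    countable, which is what makes all of them measurable. *)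
Definition ball_fun (U : Type) (phi : T -> U) : Prop :=
  forall w w', (forall i, X i w = X i w') -> phi w = phi w'.

Lemma ball_fun_measurable (A : set T) : ball_fun A -> measurable A.
Proof.
move=> dA.
have -> : A = \bigcup_(t : n.-tuple nat)
    (if `[< exists w, A w /\ t = [tuple X i w | i < n] >] then
       \bigcap_(i in [set: 'I_n]) (X i @^-1` [set tnth t i]) else set0).
  apply/seteqP; split=> [w Aw|w [t _]].
    exists [tuple X i w | i < n] => //.
    case: asboolP => [_ i _ /=|]; first by rewrite tnth_mktuple.
    by case; exists w.
  case: asboolP => // -[w' [Aw' tE]] Xt.
  suff -> : A w = A w' by [].
  apply: dA => i; have := Xt i I; rewrite /= tE tnth_mktuple; exact.
apply: countable_bigcupT_measurable => [|t]; first exact: countableP.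
case: ifPn => // _; apply: fin_bigcap_measurable => [|i _].
  exact: finite_finset.
exact: measurable_funPTI.
Qed.

Lemma ball_fun_measurable_fun (phi : T -> R) :
  ball_fun phi -> measurable_fun setT phi.
Proof.
move=> dphi _ B _; rewrite setTI; apply: ball_fun_measurable => w w' ww'.
by rewrite /preimage /= (dphi _ _ ww').
Qed.

Definition ball_bfun (phi : T -> R) : Prop :=
  ball_fun phi /\ exists C, forall w, `|phi w| <= C.

Lemma ball_bfun_integrable phi : ball_bfun phi ->
  P.-integrable setT (EFin \o phi).
Proof.
move=> [dphi [C phiC]]; apply: measurable_bounded_integrable => //.
- by rewrite (le_lt_trans (probability_le1 _ _)) // ltry.
- exact: ball_fun_measurable_fun.
- exists C; split; first exact: num_real.
  by move=> x Cx w _ /=; apply: le_trans (phiC w) (ltW Cx).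
Qed.

Lemma ball_bfun_cst a : ball_bfun (fun=> a).
Proof. by split; [move=> ? ?|exists `|a|]. Qed.

Lemma ball_bfunD f g : ball_bfun f -> ball_bfun g -> ball_bfun (fun w => f w + g w).
Proof.
move=> [df [C fC]] [dg [D gD]]; split.
  by move=> w w' ww'; rewrite (df _ _ ww') (dg _ _ ww').
by exists (C + D) => w; rewrite (le_trans (ler_normD _ _)) // lerD.
Qed.

Lemma ball_bfunM f g : ball_bfun f -> ball_bfun g -> ball_bfun (fun w => f w * g w).
Proof.
move=> [df [C fC]] [dg [D gD]]; split.
  by move=> w w' ww'; rewrite (df _ _ ww') (dg _ _ ww').
by exists (C * D) => w; rewrite normrM ler_pM.
Qed.

Lemma ball_bfun_norm f : ball_bfun f -> ball_bfun (fun w => `|f w|).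
Proof.
move=> [df [C fC]]; split.
  by move=> w w' ww'; rewrite (df _ _ ww').
by exists C => w; rewrite normr_id.
Qed.

Lemma ball_bfun_sum (K : Type) (s : seq K) (Q : pred K) (f : K -> T -> R) :
  (forall k, Q k -> ball_bfun (f k)) ->
  ball_bfun (fun w => \sum_(k <- s | Q k) f k w).
Proof.
move=> df; elim: s => [|k s IH].
  by under eq_fun do rewrite big_nil; exact: ball_bfun_cst.
under eq_fun do rewrite big_cons; case: (boolP (Q k)) => Qk //.
by apply: ball_bfunD => //; exact: df.
Qed.

Lemma ball_bfun_bool (b : T -> bool) : ball_fun b -> ball_bfun (fun w => (b w)%:R).
Proof.
move=> db; split; first by move=> w w' ww'; rewrite (db _ _ ww').
by exists 1 => w; rewrite normr_nat; case: (b w) => /=; rewrite ?ler01 ?lexx.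
Qed.

Lemma ball_bfun_indic (A : set T) : ball_fun A -> ball_bfun (\1_A : T -> R).
Proof.
move=> dA; split.
  move=> w w' ww'; rewrite !indicE; congr ((nat_of_bool _)%:R).
  by apply/idP/idP; rewrite !inE (dA _ _ ww').
by exists 1 => w; rewrite indicE normr_nat; case: (_ \in _) => /=; rewrite ?ler01 ?lexx.
Qed.

Definition Er (phi : T -> R) : R := \int[P]_x phi x.

Lemma Er_cst a : Er (fun=> a) = a.
Proof. rewrite /Er Rintegral_cst //.
have e : fine (P setT) = 1 by rewrite probability_setT.
by rewrite [fine _]e mulr1. Qed.

Lemma ErD f g : ball_bfun f -> ball_bfun g ->
  Er (fun w => f w + g w) = Er f + Er g.
Proof. by move=> /ball_bfun_integrable ? /ball_bfun_integrable ?; rewrite /Er RintegralD. Qed.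

Lemma ErZ a f : ball_bfun f -> Er (fun w => a * f w) = a * Er f.
Proof. by move=> /ball_bfun_integrable ?; rewrite /Er RintegralZl. Qed.

Lemma ErB f g : ball_bfun f -> ball_bfun g ->
  Er (fun w => f w - g w) = Er f - Er g.
Proof.
move=> bf bg; rewrite -[in RHS]mulN1r -ErZ // -ErD //; last first.
  by apply: ball_bfunM => //; exact: ball_bfun_cst.
by congr Er; apply/funext => w; rewrite mulN1r.
Qed.

Lemma Er_sum (K : Type) (s : seq K) (Q : pred K) (f : K -> T -> R) :
  (forall k, Q k -> ball_bfun (f k)) ->
  Er (fun w => \sum_(k <- s | Q k) f k w) = \sum_(k <- s | Q k) Er (f k).
Proof.
move=> df; elim: s => [|k s IH].
  by under eq_fun do rewrite big_nil; rewrite big_nil Er_cst.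
under eq_fun do rewrite big_cons; rewrite big_cons.
case: (boolP (Q k)) => Qk //.
by rewrite ErD ?IH //; [exact: df|exact: ball_bfun_sum].
Qed.

Lemma ler_Er f g : ball_bfun f -> ball_bfun g -> (forall w, f w <= g w) ->
  Er f <= Er g.
Proof.
by move=> /ball_bfun_integrable ? /ball_bfun_integrable ? fg; apply: le_Rintegral.
Qed.

Lemma ler_norm_Er f : ball_bfun f -> `|Er f| <= Er (fun w => `|f w|).
Proof.
move=> bf; have bn := ball_bfun_norm bf.
have bN : ball_bfun (fun w => -1 * f w).
  by apply: ball_bfunM => //; exact: ball_bfun_cst.
rewrite ler_norml; apply/andP; split; last by apply: ler_Er => // w; exact: ler_norm.
rewrite lerNl -mulN1r -ErZ //; apply: ler_Er => // w.
by rewrite mulN1r -normrN ler_norm.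
Qed.

Lemma Er_indic (A : set T) : ball_fun A -> Er \1_A = fine (P A).
Proof.
move=> /ball_fun_measurable mA; rewrite /Er /Rintegral integral_indic //.
by rewrite setIT.
Qed.

Lemma expectation_Er f : ball_bfun f -> ('E_P[f] = (Er f)%:E)%E.
Proof.
move=> /ball_bfun_integrable fi.
by rewrite unlock /Er /Rintegral fineK // integrable_fin_num.
Qed.

Lemma fine_expectation_Er f : ball_bfun f -> fine ('E_P[f])%E = Er f.
Proof. by move=> bf; rewrite expectation_Er. Qed.

Lemma fine_variance_Er f : ball_bfun f ->
  fine ('V_P[f])%E = Er (fun w => f w * f w) - Er f ^+ 2.
Proof.
move=> bf; have bff := ball_bfunM bf bf; have b1 a := ball_bfun_cst a.
rewrite /variance covariance.unlock (fine_expectation_Er bf).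
set m := Er f.
have -> : ((f \- cst m) * (f \- cst m))%R =
    fun w => (f w * f w + (- 2 * m) * f w) + m ^+ 2.
  by apply/funext => w /=; rewrite -[LHS]/((f w - m) * (f w - m)); ring.
have bz a : ball_bfun (fun w => a * f w) by exact: ball_bfunM (b1 a) bf.
rewrite fine_expectation_Er; last by do 2 apply: ball_bfunD => //.
by rewrite ErD ?ErD ?ErZ ?Er_cst //; [rewrite -/m; ring|exact: ball_bfunD].
Qed.

Lemma Er_indic_bool (b : T -> bool) : ball_fun b ->
  Er (fun w => (b w)%:R) = fine (P [set w | b w]).
Proof.
move=> db; rewrite -Er_indic; last by move=> w w' ww' /=; rewrite (db _ _ ww').
by congr Er; apply/funext => w; rewrite indicE mem_setE.
Qed.

End scheme_expectation.

(** * The law of the number of boxes with r balls *)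

Section scheme_counts.
Context d (T : measurableType d) {R : realType} (P : probability T R).
Variables (n : nat) (X : 'I_n -> {RV P >-> nat}).
Variables (I : finType) (J : {set I}) (lab : I -> nat) (p : I -> R) (r : nat).
Hypothesis X_indep : mutually_independent X.
Hypothesis lab_inj : injective lab.
Hypothesis pE : forall i k, i \in J -> P (X k @^-1` [set lab i]) = (p i)%:E.
Hypothesis r_gt0 : (0 < r)%N.

(** The induction on A that yields the joint law needs a more general event: the
    balls of B fill the boxes of A with r each and avoid those of F, while the
    other balls are subject to individual constraints D. *)
Definition partial_event (A F : {set I}) (B : {set 'I_n}) (D : 'I_n -> set nat) :
    set T :=
  [set w | [/\ forall k, k \notin B -> D k (X k w),
     forall k, k \in B -> forall a, a \in F -> X k w <> lab a &
     forall a, a \in A -> #|[set k in B | X k w == lab a]| = r]].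

Lemma partial_event_fun A F B D : ball_fun X (partial_event A F B D).
Proof.
move=> w w' ww'; rewrite /partial_event /=; apply/propext.
have e a : [set k in B | X k w == lab a] = [set k in B | X k w' == lab a].
  by apply/setP => k; rewrite !inE ww'.
by split=> -[h1 h2 h3]; split=> k kB; [rewrite -ww'|move=> a; rewrite -ww'|rewrite -e
  |rewrite ww'|move=> a; rewrite ww'|rewrite e]; auto.
Qed.

Let pr k (D : set nat) : R := fine (P (X k @^-1` D)).

Let prE k (D : set nat) : P (X k @^-1` D) = (pr k D)%:E.
Proof. by rewrite /pr fineK // fin_num_measure //; exact: measurable_funPTI. Qed.

Let pre_fun k (D : set nat) : ball_fun X (X k @^-1` D).
Proof. by move=> w w' ww'; rewrite /preimage /= ww'. Qed.

Lemma prob_avoid k (F : {set I}) : F \subset J ->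
  pr k [set x | forall a, a \in F -> x <> lab a] = 1 - \sum_(a in F) p a.
Proof.
move=> FJ; rewrite /pr -(@Er_indic _ _ _ P n X _ (pre_fun _ _)).
have -> : \1_(X k @^-1` [set x | forall a, a \in F -> x <> lab a]) =
    (fun w => 1 - \sum_(a in F) \1_(X k @^-1` [set lab a]) w) :> (T -> R).
  apply/funext => w; rewrite indicE.
  have [h|] := pselect ((X k @^-1` [set x | forall a, a \in F -> x <> lab a]) w).
    rewrite mem_set // big1 ?subr0 // => a aF; rewrite indicE memNset //=.
    exact: h.
  move=> h; rewrite memNset //; move: h.
  move=> /existsNP[a /not_implyP[aF /contrapT xa]].
  rewrite (bigD1 a) //= indicE mem_set // big1 ?addr0 ?subrr // => b /andP[bF ba].
  rewrite indicE memNset //= xa => /lab_inj ab; by rewrite ab eqxx in ba.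
have bi a : ball_bfun X (\1_(X k @^-1` [set lab a]) : T -> R).
  by apply: ball_bfun_indic; exact: pre_fun.
rewrite (@ErB _ _ _ P n X); [|exact: ball_bfun_cst|exact: ball_bfun_sum].
rewrite Er_cst (@Er_sum _ _ _ P n X _ _ _ _ (fun a _ => bi a)); congr (_ - _); apply: eq_bigr => a aF.
by rewrite (@Er_indic _ _ _ P n X _ (pre_fun _ _)) pE //; exact: fintype.subsetP FJ _ aF.
Qed.

(** The event is split according to the set of the r balls in one box of A; these
    balls become constrained individually, and the box is thereafter one to
    avoid. *)
Lemma prob_partial_event (A F : {set I}) (B : {set 'I_n}) (D : 'I_n -> set nat) :
  A \subset J -> F \subset J -> [disjoint A & F]%B ->
  fine (P (partial_event A F B D)) =
  (\prod_(k | k \notin B) pr k (D k)) *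
  ie_coef r (powfact r p) p #|B| (1 - \sum_(a in F) p a) A.
Proof.
move: {2}#|A| (erefl #|A|) => m; elim: m A F B D => [|m IH] A F B D.
  move=> /eqP; rewrite cards_eq0 => /eqP -> _ FJ _.
  (* All constraints are now on individual balls, which are independent. *)
  pose D' k := if k \in B then [set x | forall a, a \in F -> x <> lab a] else D k.
  have -> : partial_event finset.set0 F B D =
      \bigcap_(k in [set` [set: 'I_n]%SET]) (X k @^-1` D' k).
    apply/seteqP; split=> [w [h1 h2 _] k _|w h].
      by rewrite /preimage /= /D'; case: ifPn => kB; [exact: h2|exact: h1].
    split=> [k kB|k kB|a]; last by rewrite inE.
      by have := h k; rewrite /= finset.in_setT /preimage /= /D' (negbTE kB); apply.
    by have := h k; rewrite /= finset.in_setT /preimage /= /D' kB; apply.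
  rewrite X_indep //.
  have -> : (\prod_(k in [set: 'I_n]%SET) P (X k @^-1` D' k))%E =
      (\prod_(k < n) pr k (D' k))%:E.
    rewrite -prodEFin; apply: eq_big => [k|k _]; first by rewrite finset.in_setT.
    exact: prE.
  rewrite /= (bigID (fun k => k \notin B)) /=; congr (_ * _).
    by apply: eq_bigr => k kB; rewrite /D' (negbTE kB).
  rewrite /ie_coef cards0 muln0 ffactn0 !finset.big_set0 subn0 subr0 !mul1r.
  rewrite (eq_bigr (fun=> 1 - \sum_(a in F) p a)); last first.
    by move=> k; rewrite negbK => kB; rewrite /D' kB prob_avoid.
  rewrite (eq_bigl (mem B)); last by move=> k; rewrite negbK.
  by rewrite prodr_const.
move=> Am AJ FJ dAF; have /card_gt0P[a aA] : (0 < #|A|)%N by rewrite Am.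
have aJ : a \in J := fintype.subsetP AJ _ aA.
have Am' : #|A :\ a| = m by move: Am; rewrite (cardsD1 a) aA add1n => -[].
have aA' : a \notin A :\ a by rewrite !inE eqxx.
have aF : a \notin F.
  by move: dAF; rewrite disjoint_subset => /fintype.subsetP /(_ _ aA); rewrite inE.
pose DR (Rs : {set 'I_n}) k := if k \in Rs then [set lab a] else D k.
pose ev (Rs : {set 'I_n}) := partial_event (A :\ a) (a |: F) (B :\: Rs) (DR Rs).
pose Q := [pred Rs : {set 'I_n} | (Rs \subset B) && (#|Rs| == r)].
have ind : \1_(partial_event A F B D) =
    (fun w => \sum_(Rs | Q Rs) \1_(ev Rs) w) :> (T -> R).
  apply/funext => w; pose R0 : {set 'I_n} := [set k in B | X k w == lab a].
  have R0B : R0 \subset B by apply/fintype.subsetP => k; rewrite inE => /andP[].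
  have evR0 (Rs : {set 'I_n}) : Rs \subset B -> ev Rs w -> Rs = R0.
    move=> RsB [h1 h2 _]; apply/setP => k; rewrite inE; apply/idP/andP => [kR|[kB /eqP kx]].
      have kB := fintype.subsetP RsB _ kR; split => //.
      have := h1 k; rewrite !inE kR /= => /(_ isT); rewrite /DR kR /= => ->.
      exact: eqxx.
    apply/negPn/negP => kR; have := h2 k; rewrite !inE kR kB => /(_ isT a).
    by rewrite !inE eqxx => /(_ isT); apply.
  have cnt b : b \in A :\ a ->
      [set k in B :\: R0 | X k w == lab b] = [set k in B | X k w == lab b].
    rewrite !inE => /andP[ba bA]; apply/setP => k; rewrite !inE.
    case: (k \in B) => /=; last by rewrite ?andbF.
    case: (X k w =P lab b) => [->|_]; rewrite ?andbF // !andbT.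
    by apply/eqP => /lab_inj e; rewrite e eqxx in ba.
  rewrite indicE; have [h|h] := pselect (partial_event A F B D w).
    rewrite mem_set //; have [h1 h2 h3] := h.
    have R0r : #|R0| = r by exact: h3.
    rewrite (bigD1 R0) /=; last by rewrite R0B R0r eqxx.
    rewrite big1 ?addr0 => [|Rs /andP[/andP[RsB _] RsR]]; last first.
      rewrite indicE memNset // => /(evR0 _ RsB) e.
      by rewrite e eqxx in RsR.
    rewrite indicE mem_set //; split.
    - move=> k; rewrite /DR inE negb_and negbK; case: ifPn => [|kR /= kB].
        by rewrite inE => /andP[_ /eqP].
      exact: h1.
    - move=> k; rewrite !inE => /andP[kR kB] b; rewrite !inE => /orP[/eqP ->|bF].
        by move=> xa; move: kR; rewrite kB xa eqxx.
      exact: h2.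
    - by move=> b bA; rewrite cnt //; apply: h3; move: bA; rewrite inE => /andP[].
  rewrite memNset // big1 // => Rs /andP[RsB /eqP Rsr]; rewrite indicE memNset // => evw.
  have e := evR0 _ RsB evw; apply: h; move: evw; rewrite e => -[h1 h2 h3]; split.
  - move=> k kB; have kR : k \notin R0 by apply: contra kB => /(fintype.subsetP R0B).
    by have := h1 k; rewrite !inE (negbTE kB) andbF /DR (negbTE kR); apply.
  - move=> k kB b bF; have [kR|kR] := boolP (k \in R0).
      move: (kR); rewrite inE => /andP[_ /eqP ->] /lab_inj ab.
      by rewrite ab bF in aF.
    by apply: h2; [rewrite finset.in_setD kR kB|rewrite !inE bF orbT].
  - move=> b bA; have [->|ba] := eqVneq b a; first by rewrite -/R0 -e.
    have bA' : b \in A :\ a by rewrite !inE ba.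
    by rewrite -cnt // h3.
have pe Rs := partial_event_fun (A :\ a) (a |: F) (B :\: Rs) (DR Rs).
rewrite -(@Er_indic _ _ _ P n X _ (partial_event_fun A F B D)).
rewrite ind (@Er_sum _ _ _ P n X); last by move=> Rs _; exact: ball_bfun_indic (pe Rs).
have pa k : pr k [set lab a] = p a by rewrite /pr pE.
transitivity (\sum_(Rs | Q Rs) (\prod_(k | k \notin B) pr k (D k)) * (p a ^+ r *
   ie_coef r (powfact r p) p (#|B| - r) (1 - \sum_(a in F) p a - p a) (A :\ a))).
  apply: eq_bigr.
  move=> Rs; rewrite /Q /= => /andP[RsB /eqP Rsr].
  rewrite (@Er_indic _ _ _ P n X _ (pe Rs)) IH //; last first.
  - rewrite disjoint_subset; apply/fintype.subsetP => x.
    rewrite !inE => /andP[xa xA]; rewrite negb_or xa /=.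
    by move: dAF; rewrite disjoint_subset => /fintype.subsetP /(_ _ xA); rewrite inE.
  - by rewrite finset.subUset finset.sub1set aJ.
  - by apply: fintype.subset_trans AJ; exact: finset.subD1set.
  rewrite cardsD (finset.setIidPr RsB) Rsr big_setU1 //= mulrA.
  congr (_ * _); last by congr ie_coef; ring.
  rewrite (bigID (fun k => k \in Rs)) /= mulrC; congr (_ * _).
    apply: eq_big => [k|k]; rewrite !inE negb_and negbK.
      case kR : (k \in Rs) => //=; last by rewrite andbT.
      by rewrite (fintype.subsetP RsB).
    by move=> /andP[_ kR]; rewrite /DR (negbTE kR).
  rewrite (eq_bigr (fun=> p a)); last first.
    by move=> k /andP[_ kR]; rewrite /DR kR pa.
  rewrite (eq_bigl (fun k => k \in Rs)); last first.
    by move=> k; rewrite !inE negb_and negbK; case: (k \in Rs); rewrite ?andbF.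
  by rewrite prodr_const Rsr.
rewrite sumr_const.
have -> : #|Q| = 'C(#|B|, r).
  by rewrite -cards_draws; apply: eq_card => Rs; rewrite !inE.
rewrite -[in RHS](finset.setD1K aA) ie_coef_setU1 // -mulr_natr.
rewrite /powfact -bin_ffact natrM.
have r0 : r`!%:R != 0 :> R by rewrite pnatr_eq0 -lt0n fact_gt0.
by field.
Qed.

Lemma Er_all_counts (A : {set I}) : A \subset J ->
  Er P (fun w => \prod_(a in A) (balls_in X (lab a) w == r)%:R) =
  ie_coef r (powfact r p) p n 1 A.
Proof.
move=> AJ; have := @prob_partial_event A finset.set0 [set: 'I_n]%SET (fun=> setT) AJ.
have dA : [disjoint A & finset.set0]%B.
  by rewrite disjoint_sym disjoint_subset; apply/fintype.subsetP => x; rewrite inE.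
rewrite finset.sub0set finset.big_set0 subr0 cardsT card_ord => /(_ isT dA).
rewrite big_pred0; last by move=> k; rewrite inE.
rewrite mul1r => <-; rewrite -(@Er_indic _ _ _ P n X _ (partial_event_fun _ _ _ _)).
congr Er; apply/funext => w; rewrite indicE.
have cE a : #|[set k in [set: 'I_n]%SET | X k w == lab a]| = balls_in X (lab a) w.
  by rewrite /balls_in; apply: eq_card => k; rewrite !inE.
have [h|h] := pselect (partial_event A finset.set0 [set: 'I_n]%SET (fun=> setT) w).
  rewrite mem_set //; have [_ _ h3] := h; rewrite big1 // => a aA; rewrite -cE h3 // eqxx //.
have [a aA aN] : exists2 a, a \in A & balls_in X (lab a) w != r.
  apply: contrapT => /forall2NP H; apply: h; split; [by move=> k; rewrite inE|by move=> k _ a; rewrite inE|].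
  move=> a aA; rewrite cE; have [//|/negP/negPn/eqP//] := H a.
by rewrite memNset // (bigD1 a) //= (negbTE aN) mul0r.
Qed.

Definition count_in (w : T) : nat := (\sum_(i in J) (balls_in X (lab i) w == r))%N.

Lemma balls_in_fun j : ball_fun X (balls_in X j).
Proof.
by move=> w w' ww'; rewrite /balls_in; apply: eq_card => k; rewrite !inE ww'.
Qed.

Lemma count_in_fun (U : Type) (f : nat -> U) : ball_fun X (fun w => f (count_in w)).
Proof.
move=> w w' ww'; congr f; apply: eq_bigr => i _.
by rewrite (balls_in_fun _ ww').
Qed.

Lemma Er_count_in f : Er P (fun w => f (count_in w)) = eocc r p J n 1 f.
Proof.
under eq_fun do rewrite /count_in expansion_at_count.
have bp (A : {set I}) : ball_bfun X (fun w => \prod_(a in A) (balls_in X (lab a) w == r)%:R : R).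
  under eq_fun do rewrite -big_enum /=.
  elim: (enum A) => [|a s bg].
    by under eq_fun do rewrite big_nil; exact: ball_bfun_cst.
  under eq_fun do rewrite big_cons.
  apply: ball_bfunM bg; apply: ball_bfun_bool => w w' ww'.
  by rewrite (balls_in_fun _ ww').
rewrite (@Er_sum _ _ _ P n X); last by move=> A _; apply: ball_bfunM (bp A) (ball_bfun_cst _ _).
rewrite /eocc expr1n divr1 /occ; apply: eq_bigr => A AJ.
under eq_fun do rewrite mulrC.
by rewrite (@ErZ _ _ _ P n X _ _ (bp A)) // Er_all_counts // mulrC.
Qed.

End scheme_counts.

(** * Counting boxes within a finite set *)

Section box_sums.
Context {R : realType} (p : nat -> R).
Hypothesis p_gt0 : forall j, (1 <= j)%N -> 0 < p j.
Hypothesis p_sum1 : (\sum_(1 <= j <oo) (p j)%:E = 1)%E.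

Lemma partial_sum_le1 k : \sum_(1 <= j < k) p j <= 1.
Proof.
rewrite -lee_fin -p_sum1 -sumEFin.
apply: nneseries_lim_ge => j j1 _.
by rewrite lee_fin ltW // p_gt0.
Qed.

Lemma partial_sum_ge (e : R) : 0 < e -> exists k, 1 - e < \sum_(1 <= j < k) p j.
Proof.
move=> e0; apply: contrapT => /forallNP H.
suff : (\sum_(1 <= j <oo) (p j)%:E <= (1 - e)%:E)%E.
  by rewrite p_sum1 lee_fin; lra.
apply: lime_le.
  by apply: is_cvg_nneseries => j j1 _; rewrite lee_fin ltW // p_gt0.
apply: nearW => k; rewrite sumEFin lee_fin leNgt; apply/negP; exact: H.
Qed.

End box_sums.

Section box_counts.
Context d (T : measurableType d) {R : realType} (P : probability T R).
Variables (n : nat) (X : 'I_n -> {RV P >-> nat}) (r : nat).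
Hypothesis r_gt0 : (0 < r)%N.

Lemma boxes_with_le w : (boxes_with X r w <= n)%N.
Proof.
rewrite /boxes_with.
rewrite -[leqRHS]size_enum_ord -(size_map (fun i => X i w)).
apply: uniq_leq_size; first exact: fset_uniq.
move=> j; rewrite -[_ \in enum_fset _]/(j \in fset_set _) in_fset_set; last exact: finite_boxes_with.
rewrite inE /= => -[_ jr]; move: r_gt0; rewrite -jr => /card_gt0P[i].
by rewrite inE => /eqP <-; apply/mapP; exists i => //; rewrite mem_enum.
Qed.

Lemma boxes_with_fun : ball_fun X (boxes_with X r).
Proof.
move=> w w' ww'; rewrite /boxes_with; congr #|` fset_set _|.
by apply/funext => j /=; rewrite (balls_in_fun _ ww').
Qed.

Lemma boxes_with_count (M : nat) (J : {set 'I_M}) w :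
  (forall k, (X k w < M)%N) ->
  (forall i : 'I_M, (1 <= i)%N -> i \notin J -> balls_in X i w <> r) ->
  (forall i, i \in J -> (1 <= i)%N) ->
  boxes_with X r w = count_in X J val r w.
Proof.
move=> XM nJ J1; rewrite /boxes_with /count_in.
pose s := [seq val i | i <- enum [set i in J | balls_in X (val i) w == r]%SET].
have fS := finite_boxes_with X w r_gt0.
transitivity (size s).
  apply: perm_size; apply: uniq_perm; first exact: fset_uniq.
    by rewrite map_inj_uniq ?enum_uniq //; exact: val_inj.
  move=> j; rewrite -[_ \in enum_fset _]/(j \in fset_set _) in_fset_set //.
  apply/idP/mapP => [|[i]].
    rewrite inE /= => -[j1 jr].
    have [k kj] : exists k, X k w = j.
      move: (r_gt0); rewrite -jr => /card_gt0P[k]; rewrite inE => /eqP kj.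
      by exists k.
    have jM : (j < M)%N by rewrite -kj.
    exists (Ordinal jM) => //; rewrite mem_enum inE /= jr eqxx andbT.
    by apply/negPn/negP => /(nJ (Ordinal jM) j1); apply.
  rewrite mem_enum finset.in_set => /andP[iJ /eqP ir] ->.
  by rewrite inE /=; split; [exact: J1|].
rewrite /s size_map -cardE -sum1_card big_mkcond /= [RHS]big_mkcond /=.
by apply: eq_bigr => i _; rewrite inE; case: (i \in J) => //=; case: eqP.
Qed.

End box_counts.

(** * Truncation to the small boxes *)

Section transfer.
Context d (T : measurableType d) {R : realType} (P : probability T R).
Variables (n : nat) (X : 'I_n -> {RV P >-> nat}).
Local Notation Er := (Er P).

Lemma count_bfun (V : T -> nat) N (f : nat -> R) : ball_fun X V ->
  (forall w, (V w <= N)%N) -> ball_bfun X (fun w => f (V w)).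
Proof.
move=> dV VN; split; first by move=> w w' ww'; rewrite (dV _ _ ww').
exists (\sum_(k < N.+1) `|f k|) => w.
have VN' : (V w < N.+1)%N by rewrite ltnS.
by rewrite (bigD1 (Ordinal VN')) //= lerDl sumr_ge0.
Qed.

(** For f constant and for f the identity this vanishes; it measures how far the
    law of V is from satisfying the Stein equation of its translated Poisson
    law. *)
Definition stein_defect (V : T -> nat) (f : nat -> R) : R :=
  Er (fun w => (V w)%:R * f (V w)) - Er (fun w => (V w)%:R) * Er (fun w => f (V w)) -
  (Er (fun w => (V w)%:R * (V w)%:R) - Er (fun w => (V w)%:R) ^+ 2) *
    Er (fun w => fdiff f (V w)).

Variables (V V' : T -> nat).
Hypothesis dV : ball_fun X V.
Hypothesis dV' : ball_fun X V'.
Hypothesis V_le : forall w, (V w <= n)%N.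
Hypothesis V'_le : forall w, (V' w <= n)%N.
Let eps := Er (fun w => (V w != V' w)%:R).

Let bad_bfun : ball_bfun X (fun w => (V w != V' w)%:R : R).
Proof.
by apply: ball_bfun_bool => w w' ww'; rewrite (dV ww') (dV' ww').
Qed.

Let eps_ge0 : 0 <= eps.
Proof.
rewrite -(Er_cst P 0); apply: (@ler_Er _ _ _ P n X) => //; exact: ball_bfun_cst.
Qed.

Let bV f := count_bfun f dV V_le.
Let bV' f := count_bfun f dV' V'_le.

Let close (f : nat -> R) (K : R) : (forall k, (k <= n)%N -> `|f k| <= K) ->
  `|Er (fun w => f (V w)) - Er (fun w => f (V' w))| <= 2 * K * eps.
Proof.
move=> fK.
have -> : Er (fun w => f (V w)) - Er (fun w => f (V' w)) =
    Er (fun w => f (V w) - f (V' w)) by rewrite (@ErB _ _ _ P n X).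
have bd : ball_bfun X (fun w => f (V w) - f (V' w)).
  rewrite (_ : (fun w => _) = fun w => f (V w) + -1 * f (V' w)); last first.
    by apply/funext => w; rewrite mulN1r.
  apply: ball_bfunD => //; apply: ball_bfunM => //; exact: ball_bfun_cst.
apply: (le_trans (@ler_norm_Er _ _ _ P n X _ bd)); rewrite /eps -(@ErZ _ _ _ P n X) //.
apply: (@ler_Er _ _ _ P n X); first exact: ball_bfun_norm.
  by apply: ball_bfunM => //; exact: ball_bfun_cst.
move=> w; case: eqP => [->|_]; first by rewrite subrr normr0 mulr0.
rewrite mulr1; apply: (le_trans (ler_normB _ _)).
by rewrite mulr_natl mulr2n; apply: lerD; apply: fK.
Qed.

Let bnd (U : T -> nat) (f : nat -> R) K : ball_fun X U -> (forall w, (U w <= n)%N) ->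
  (forall k, (k <= n)%N -> `|f k| <= K) -> `|Er (fun w => f (U w))| <= K.
Proof.
move=> dU Un fK; apply: (le_trans (@ler_norm_Er _ _ _ P n X _ (count_bfun f dU Un))).
rewrite -[leRHS](Er_cst P); apply: (@ler_Er _ _ _ P n X).
- exact/ball_bfun_norm/(count_bfun f dU Un).
- exact: ball_bfun_cst.
- by move=> w; apply: fK.
Qed.

Let defect_shift (U : T -> nat) f a : ball_fun X U -> (forall w, (U w <= n)%N) ->
  stein_defect U (fun k => f k + a) = stein_defect U f.
Proof.
move=> dU Un; rewrite /stein_defect.
have b g := count_bfun g dU Un.
have -> : (fun w => (U w)%:R * (f (U w) + a)) =
    fun w => (U w)%:R * f (U w) + a * (U w)%:R.
  by apply/funext => w; ring.
have -> : fdiff (fun k => f k + a) = fdiff f.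
  by apply/funext => k; rewrite /fdiff; ring.
rewrite (@ErD _ _ _ P n X _ _ (b (fun k => k%:R * f k)) (b (fun k => a * k%:R))).
rewrite (@ErZ _ _ _ P n X a _ (b (fun k => k%:R))).
rewrite (@ErD _ _ _ P n X _ _ (b f) (ball_bfun_cst X a)) Er_cst; ring.
Qed.

(** Only differences of f enter, as constants do not contribute; f can therefore be
    assumed to vanish at 0, and is then of order n * L on the range of the
    counts. *)
Lemma stein_defect_close f L : (forall k, `|fdiff f k| <= L) ->
  `|stein_defect V f - stein_defect V' f| <= 16 * n%:R ^+ 2 * L * eps.
Proof.
move=> fL; pose g k := f k + - f 0.
rewrite -(defect_shift f (- f 0) dV V_le) -(defect_shift f (- f 0) dV' V'_le).
rewrite -/g; set N : R := n%:R; have N0 : 0 <= N by [].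
have L0 : 0 <= L by apply: le_trans (fL 0%N).
have fg : fdiff g = fdiff f by apply/funext => k; rewrite /fdiff /g; ring.
have gk k : (k <= n)%N -> `|g k| <= N * L.
  move=> kn; apply: (@le_trans _ _ (k%:R * L)); last by rewrite ler_wpM2r // ler_nat.
  elim: k {kn} => [|k IH]; first by rewrite /g subrr normr0 mul0r.
  have -> : g k.+1 = g k + fdiff f k by rewrite /g /fdiff; ring.
  rewrite -natr1 mulrDl mul1r; apply: (le_trans (ler_normD _ _)); exact: lerD.
have k1 k : (k <= n)%N -> `|k%:R| <= N by move=> kn; rewrite normr_nat ler_nat.
have k2 k : (k <= n)%N -> `|k%:R * k%:R| <= N * N.
  by move=> kn; rewrite normrM ler_pM ?k1.
have kg k : (k <= n)%N -> `|k%:R * g k| <= N * (N * L).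
  by move=> kn; rewrite normrM ler_pM ?k1 ?gk.
have kd k : (k <= n)%N -> `|fdiff g k| <= L by rewrite fg.
rewrite /stein_defect.
have A1 := close (f := fun k => k%:R * g k) kg.
have A2 := close k1; have A3 := close gk; have A4 := close k2; have A5 := close kd.
have B1 := bnd (f := fun k => k%:R) dV V_le k1.
have B2 := bnd (f := fun k => k%:R) dV' V'_le k1.
have B3 := bnd (f := g) dV V_le gk.
have B4 := bnd (f := fun k => k%:R * k%:R) dV' V'_le k2.
have B5 := bnd (f := fdiff g) dV V_le kd.
move: A1 A2 A3 A4 A5 B1 B2 B3 B4 B5.
set a1 := Er (fun w => (V w)%:R * g (V w)); set a1' := Er (fun w => (V' w)%:R * g (V' w)).
set a2 := Er (fun w => (V w)%:R); set a2' := Er (fun w => (V' w)%:R).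
set a3 := Er (fun w => g (V w)); set a3' := Er (fun w => g (V' w)).
set a4 := Er (fun w => (V w)%:R * (V w)%:R); set a4' := Er (fun w => (V' w)%:R * (V' w)%:R).
set a5 := Er (fun w => fdiff g (V w)); set a5' := Er (fun w => fdiff g (V' w)).
move=> A1 A2 A3 A4 A5 B1 B2 B3 B4 B5.
have e0 := eps_ge0.
have -> : a1 - a2 * a3 - (a4 - a2 ^+ 2) * a5 - (a1' - a2' * a3' - (a4' - a2' ^+ 2) * a5') =
  (a1 - a1') - ((a2 - a2') * a3 + a2' * (a3 - a3')) -
  (((a4 - a4') - (a2 - a2') * (a2 + a2')) * a5 + (a4' - a2' ^+ 2) * (a5 - a5')) by ring.
have C1 : `|(a2 - a2') * a3| <= 2 * N * eps * (N * L) by rewrite normrM ler_pM.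
have C2 : `|a2' * (a3 - a3')| <= N * (2 * (N * L) * eps) by rewrite normrM ler_pM.
have C3 : `|(a2 - a2') * (a2 + a2')| <= 2 * N * eps * (N + N).
  by rewrite normrM ler_pM // (le_trans (ler_normD _ _)) // lerD.
have C4 : `|((a4 - a4') - (a2 - a2') * (a2 + a2')) * a5| <=
    (2 * (N * N) * eps + 2 * N * eps * (N + N)) * L.
  by rewrite normrM ler_pM // (le_trans (ler_normB _ _)) // lerD.
have C5 : `|(a4' - a2' ^+ 2) * (a5 - a5')| <= (N * N + N * N) * (2 * L * eps).
  rewrite normrM ler_pM // (le_trans (ler_normB _ _)) // lerD //.
  by rewrite expr2 normrM ler_pM.
apply: (le_trans (ler_normB _ _)).
have -> : 16 * N ^+ 2 * L * eps =
  (2 * (N * (N * L)) * eps + (2 * N * eps * (N * L) + N * (2 * (N * L) * eps))) +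
  ((2 * (N * N) * eps + 2 * N * eps * (N + N)) * L + (N * N + N * N) * (2 * L * eps)) by ring.
apply: lerD; last by apply: (le_trans (ler_normD _ _)); exact: lerD.
apply: (le_trans (ler_normB _ _)); apply: lerD => //.
by apply: (le_trans (ler_normD _ _)); exact: lerD.
Qed.

Lemma variance_close :
  `|(Er (fun w => (V w)%:R * (V w)%:R) - Er (fun w => (V w)%:R) ^+ 2) -
    (Er (fun w => (V' w)%:R * (V' w)%:R) - Er (fun w => (V' w)%:R) ^+ 2)| <=
  6 * n%:R ^+ 2 * eps.
Proof.
set N : R := n%:R; have N0 : 0 <= N by [].
have k1 k : (k <= n)%N -> `|k%:R| <= N by move=> kn; rewrite normr_nat ler_nat.
have k2 k : (k <= n)%N -> `|k%:R * k%:R| <= N * N.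
  by move=> kn; rewrite normrM ler_pM ?k1.
have A2 := close k1; have A4 := close k2.
have B1 := bnd (f := fun k => k%:R) dV V_le k1.
have B2 := bnd (f := fun k => k%:R) dV' V'_le k1.
move: A2 A4 B1 B2.
set a2 := Er (fun w => (V w)%:R); set a2' := Er (fun w => (V' w)%:R).
set a4 := Er (fun w => (V w)%:R * (V w)%:R); set a4' := Er (fun w => (V' w)%:R * (V' w)%:R).
move=> A2 A4 B1 B2; have e0 := eps_ge0.
have C3 : `|(a2 - a2') * (a2 + a2')| <= 2 * N * eps * (N + N).
  by rewrite normrM ler_pM // (le_trans (ler_normD _ _)) // lerD.
have -> : a4 - a2 ^+ 2 - (a4' - a2' ^+ 2) = (a4 - a4') - (a2 - a2') * (a2 + a2') by ring.
have -> : 6 * N ^+ 2 * eps = 2 * (N * N) * eps + 2 * N * eps * (N + N) by ring.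
by apply: (le_trans (ler_normB _ _)); exact: lerD.
Qed.

End transfer.

Section truncation.
Context d (T : measurableType d) {R : realType} (P : probability T R).
Variables (n : nat) (X : 'I_n -> {RV P >-> nat}) (r : nat).
Variables (p : nat -> R) (tau : R).
Hypothesis r_gt0 : (0 < r)%N.
Hypothesis n_big : (2 * r <= n)%N.
Hypothesis p_gt0 : forall j, (1 <= j)%N -> 0 < p j.
Hypothesis p_sum1 : (\sum_(1 <= j <oo) (p j)%:E = 1)%E.
Hypothesis X_scheme : is_occupancy_scheme p X.
Hypothesis tau_ge0 : 0 <= tau.
Local Notation Er := (Er P).

Definition small_boxes M : {set 'I_M} := [set i : 'I_M | (1 <= i)%N && (p i <= tau)]%SET.

Lemma count_in_le M (J : {set 'I_M}) w : (count_in X J val r w <= n)%N.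
Proof.
rewrite /count_in; apply: (@leq_trans (\sum_(i in J) balls_in X (val i) w)).
  by apply: leq_sum => i _; case: eqP => // ->.
apply: (@leq_trans (\sum_(i in J) \sum_(k < n) (X k w == val i))%N).
  apply: leq_sum => i _; rewrite /balls_in -sum1_card big_mkcond /= leq_eqVlt.
  by apply/orP; left; apply/eqP; apply: eq_bigr => k _; rewrite inE; case: eqP.
rewrite exchange_big /= -[leqRHS]card_ord -sum1_card; apply: leq_sum => k _.
have [iX|/existsPn nX] := boolP [exists i in J, X k w == val i]; last first.
  by rewrite big1 // => i iJ; have := nX i; rewrite iJ /= => /negbTE ->.
have [i iJ /eqP Xi] := exists_inP iX.
rewrite (bigD1 i) //= Xi eqxx big1 // => j /andP[_ ji].
by apply/eqP; rewrite eqb0; apply: contra ji => /eqP ij; apply/eqP/val_inj.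
Qed.

Let hitP (i : nat) (k : 'I_n) : (1 <= i)%N -> P (X k @^-1` [set i]) = (p i)%:E.
Proof. by move=> i1; have [_] := X_scheme; apply. Qed.

Let box_fun i k : ball_fun X (fun w => X k w == i).
Proof. by move=> w w' ww'; rewrite ww'. Qed.

Let Er_box i k : (1 <= i)%N -> Er (fun w => (X k w == i)%:R) = p i.
Proof.
move=> i1; rewrite (Er_indic_bool (box_fun i k)).
have -> : [set w | X k w == i] = X k @^-1` [set i].
  by apply/seteqP; split=> w /= /eqP.
by rewrite hitP.
Qed.

Let p_le1 i : (1 <= i)%N -> p i <= 1.
Proof.
move=> i1; apply: le_trans (partial_sum_le1 p_gt0 p_sum1 i.+1).
rewrite big_nat_recr //= lerDr big_nat_cond sumr_ge0 // => j /andP[/andP[j1 _] _].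
by rewrite ltW // p_gt0.
Qed.

Lemma Er_escape M k :
  Er (fun w => (M <= X k w)%:R) <= 1 - \sum_(1 <= j < M) p j.
Proof.
have bb j : ball_bfun X (fun w => (X k w == j)%:R : R) := ball_bfun_bool (box_fun j k).
have -> : 1 - \sum_(1 <= j < M) p j = Er (fun w => 1 - \sum_(1 <= j < M) (X k w == j)%:R).
  rewrite (@ErB _ _ _ P n X); [|exact: ball_bfun_cst|exact: ball_bfun_sum].
  rewrite Er_cst (@Er_sum _ _ _ P n X) //; congr (_ - _).
  by rewrite [LHS]big_nat_cond [RHS]big_nat_cond; apply: eq_bigr => j /andP[/andP[j1 _] _]; rewrite Er_box.
apply: (@ler_Er _ _ _ P n X).
- by apply: ball_bfun_bool => w w' ww'; rewrite ww'.
- rewrite (_ : (fun w => _) = fun w => 1 + -1 * \sum_(1 <= j < M) (X k w == j)%:R); last first.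
    by apply/funext => w; rewrite mulN1r.
  apply: ball_bfunD; first exact: ball_bfun_cst.
  by apply: ball_bfunM; [exact: ball_bfun_cst|exact: ball_bfun_sum].
move=> w; have [MX|XM] := leqP M (X k w).
  rewrite big_nat_cond big1 ?subr0 // => j /andP[/andP[_ jM] _].
  by rewrite (_ : _ == _ = false) //; apply/eqP => Xj; move: MX; rewrite Xj leqNgt jM.
rewrite subr_ge0.
have [X0|X0] := posnP (X k w).
  rewrite big_nat_cond big1 // => j /andP[/andP[j1 _] _].
  by rewrite X0 (_ : _ == _ = false) //; apply/eqP => j0; rewrite -j0 in j1.
rewrite (big_rem (X k w)) /=; last by rewrite mem_index_iota X0.
rewrite eqxx big_seq big1 ?addr0 // => j.
rewrite mem_rem_uniq ?iota_uniq // => /andP[jX _].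
by rewrite eq_sym (_ : (j == X k w) = false) //; apply: negbTE.
Qed.

(** The chance to avoid a box of mass above tau with the n - r >= n / 2 other
    balls is exponentially small; the factor p i makes the bound summable over
    boxes. *)
Lemma Er_big_box i : (1 <= i)%N -> tau < p i ->
  Er (fun w => (balls_in X i w == r)%:R) <=
  p i * (n%:R ^+ r * expR (- (tau * n%:R / 2))).
Proof.
move=> i1 pi; have pi0 := p_gt0 i1; have pi1 := p_le1 i1.
have t0 := tau_ge0.
have inj : injective (fun _ : 'I_1 => i) by move=> x y _; rewrite !ord1.
have pE (x : 'I_1) k : x \in [set: 'I_1]%SET -> P (X k @^-1` [set i]) = (p i)%:E.
  by move=> _; exact: hitP.
have := @Er_all_counts _ T R P n X _ _ _ (fun=> p i) r X_scheme.1 inj pE [set: 'I_1]%SET (fintype.subxx _).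
have -> : [set: 'I_1]%SET = [set ord0]%SET.
  by apply/setP => x; rewrite !inE ord1 eqxx.
under eq_fun do rewrite big_set1; move=> ->.
rewrite /ie_coef cards1 muln1 !big_set1 /powfact.
have h1 : p i ^+ r / r`!%:R * (n ^_ r)%:R <= p i * n%:R ^+ r.
  apply: ler_pM => //; first by rewrite divr_ge0 // exprn_ge0 // ltW.
    rewrite ler_pdivrMr ?ltr0n ?fact_gt0 //; apply: (@le_trans _ _ (p i)).
      by rewrite -(prednK r_gt0) exprS -[leRHS]mulr1 ler_wpM2l ?exprn_ile1 // ltW.
    by rewrite -[leLHS]mulr1 ler_wpM2l ?ler1n ?fact_gt0 // ltW.
  rewrite -natrX ler_nat; elim: (r) => [//|k IH].
  by rewrite ffactnSr expnSr leq_mul // leq_subr.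
have h2 : (1 - p i) ^+ (n - r) <= expR (- (tau * n%:R / 2)).
  apply: (@le_trans _ _ (expR (- p i) ^+ (n - r))).
    by rewrite lerXn2r ?nnegrE ?expR_ge0 //; [lra|exact: expR_ge1Dx].
  rewrite -expRM_natl ler_expR mulrN lerN2.
  have : n%:R <= 2 * (n - r)%:R :> R by rewrite -natrM ler_nat; nlia.
  have : (0 : R) <= (n - r)%:R by [].
  set a := (n - r)%:R; nra.
rewrite [leRHS]mulrA [(n ^_ r)%:R * _]mulrC; apply: ler_pM => //.
  by rewrite mulr_ge0 // divr_ge0 // exprn_ge0 // ltW.
by rewrite exprn_ge0 // subr_ge0.
Qed.

(** The two counts differ only if some ball lands at or beyond M, or some box of
    mass above tau holds exactly r balls. *)
Lemma truncation_error M :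
  Er (fun w => (boxes_with X r w != count_in X (small_boxes M) val r w)%:R) <=
  n%:R * (1 - \sum_(1 <= j < M) p j) + n%:R ^+ r * expR (- (tau * n%:R / 2)).
Proof.
set e := n%:R ^+ r * _.
have e0 : 0 <= e by rewrite mulr_ge0 ?exprn_ge0 ?expR_ge0.
have b1 k : ball_bfun X (fun w => (M <= X k w)%:R : R).
  by apply: ball_bfun_bool => w w' ww'; rewrite ww'.
have b2 i : ball_bfun X (fun w => (balls_in X i w == r)%:R : R).
  by apply: ball_bfun_bool => w w' ww'; rewrite (balls_in_fun _ ww').
pose big := [pred i : 'I_M | (1 <= i)%N && (tau < p i)].
apply: (@le_trans _ _ (Er (fun w => (\sum_(k < n) (M <= X k w)%:R) +
    \sum_(i < M | big i) (balls_in X i w == r)%:R))).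
  apply: (@ler_Er _ _ _ P n X).
  - apply: ball_bfun_bool => w w' ww'.
    by rewrite (boxes_with_fun _ ww') (count_in_fun _ _ _ id ww').
  - by apply: ball_bfunD; apply: ball_bfun_sum.
  move=> w; have [//|bad] := eqVneq (boxes_with X r w) (count_in X (small_boxes M) val r w).
    by rewrite /= addr_ge0 // sumr_ge0.
  have [/existsP[k Mk]|/existsPn Xs] := boolP [exists k, (M <= X k w)%N].
    rewrite (bigD1 k) //= Mk -addrA lerDl addr_ge0 // sumr_ge0 //.
  have [/existsP[i /andP[bi ir]]|/existsPn bs] :=
      boolP [exists i, big i && (balls_in X (nat_of_ord i) w == r)].
    rewrite (bigD1 i) //= ir addrCA lerDl addr_ge0 // sumr_ge0 //.
  case/eqP: bad; apply: boxes_with_count => //.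
  - by move=> k; have := Xs k; rewrite -ltnNge.
  - move=> i i1 iJ ir; have := bs i; rewrite ir eqxx andbT /= i1 /=.
    by move: iJ; rewrite inE i1 /= -ltNge => ->.
  - by move=> i; rewrite inE => /andP[].
rewrite (@ErD _ _ _ P n X); [|exact: ball_bfun_sum|exact: ball_bfun_sum].
rewrite (@Er_sum _ _ _ P n X) // (@Er_sum _ _ _ P n X) //; apply: lerD.
  apply: (@le_trans _ _ (\sum_(k < n) (1 - \sum_(1 <= j < M) p j))).
    by apply: ler_sum => k _; exact: Er_escape.
  by rewrite sumr_const card_ord mulr_natl.
apply: (@le_trans _ _ (\sum_(i < M | big i) p i * e)).
  by apply: ler_sum => i /andP[i1 ti]; exact: Er_big_box.
rewrite -mulr_suml -[leRHS]mul1r ler_wpM2r //.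
apply: le_trans (partial_sum_le1 p_gt0 p_sum1 M).
rewrite (_ : \sum_(1 <= j < M) p j = \sum_(i < M | (1 <= i)%N) p i); last first.
  by rewrite big_geq_mkord.
rewrite [leLHS]big_mkcond [leRHS]big_mkcond /=; apply: ler_sum => i _.
by case: ifP => [/andP[i1 _]|_]; [rewrite i1|case: ifP => // i1; rewrite ltW // p_gt0].
Qed.

End truncation.

(** * From the Stein defect to the distances *)

Section shifted_solution.
Variables (R : realType) (a : int).

(** The solutions of the Poisson equation vanish at 0, so extending them by 0 below
    the shift a creates no jump. *)
Definition shifted (g : nat -> R) (w : nat) : R :=
  if a <= w%:Z then g `|w%:Z - a|%N else 0.

Lemma shifted_fdiff g w : g 0%N = 0 -> fdiff (shifted g) w = shifted (fdiff g) w.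
Proof.
move=> g0; rewrite /fdiff /shifted.
have [aw|wa] := leP a w%:Z.
  have -> : a <= w.+1%:Z by lia.
  by have -> : `|w.+1%:Z - a|%N = (`|w%:Z - a|%N).+1 by lia.
case: ifPn => [aw|_]; last by rewrite subrr.
have -> : `|w.+1%:Z - a|%N = 0%N by lia.
by rewrite g0 subrr.
Qed.

Lemma shifted_le (g : nat -> R) L w : (forall k, `|g k| <= L) -> `|shifted g w| <= L.
Proof.
move=> gL; rewrite /shifted; case: ifP => // _; rewrite normr0.
exact: le_trans (gL 0%N).
Qed.

Lemma shifted_sum_le (g : nat -> R) L N : (forall N, \sum_(k < N) `|g k| <= L) ->
  \sum_(w < N) `|shifted g w| <= L.
Proof.
move=> gL; rewrite /shifted; case: a => m.
  apply: le_trans (gL (N - m)%N).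
  rewrite -(big_mkord xpredT (fun w => `|if m%:Z <= w%:Z then g `|w%:Z - m%:Z|%N else 0|)).
  have [Nm|mN] := leqP N m.
    rewrite big_nat_cond big1 ?sumr_ge0 // => w /andP[/andP[_ wN] _].
    by rewrite (_ : (m%:Z <= w%:Z) = false) ?normr0 //; lia.
  rewrite (@big_cat_nat _ _ _ m) ?(ltnW mN) //= big_nat_cond big1 ?add0r; last first.
    move=> w /andP[/andP[_ wm] _].
    by rewrite (_ : (m%:Z <= w%:Z) = false) ?normr0 //; lia.
  rewrite -[in X in X <= _](add0n m) big_addn big_mkord le_eqVlt; apply/orP; left; apply/eqP.
  apply: eq_bigr => w _; rewrite (_ : (m%:Z <= (w + m)%N%:Z) = true); last lia.
  by congr (`|g _|); lia.
apply: le_trans (gL (N + m.+1)%N).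
rewrite -(big_mkord xpredT (fun k => `|g k|)) addnC (@big_cat_nat _ _ _ m.+1) //=; last first.
  exact: leq_addr.
rewrite [X in _ <= _ + X](big_addn 0 (m.+1 + N) m.+1) addKn.
rewrite [X in _ <= _ + X]big_mkord.
apply: (@le_trans _ _ (\sum_(i < N) `|g (i + m.+1)%N|)); first by apply: ler_sum.
by rewrite lerDr sumr_ge0.
Qed.

Lemma shifted_stein lam N h w : 0 < lam ->
  lam * shifted (stein_sol lam N h) w.+1 -
    (w%:R - a%:~R) * shifted (stein_sol lam N h) w =
  if a <= w%:Z then
    (if (`|w%:Z - a|%N < N)%N then h `|w%:Z - a|%N else 0) -
      \sum_(j < N) h j * poisson_pmf lam j
  else 0.
Proof.
move=> lam_gt0; have g0 : stein_sol lam N h 0%N = 0.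
  by rewrite /stein_sol big1 // => j _; rewrite stein_pt0 mulr0.
rewrite /shifted; have [aw|wa] := leP a w%:Z.
  have -> : a <= w.+1%:Z by lia.
  have -> : `|w.+1%:Z - a|%N = (`|w%:Z - a|%N).+1 by lia.
  rewrite -(stein_solP lam_gt0); congr (_ - _ * _).
  have -> : w%:R - a%:~R = (w%:Z - a)%:~R :> R by rewrite intrB.
  by rewrite -[in LHS](@gez0_abs (w%:Z - a)) //; lia.
case: ifPn => [aw|_]; last by rewrite !mulr0 subrr.
have -> : `|w.+1%:Z - a|%N = 0%N by lia.
by rewrite g0 !mulr0 subrr.
Qed.

End shifted_solution.

Section comparison.
Context d (T : measurableType d) {R : realType} (P : probability T R).
Variables (n : nat) (X : 'I_n -> {RV P >-> nat}) (V : T -> nat).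
Hypothesis dV : ball_fun X V.
Hypothesis V_le : forall w, (V w <= n)%N.
Local Notation Er := (Er P).
Let mu := Er (fun w => (V w)%:R).
Let v := Er (fun w => (V w)%:R * (V w)%:R) - mu ^+ 2.
Hypothesis v_gt0 : 0 < v.
Let a := TP_shift mu v.
Let lam := TP_rate mu v.
Let bV f := @count_bfun _ T R P n X V n f dV V_le.

Let lamP : a%:~R + lam = mu /\ v <= lam < v + 1.
Proof. by apply/(TP_specP mu v a lam). Qed.

Let lam_gt0 : 0 < lam.
Proof. by have [_ /andP[h _]] := lamP; apply: lt_le_trans h. Qed.

Let inv_lam : lam^-1 <= v^-1.
Proof. by have [_ /andP[h _]] := lamP; rewrite lef_pV2 ?posrE. Qed.

Let low := Er (fun w => ((V w)%:Z < a)%R%:R).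

Let cb (b : nat -> bool) : ball_bfun X (fun w => (b (V w))%:R : R).
Proof. exact: (bV (fun k => (b k)%:R)). Qed.

(** Chebyshev's inequality: below a the count is at distance at least
    mu - a = lam >= v from its mean. *)
Lemma low_le : low <= v^-1.
Proof.
have v0 := v_gt0.
have e : Er (fun w => v ^- 2 * ((V w)%:R - mu) ^+ 2) = v^-1.
  have -> : (fun w => v ^- 2 * ((V w)%:R - mu) ^+ 2) = fun w =>
      v ^- 2 * ((V w)%:R * (V w)%:R + - (2 * mu) * (V w)%:R + mu ^+ 2).
    by apply/funext => w; ring.
  rewrite (@ErZ _ _ _ P n X _ _ (bV (fun k => k%:R * k%:R + - (2 * mu) * k%:R + mu ^+ 2))).
  rewrite (@ErD _ _ _ P n X _ _ (bV (fun k => k%:R * k%:R + - (2 * mu) * k%:R)) (ball_bfun_cst X _)).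
  rewrite (@ErD _ _ _ P n X _ _ (bV (fun k => k%:R * k%:R)) (bV (fun k => - (2 * mu) * k%:R))).
  rewrite (@ErZ _ _ _ P n X _ _ (bV (fun k => k%:R))) Er_cst -/mu.
  have -> : Er (fun w => (V w)%:R * (V w)%:R) = v + mu ^+ 2 by rewrite /v subrK.
  by field; rewrite gt_eqF.
rewrite -e; apply: (@ler_Er _ _ _ P n X).
- exact: (cb (fun k => (k%:Z < a)%R)).
- exact: (bV (fun k => v ^- 2 * (k%:R - mu) ^+ 2)).
move=> w; have [wa|_] := ltP (V w)%:Z a; last first.
  by rewrite mulr_ge0 ?sqr_ge0 // invr_ge0 exprn_ge0 // ltW.
rewrite mulrC ler_pdivlMr ?exprn_gt0 // mul1r.
have [amu /andP[vl _]] := lamP.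
have : (V w)%:R <= a%:~R :> R.
  by rewrite -[(V w)%:R]/((V w)%:Z%:~R) ler_int ltW.
by rewrite !expr2; nra.
Qed.

(** On V >= a the integrand is lam * f (V + 1) - (V - a) * f V; with a + lam = mu
    it is the defect of f up to (lam - v) times the mean difference, where
    lam - v < 1. *)
Lemma stein_test N h (L : R) : (forall k, `|fdiff (stein_sol lam N h) k| <= L) -> L <= v^-1 ->
  `|Er (fun w => if a <= (V w)%:Z then
      (if (`|(V w)%:Z - a|%N < N)%N then h `|(V w)%:Z - a|%N else 0) -
      \sum_(j < N) h j * poisson_pmf lam j else 0)| <=
  v^-1 + `|stein_defect P V (shifted a (stein_sol lam N h))|.
Proof.
move=> gL Lv; set g := stein_sol lam N h; set f := shifted a g.
have g0 : g 0%N = 0.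
  by rewrite /g /stein_sol big1 // => j _; rewrite stein_pt0 mulr0.
have -> : (fun w => if a <= (V w)%:Z then
      (if (`|(V w)%:Z - a|%N < N)%N then h `|(V w)%:Z - a|%N else 0) -
      \sum_(j < N) h j * poisson_pmf lam j else 0) =
    fun w => (lam * fdiff f (V w) + mu * f (V w)) + -1 * ((V w)%:R * f (V w)).
  apply/funext => w; rewrite -(shifted_stein _ _ _ _ lam_gt0) -/g -/f /fdiff.
  by have [<- _] := lamP; ring.
rewrite (@ErD _ _ _ P n X _ _ (bV (fun k => lam * fdiff f k + mu * f k))
  (bV (fun k => -1 * (k%:R * f k)))).
rewrite (@ErD _ _ _ P n X _ _ (bV (fun k => lam * fdiff f k)) (bV (fun k => mu * f k))).
rewrite (@ErZ _ _ _ P n X _ _ (bV (fdiff f))) (@ErZ _ _ _ P n X _ _ (bV f)).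
rewrite (@ErZ _ _ _ P n X _ _ (bV (fun k => k%:R * f k))).
rewrite /stein_defect -/mu -/v.
set e1 := Er (fun w => fdiff f (V w)).
set D := _ - _ - v * e1.
have -> : lam * e1 + mu * Er (fun w => f (V w)) + -1 * Er (fun w => (V w)%:R * f (V w)) =
  (lam - v) * e1 - D by rewrite /D; ring.
apply: (le_trans (ler_normB _ _)); rewrite lerD2r normrM.
have [_ /andP[h1 h2]] := lamP.
have L0 : 0 <= L by apply: le_trans (gL 0%N).
have e1L : `|e1| <= L.
  apply: (le_trans (@ler_norm_Er _ _ _ P n X _ (bV (fdiff f)))).
  rewrite -[leRHS](Er_cst P); apply: (@ler_Er _ _ _ P n X).
  - exact: ball_bfun_norm (bV (fdiff f)).
  - exact: ball_bfun_cst.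
  - by move=> w; rewrite shifted_fdiff //; exact: shifted_le.
apply: le_trans Lv; rewrite -[leRHS]mul1r; apply: ler_pM => //.
by rewrite ger0_norm; lra.
Qed.

Let lw (A : set int) : R := fine (P [set w | A (V w)%:Z]).

Let lwE A : lw A = Er (fun w => (`[< A (V w)%:Z >])%:R).
Proof.
rewrite (@Er_indic_bool _ _ _ P n X); last by move=> w w' ww'; rewrite (dV ww').
by rewrite /lw; congr (fine (P _)); apply/seteqP; split=> w /= /asboolP.
Qed.

Let tp (A : set int) : R := fine (TP mu v A).

Let TP_def A : TP mu v A = (\esum_(k in [set k | A (a + k%:Z)%R]) (poisson_pmf lam k)%:E)%E.
Proof.
by rewrite /TP /distribution /pushforward /= /poisson_prob lam_gt0.
Qed.

Lemma tp_sum (A : set int) N : \sum_(k < N | `[< A (a + k%:Z) >]) poisson_pmf lam k <= tp A.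
Proof.
rewrite -lee_fin /tp fineK; last exact: fin_num_measure.
have e : [set k : nat | A (a + k%:Z)] = [set k : nat | `[< A (a + k%:Z) >]].
  by apply/seteqP; split=> k /= /asboolP.
rewrite TP_def e -(nneseries_esum (P := fun k => `[< A (a + k%:Z) >])); last first.
  by move=> k _; rewrite lee_fin poisson_pmf_ge0.
rewrite -sumEFin -(big_mkord (fun k => `[< A (a + k%:Z) >]) (fun k => (poisson_pmf lam k)%:E)).
by apply: nneseries_lim_ge => k _ _; rewrite lee_fin poisson_pmf_ge0.
Qed.

Lemma tp_pt k : tp [set (a + k%:Z)] = poisson_pmf lam k.
Proof.
rewrite /tp TP_def (_ : [set _ | _] = [set k]); last first.
  by apply/seteqP; split=> i /=; [move/addrI => [->]|move=> ->].
by rewrite esum_set1 // lee_fin poisson_pmf_ge0.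
Qed.

Lemma tp_low j : j < a -> tp [set j] = 0.
Proof.
move=> ja; rewrite /tp TP_def (_ : [set _ | _] = set0) ?esum_set0 //.
by apply/seteqP; split=> i //=; lia.
Qed.

Let b_if (b : nat -> bool) (f : nat -> R) :
  ball_bfun X (fun w => if b (V w) then f (V w) else 0).
Proof. exact: (bV (fun k => if b k then f k else 0)). Qed.

(** For V >= a the Stein equation gives the indicator of A minus its Poisson
    probability, cut off at N, beyond the range of V; the cut-off only lowers the
    Poisson probability. Hence a one-sided bound. *)
Lemma law_sub_tp_le (A : set int) D :
  (forall N h, (forall j, 0 <= h j <= 1) ->
     `|stein_defect P V (shifted a (stein_sol lam N h))| <= D) ->
  lw A - tp A <= 2 / v + D.
Proof.
move=> HD; pose h k : R := (`[< A (a + k%:Z) >])%:R.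
(* Any N with V - a < N on the event V >= a would do. *)
pose N := (`|n%:Z - a|).+1%N.
pose H := \sum_(j < N) h j * poisson_pmf lam j.
have h01 j : 0 <= h j <= 1 by rewrite /h; case: (`[< _ >]); rewrite ?lexx ?ler01.
have H0 : 0 <= H.
  by apply: sumr_ge0 => j _; rewrite mulr_ge0 ?poisson_pmf_ge0 //; case/andP: (h01 j).
have Htp : H <= tp A.
  apply: le_trans (tp_sum A N); rewrite big_mkcond /= /H; apply: ler_sum => j _.
  by rewrite /h; case: (`[< _ >]); rewrite ?mul1r ?mul0r.
have := @stein_test N h lam^-1 (fun k => stein_sol_diff lam_gt0 N k h01) inv_lam.
set Z := Er _ => HZ.
have : lw A <= low + (Z + H).
  rewrite lwE -[H](Er_cst P) /Z /low.
  have bZ := b_if (fun k => a <= k%:Z) (fun k =>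
    (if (`|k%:Z - a|%N < N)%N then h `|k%:Z - a|%N else 0) - H).
  have bl := cb (fun k => (k%:Z < a)%R).
  rewrite -(@ErD _ _ _ P n X _ _ bZ (ball_bfun_cst X H)).
  rewrite -(@ErD _ _ _ P n X _ _ bl (ball_bfunD bZ (ball_bfun_cst X H))).
  apply: (@ler_Er _ _ _ P n X).
  - exact: (cb (fun k => `[< A k%:Z >])).
  - exact: ball_bfunD bl (ball_bfunD bZ (ball_bfun_cst X H)).
  move=> w; have Vn := V_le w; have [aw|wa] := leP a (V w)%:Z.
    have -> : (`|(V w)%:Z - a|%N < N)%N by rewrite /N; lia.
    rewrite /= add0r subrK /h gez0_abs; last by lia.
    by rewrite (_ : a + ((V w)%:Z - a) = (V w)%:Z) //; ring.
  rewrite add0r /=; apply: (@le_trans _ _ 1); first by case: (`[< _ >]); rewrite ?ler01.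
  by rewrite lerDl.
move=> h1; have h2 := low_le.
have h3 : Z <= v^-1 + D.
  apply: (le_trans (ler_norm _)); apply: (le_trans HZ).
  by rewrite lerD2l HD.
lra.
Qed.

(** For a single point the Poisson equation is solved without cut-off. *)
Lemma law_tp_pt_le j D :
  (forall k, `|stein_defect P V (shifted a (stein_pt lam k))| <= D) -> 0 <= D ->
  `|lw [set j] - tp [set j]| <= 2 / v + D.
Proof.
move=> HD D0; have h2 := low_le; have v0 : 0 < v^-1 by rewrite invr_gt0.
have bl := cb (fun k => (k%:Z < a)%R).
have bj : ball_bfun X (fun w => (`[< [set j] (V w)%:Z >])%:R : R).
  exact: (cb (fun k => `[< [set j] k%:Z >])).
have lw0 : 0 <= lw [set j] by rewrite /lw fine_ge0.
have [aj|ja] := leP a j; last first.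
  rewrite tp_low // subr0 ger0_norm //; apply: (@le_trans _ _ low); last lra.
  rewrite lwE; apply: (@ler_Er _ _ _ P n X) => // w.
  by case: asboolP => // /= ->; rewrite ja.
pose k := `|j - a|%N; have jE : j = a + k%:Z.
  by rewrite /k gez0_abs ?subr_ge0 //; ring.
pose h i : R := (i == k)%:R.
have h01 i : 0 <= h i <= 1 by rewrite /h; case: eqP; rewrite ?lexx ?ler01.
have solE : stein_sol lam k.+1 h = stein_pt lam k.
  apply/funext => x; rewrite /stein_sol (bigD1 ord_max) //= /h eqxx mul1r big1 ?addr0 //.
  by move=> i ik; rewrite (_ : (i == k :> nat) = false) ?mul0r //; apply: negbTE.
have HE : \sum_(i < k.+1) h i * poisson_pmf lam i = poisson_pmf lam k.
  rewrite (bigD1 ord_max) //= /h eqxx mul1r big1 ?addr0 //.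
  by move=> i ik; rewrite (_ : (i == k :> nat) = false) ?mul0r //; apply: negbTE.
have := @stein_test k.+1 h lam^-1 (fun i => stein_sol_diff lam_gt0 k.+1 i h01) inv_lam.
rewrite HE solE; set Z := Er _ => HZ.
have ZE : Z = lw [set j] - poisson_pmf lam k * (1 - low).
  have -> : Z = Er (fun w => (`[< [set j] (V w)%:Z >])%:R +
      (poisson_pmf lam k * ((V w)%:Z < a)%R%:R + - poisson_pmf lam k)).
    congr Er; apply/funext => w; have [aw|wa] := leP a (V w)%:Z; last first.
      case: asboolP => [/= e|_]; first by move: aj; rewrite -e leNgt wa.
      by rewrite mulr1 addrN addr0.
    rewrite mulr0 add0r; congr (_ + _); rewrite /h.
    case: asboolP => [/= e|/= e].
      by rewrite e -/k ltnSn eqxx.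
    case: ifP => // _; case: eqP => // ek; case: e.
    by rewrite /= jE -ek gez0_abs ?subr_ge0 //; ring.
  rewrite (@ErD _ _ _ P n X _ _ bj); last first.
    exact: (bV (fun i => poisson_pmf lam k * (i%:Z < a)%R%:R + - poisson_pmf lam k)).
  have bpl : ball_bfun X (fun w => poisson_pmf lam k * ((V w)%:Z < a)%R%:R).
    exact: (bV (fun i => poisson_pmf lam k * (i%:Z < a)%R%:R)).
  rewrite (@ErD _ _ _ P n X _ _ bpl (ball_bfun_cst X _)) (@ErZ _ _ _ P n X _ _ bl) Er_cst.
  by rewrite -lwE -/low; ring.
have pi0 := poisson_pmf_ge0 lam k.
have pi1 : poisson_pmf lam k <= 1.
  rewrite -(tp_pt k) /tp -lee_fin fineK; last exact: fin_num_measure.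
  exact: probability_le1.
have low0 : 0 <= low.
  by rewrite -(Er_cst P 0); apply: (@ler_Er _ _ _ P n X) => //; exact: ball_bfun_cst.
rewrite jE tp_pt -jE.
have -> : lw [set j] - poisson_pmf lam k = Z - poisson_pmf lam k * low.
  by rewrite ZE; ring.
apply: (le_trans (ler_normB _ _)).
have h4 : `|poisson_pmf lam k * low| <= v^-1.
  rewrite ger0_norm ?mulr_ge0 //; apply: le_trans h2.
  by rewrite -[leRHS]mul1r ler_wpM2r.
have h3 := HD k; lra.
Qed.

(** The lower bound is the upper bound for the complement of A. *)
Lemma law_tp_le (A : set int) D :
  (forall N h, (forall j, 0 <= h j <= 1) ->
     `|stein_defect P V (shifted a (stein_sol lam N h))| <= D) ->
  `|lw A - tp A| <= 2 / v + D.
Proof.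
move=> HD; have h1 := law_sub_tp_le A HD; have h2 := law_sub_tp_le (~` A) HD.
have e1 : lw (~` A) = 1 - lw A.
  rewrite !lwE -[X in X - _](Er_cst P) -(@ErB _ _ _ P n X).
  - by congr Er; apply/funext => w; rewrite asbool_neg; case: (`[< _ >]); rewrite /= ?subr0 ?subrr.
  - exact: ball_bfun_cst.
  - exact: (cb (fun k => `[< A k%:Z >])).
have e2 : tp (~` A) = 1 - tp A.
  rewrite /tp probability_setC // fineB //; exact: fin_num_measure.
by rewrite ler_norml; apply/andP; split; lra.
Qed.

End comparison.

(** * Bounds on the Stein defect *)

Lemma mean_var_compare (R : realType) (mu v v' : R) : `|v - v'| <= 6 ->
  mu / 4 <= v' -> v' <= 2 * mu -> 32 <= v -> 6 <= mu /\ mu <= 5 * v.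
Proof. by rewrite ler_norml => /andP[h1 h2] h3 h4 h5; split; lra. Qed.

Lemma sqrt_mean_le (R : realType) (b mu v : R) : 0 < b -> b <= 1 -> 0 < mu ->
  mu <= 5 * v -> Num.sqrt (b * mu / 2) <= 2 * Num.sqrt v.
Proof.
move=> b0 b1 mu0 muv; have v0 : 0 <= v by lra.
rewrite -[2 in leRHS](@ger0_norm R 2) // -sqrtr_sqr -sqrtrM ?sqr_ge0 // ler_sqrt.
  by rewrite expr2; nra.
by rewrite mulr_ge0 ?sqr_ge0.
Qed.

Section small_box_bounds.
Context {R : realType} (p : nat -> R) (r : nat).
Hypothesis p_gt0 : forall j, (1 <= j)%N -> 0 < p j.
Hypothesis p_noninc : forall j, (1 <= j)%N -> p j.+1 <= p j.
Hypothesis p_sum1 : (\sum_(1 <= j <oo) (p j)%:E = 1)%E.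

(** The constant makes the total mass of the small boxes at most 1/8 and small
    enough for the variance to be comparable to the mean. *)
Definition eta_cst : R := (8 + 16 * hit_ratio R r * moment_cst R r)^-1.

Let hr_gt0 : 0 < hit_ratio R r. Proof. exact: exprn_gt0. Qed.
Let mc_gt0 : 0 < moment_cst R r.
Proof. by rewrite mulr_gt0 ?expR_gt0 // exprn_gt0 // mulr_gt0. Qed.
Let hm_gt0 : 0 < 16 * hit_ratio R r * moment_cst R r.
Proof. by rewrite mulr_gt0 // mulr_gt0. Qed.

Let eta_gt0 : 0 < eta_cst.
Proof. by rewrite invr_gt0 addr_gt0. Qed.

Let p_mono i j : (1 <= i)%N -> (i <= j)%N -> p j <= p i.
Proof.
move=> i1; elim: j => [|j IH]; first by move=> i0; lia.
rewrite leq_eqVlt => /predU1P[<-//|]; rewrite ltnS => ij.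
by apply: le_trans (IH ij); apply: p_noninc; lia.
Qed.

(** A tail of the convergent series of the p j: boxes of mass below p (k1 + 1) have
    index beyond k1, as the masses decrease. *)
Lemma small_boxes_sum : exists2 c : R, 0 < c & forall (tau : R) M, tau < c ->
  \sum_(i in small_boxes p tau M) p i <= eta_cst.
Proof.
have [k1 hk] := partial_sum_ge p_gt0 p_sum1 eta_gt0.
exists (p k1.+1); first exact: p_gt0.
move=> tau M tauc.
have h : \sum_(i in small_boxes p tau M) p i + \sum_(1 <= j < k1) p j <= 1.
  apply: le_trans (partial_sum_le1 p_gt0 p_sum1 (maxn M k1)).
  rewrite !big_geq_mkord.
  have -> : \sum_(i in small_boxes p tau M) p i =
      \sum_(i < M | (1 <= i)%N && (p i <= tau)) p i.
    by apply: eq_bigl => i; rewrite inE.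
  rewrite (big_ord_widen_cond (maxn M k1) (fun i => (1 <= i)%N && (p i <= tau)) p) ?leq_maxl //.
  rewrite (big_ord_widen_cond (maxn M k1) (fun i => (1 <= i)%N) p) ?leq_maxr //.
  rewrite [X in X + _]big_mkcond [X in _ + X]big_mkcond [leRHS]big_mkcond -big_split /=.
  apply: ler_sum => i _; case: (leqP 1 i) => [i1|]; last by rewrite /= addr0.
  have pi0 := p_gt0 i1.
  have [ik|ki] := ltnP i k1; last by rewrite andbF addr0; case: ifP => // _; exact: ltW.
  rewrite andbT /= (_ : (p i <= tau) = false) ?andbF ?add0r //.
  apply/negbTE; rewrite -ltNge; apply: (lt_le_trans tauc); apply: p_mono => //; lia.
lra.
Qed.

(** n^(r + 3) = 4^(r + 3) * x^(2 r + 6) for x = sqrt n / 2, and powers of x are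
    dominated by exp x. *)
Definition exp_cst : R := 4 ^+ (r + 3) * (2 * (r + 3))%:R ^+ (2 * (r + 3)).

Lemma pow_expR_sqrt n : n%:R ^+ (r + 3) <= exp_cst * expR (Num.sqrt n%:R / 2) :> R.
Proof.
set x := Num.sqrt n%:R / 2.
have x0 : 0 <= x by rewrite divr_ge0 // sqrtr_ge0.
have -> : n%:R = 4 * x ^+ 2 :> R.
  by rewrite -[LHS](@sqr_sqrtr R n%:R) // /x; field.
rewrite exprMn -exprM /exp_cst -mulrA ler_wpM2l ?exprn_ge0 //.
exact: expR_ge_pow.
Qed.

End small_box_bounds.

Section large_variance.
Context {R : realType} (p : nat -> R) (r : nat).
Hypothesis r_gt0 : (0 < r)%N.
Hypothesis p_gt0 : forall j, (1 <= j)%N -> 0 < p j.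
Hypothesis p_noninc : forall j, (1 <= j)%N -> p j.+1 <= p j.
Hypothesis p_sum1 : (\sum_(1 <= j <oo) (p j)%:E = 1)%E.

(** The first term comes from the truncated count, the second from the
    truncation. *)
Definition defect_cst : R :=
  4 * stein_cst R r * smooth_cst R r / hit_ratio_inv R r + 16.

Let sc_ge0 : 0 <= stein_cst R r.
Proof.
have h : 0 <= hit_ratio R r by exact: exprn_ge0.
have m : 0 <= moment_cst R r by rewrite mulr_ge0 ?expR_ge0 // exprn_ge0 // mulr_ge0.
by rewrite !addr_ge0 ?mulr_ge0 ?exprn_ge0.
Qed.
Let sm_ge0 : 0 <= smooth_cst R r.
Proof. by rewrite mulr_ge0 // addr_ge0 // exprn_ge0. Qed.
Let hi_gt0 : 0 < hit_ratio_inv R r.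
Proof. by rewrite mulr_gt0 ?expR_gt0 // invr_gt0 exprn_gt0. Qed.
Let hi_le1 : hit_ratio_inv R r <= 1.
Proof.
rewrite -[leRHS]mulr1 /hit_ratio_inv; apply: ler_pM.
- by rewrite invr_ge0 exprn_ge0.
- exact: expR_ge0.
- by rewrite invf_le1 ?exprn_gt0 // exprn_ege1 // ler1n.
- by rewrite -[leRHS]expR0 ler_expR; lra.
Qed.

Lemma defect_cst_ge0 : 0 <= defect_cst.
Proof. by rewrite addr_ge0 // !mulr_ge0 // invr_ge0 ltW. Qed.

(** With tau = 1 / sqrt n, n * tau^2 = 1 while tau * n = sqrt n, so boxes above
    tau contribute at most n^r * exp (- sqrt n / 2). The index M is then taken so
    large, depending on n, that the balls beyond it are negligible. The variance
    of the truncated count differs from v by at most 6, whence the requirement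
    that v be at least 32. *)
Lemma defect_bounds : exists N0 : nat, forall n, (N0 <= n)%N -> (2 * r <= n)%N ->
  forall (d : measure_display) (T : measurableType d) (P : probability T R)
    (X : 'I_n -> {RV P >-> nat}), is_occupancy_scheme p X ->
  let V := boxes_with X r in
  let v := Er P (fun w => (V w)%:R * (V w)%:R) - Er P (fun w => (V w)%:R) ^+ 2 in
  32 <= v ->
  (forall f (L : R), (forall k, `|fdiff f k| <= L) ->
     `|stein_defect P V f| <= defect_cst * L * Num.sqrt v) /\
  (forall f (L : R), (forall N, \sum_(k < N) `|fdiff f k| <= L) ->
     `|stein_defect P V f| <= defect_cst * L).
Proof.
have [c c0 small] := small_boxes_sum r p_gt0 p_noninc p_sum1.
pose N0 := (4096 + 16 * r + (Num.trunc (c ^- 2)).+1 + (Num.trunc (2 * (exp_cst r : R))).+1)%N.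
(* The terms of N0 ensure, in this order, tau <= 1 / 64, that n is large compared
   to r, tau < c, and that boxes above tau are negligible. *)
exists N0 => n nN0 r2n d T P X scheme V v v32.
have [n4 n16 nc ne] : [/\ (4096 <= n)%N, (16 * r <= n)%N,
    ((Num.trunc (c ^- 2)).+1 <= n)%N & ((Num.trunc (2 * (exp_cst r : R))).+1 <= n)%N].
  move: nN0; rewrite /N0; move: (Num.trunc _).+1 (Num.trunc _).+1 => t1 t2; clear.
  by move=> h; split; lia.
have n0 : (0 < n)%N by exact: leq_trans n4.
have nR : 0 < n%:R :> R by rewrite ltr0n.
have sn : 0 < Num.sqrt n%:R :> R by rewrite sqrtr_gt0.
pose tau : R := (Num.sqrt n%:R)^-1.
have tau0 : 0 < tau by rewrite invr_gt0.
have tau64 : tau <= 1 / 64.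
  rewrite div1r lef_pV2 ?posrE // -[X in X <= _](@ger0_norm R 64) // -sqrtr_sqr.
  by rewrite ler_sqrt // -natrX ler_nat.
have ntau : n%:R * tau ^+ 2 <= 1.
  by rewrite /tau exprVn sqr_sqrtr // divff // gt_eqF.
have tauc : tau < c.
  rewrite -[c]invrK ltf_pV2 ?posrE ?invr_gt0 //.
  rewrite -(@ltr_pXn2r _ 2) ?nnegrE ?invr_ge0 ?(ltW c0) ?sqrtr_ge0 // sqr_sqrtr //.
  rewrite exprVn; apply: (lt_le_trans (truncnS_gt _)).
  by rewrite ler_nat.
have e1 : n%:R ^+ (r + 2) * expR (- (tau * n%:R / 2)) <= 1 / 2.
  have -> : tau * n%:R = Num.sqrt n%:R.
    by rewrite /tau -{2}(sqr_sqrtr (ltW nR)); field; rewrite gt_eqF.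
  rewrite expRN ler_pdivrMr ?expR_gt0 //.
  rewrite -(ler_pM2l nR) -exprS -addnS.
  apply: (le_trans (pow_expR_sqrt r n)); rewrite mulrA ler_wpM2r ?expR_ge0 //.
  have : 2 * (exp_cst r : R) <= n%:R.
    apply/ltW/(lt_le_trans (truncnS_gt _)).
    by rewrite ler_nat.
  by lra.
have [M hM] : exists M, 1 - (2 * n%:R ^+ 3)^-1 < \sum_(1 <= j < M) p j.
  by apply: partial_sum_ge => //; rewrite invr_gt0 mulr_gt0 // exprn_gt0.
pose J := small_boxes p tau M.
pose V' := count_in X J val r.
have dV : ball_fun X V := @boxes_with_fun _ _ _ _ _ _ _.
have dV' : ball_fun X V' by exact: (count_in_fun _ _ _ id).
have Vn w : (V w <= n)%N by exact: boxes_with_le.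
have V'n w : (V' w <= n)%N by exact: count_in_le.
pose eps := Er P (fun w => (V w != V' w)%:R).
have eps0 : 0 <= eps.
  rewrite -(Er_cst P 0); apply: (@ler_Er _ _ _ P n X) => //; first exact: ball_bfun_cst.
  by apply: ball_bfun_bool => w w' ww'; rewrite (dV _ _ ww') (dV' _ _ ww').
have eps_le : n%:R ^+ 2 * eps <= 1.
  have := truncation_error r_gt0 r2n p_gt0 p_sum1 scheme (ltW tau0) M.
  rewrite -/J -/V -/V' -/eps => he.
  apply: (@le_trans _ _ (n%:R ^+ 2 * (n%:R * (1 - \sum_(1 <= j < M) p j) +
     n%:R ^+ r * expR (- (tau * n%:R / 2))))).
    by rewrite ler_wpM2l // exprn_ge0.
  set A := 1 - _; set B := expR _ in e1 *.
  have -> : n%:R ^+ 2 * (n%:R * A + n%:R ^+ r * B) = n%:R ^+ 3 * A + n%:R ^+ (r + 2) * B.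
    by rewrite (exprD _ r); ring.
  have h : n%:R ^+ 3 * A <= 1 / 2.
    have n3 : 0 < n%:R ^+ 3 :> R by rewrite exprn_gt0.
    have : A <= (2 * n%:R ^+ 3)^-1 by rewrite /A lerBlDr -lerBlDl ltW.
    rewrite -(ler_pM2l n3) => /le_trans; apply.
    by rewrite invfM mulrCA divff ?gt_eqF // mulr1 div1r.
  by apply: (le_trans (lerD h e1)); lra.
(* No boxes are numbered 0, so p 0 is arbitrary and may be negative. *)
pose q (i : 'I_M) : R := if (1 <= i)%N then p i else 0.
have q_ge0 i : 0 <= q i by rewrite /q; case: ifP => // i1; rewrite ltW // p_gt0.
have J1 i : i \in J -> (1 <= i)%N by rewrite inE => /andP[].
have qJ i : i \in J -> q i = p i by move=> /J1; rewrite /q => ->.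
have q_le i : i \in J -> q i <= tau by move=> iJ; rewrite qJ //; move: iJ; rewrite inE => /andP[].
have qsum : \sum_(i in J) q i <= eta_cst r.
  by rewrite (eq_bigr (fun i : 'I_M => p i)) ?small // => i /qJ.
have hr_gt0 : 0 < hit_ratio R r by exact: exprn_gt0.
have mc_gt0 : 0 < moment_cst R r by rewrite mulr_gt0 ?expR_gt0 // exprn_gt0 // mulr_gt0.
have hm_gt0 : 0 < 16 * hit_ratio R r * moment_cst R r by rewrite mulr_gt0 // mulr_gt0.
have qsum8 : \sum_(i in J) q i <= 1 / 8.
  apply: (le_trans qsum); rewrite /eta_cst div1r lef_pV2 ?posrE ?addr_gt0 //.
  by rewrite lerDl ltW.
have qsumB : 16 * hit_ratio R r * moment_cst R r * (\sum_(i in J) q i) <= 1.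
  apply: (le_trans (ler_wpM2l (ltW hm_gt0) qsum)).
  by rewrite /eta_cst ler_pdivrMr ?addr_gt0 // mul1r lerDr.
have pE i k : i \in J -> P (X k @^-1` [set val i]) = (q i)%:E.
  by move=> iJ; rewrite (qJ _ iJ); have [_] := scheme; apply; exact: J1.
have E' f : Er P (fun w => f (V' w)) = eocc r q J n 1 f.
  exact: (Er_count_in r (proj1 scheme) (@ord_inj M) pE).
pose mu' := \sum_(i in J) hit r q n 1 i.
pose v' := eocc r q J n 1 (fun w => w%:R * w%:R) - mu' ^+ 2.
have mean' : eocc r q J n 1 (fun w => w%:R) = mu'.
  exact: (eocc_mean r n tau64 q_le).
have /andP[v'1 v'2] : mu' / 4 <= v' <= 2 * mu'.
  exact: (eocc_var r_gt0 q_ge0 n16 tau64 ntau q_le qsumB).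
have vv' : `|v - v'| <= 6.
  have := variance_close dV dV' Vn V'n.
  rewrite -/eps (E' (fun k => k%:R * k%:R)) (E' (fun k => k%:R)) mean'.
  rewrite -/v -/v' => /le_trans; apply.
  by rewrite -mulrA -[leRHS]mulr1 ler_wpM2l.
have [mu6 mu5] := mean_var_compare vv' v'1 v'2 v32.
have mu_gt0 : 0 < mu' by exact: lt_le_trans mu6.
have defE f : stein_defect P V' f = eocc r q J n 1 (fun w => w%:R * f w) -
    mu' * eocc r q J n 1 f - v' * eocc r q J n 1 (fdiff f).
  rewrite /stein_defect (E' (fun k => k%:R * f k)) (E' (fun k => k%:R)) mean'.
  by rewrite (E' (fun k => k%:R * k%:R)) (E' f) (E' (fdiff f)).
have close f L : (forall k, `|fdiff f k| <= L) ->
    `|stein_defect P V f| <= `|stein_defect P V' f| + 16 * L.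
  move=> fL; have L0 : 0 <= L by apply: le_trans (fL 0%N).
  have := stein_defect_close dV dV' Vn V'n fL; rewrite -/eps => h.
  have -> : stein_defect P V f = stein_defect P V' f +
    (stein_defect P V f - stein_defect P V' f) by ring.
  apply: (le_trans (ler_normD _ _)); rewrite lerD2l; apply: (le_trans h).
  have -> : 16 * n%:R ^+ 2 * L * eps = (16 * L) * (n%:R ^+ 2 * eps) by ring.
  by rewrite -[leRHS]mulr1 ler_wpM2l // mulr_ge0.
have b0 := hi_gt0; have b1 := hi_le1; have s0 := sc_ge0; have m0 := sm_ge0.
set b := hit_ratio_inv R r in b0 b1 *.
have bm : 0 < b * mu' / 2 by rewrite divr_gt0 // mulr_gt0.
split=> f L fL.
- have L0 : 0 <= L by apply: le_trans (fL 0%N).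
  apply: (le_trans (close f L fL)); rewrite defE.
  have := stein_approx_inf r_gt0 q_ge0 n16 (ltW tau0) tau64 ntau q_le qsum8 mu6 fL.
  rewrite -/mu' -/v' -/b => h.
  have sv : 1 <= Num.sqrt v by rewrite -{1}sqrtr1 ler_sqrt (le_trans _ v32) // ler1n.
  set s := Num.sqrt (b * mu' / 2) in h.
  have s_gt0 : 0 < s by rewrite sqrtr_gt0.
  have sv2 : s <= 2 * Num.sqrt v by exact: sqrt_mean_le.
  have mus : mu' = 2 / b * s * s.
    by rewrite -mulrA -expr2 sqr_sqrtr ?(ltW bm) //; field; rewrite gt_eqF.
  have h2 : stein_cst R r * (smooth_cst R r * L / s) * mu' <=
      4 * stein_cst R r * smooth_cst R r / b * L * Num.sqrt v.
    have -> : stein_cst R r * (smooth_cst R r * L / s) * mu' =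
       (2 * stein_cst R r * smooth_cst R r / b * L) * s.
      by rewrite mus; field; rewrite !gt_eqF.
    have -> : 4 * stein_cst R r * smooth_cst R r / b * L * Num.sqrt v =
       (2 * stein_cst R r * smooth_cst R r / b * L) * (2 * Num.sqrt v) by ring.
    by rewrite ler_wpM2l // !mulr_ge0 // invr_ge0 ltW.
  have -> : defect_cst * L * Num.sqrt v =
      4 * stein_cst R r * smooth_cst R r / b * L * Num.sqrt v + 16 * L * Num.sqrt v.
    by rewrite /defect_cst -/b; ring.
  apply: lerD; first exact: le_trans h h2.
  by rewrite -[leLHS]mulr1 ler_wpM2l // mulr_ge0.
- have fL1 k : `|fdiff f k| <= L.
    apply: le_trans (fL k.+1); rewrite big_ord_recr /= lerDr; exact: sumr_ge0.
  have L0 : 0 <= L by apply: le_trans (fL1 0%N).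
  apply: (le_trans (close f L fL1)); rewrite defE.
  have := stein_approx_one r_gt0 q_ge0 n16 (ltW tau0) tau64 ntau q_le qsum8 mu6 fL.
  rewrite -/mu' -/v' -/b => h.
  have h2 : stein_cst R r * (smooth_cst R r * L / (b * mu' / 2)) * mu' <=
      4 * stein_cst R r * smooth_cst R r / b * L.
    have -> : stein_cst R r * (smooth_cst R r * L / (b * mu' / 2)) * mu' =
       2 * (stein_cst R r * smooth_cst R r / b * L).
      by field; rewrite !gt_eqF.
    have -> : 4 * stein_cst R r * smooth_cst R r / b * L =
       4 * (stein_cst R r * smooth_cst R r / b * L) by ring.
    rewrite ler_wpM2r ?ler_nat //.
    by rewrite !mulr_ge0 // invr_ge0 ltW.
  have -> : defect_cst * L = 4 * stein_cst R r * smooth_cst R r / b * L + 16 * L.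
    by rewrite /defect_cst -/b; ring.
  apply: lerD; last exact: lexx.
  exact: le_trans h h2.
Qed.

End large_variance.

(** * The approximation theorem *)

Section variance_zero.
Context d (T : measurableType d) {R : realType} (P : probability T R).
Variables (n : nat) (X : 'I_n -> {RV P >-> nat}) (V : T -> nat).
Hypothesis dV : ball_fun X V.
Hypothesis V_le : forall w, (V w <= n)%N.
Local Notation Er := (Er P).
Let mu := Er (fun w => (V w)%:R).
Let bV f := @count_bfun _ T R P n X V n f dV V_le.

Lemma Er_sq_dist : Er (fun w => ((V w)%:R - mu) ^+ 2) =
  Er (fun w => (V w)%:R * (V w)%:R) - mu ^+ 2.
Proof.
have -> : (fun w => ((V w)%:R - mu) ^+ 2) = fun w =>
    ((V w)%:R * (V w)%:R + - (2 * mu) * (V w)%:R) + mu ^+ 2.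
  by apply/funext => w; ring.
rewrite (@ErD _ _ _ P n X _ _ (bV (fun k => k%:R * k%:R + - (2 * mu) * k%:R)) (ball_bfun_cst X _)).
rewrite (@ErD _ _ _ P n X _ _ (bV (fun k => k%:R * k%:R)) (bV (fun k => - (2 * mu) * k%:R))).
rewrite (@ErZ _ _ _ P n X _ _ (bV (fun k => k%:R))) Er_cst -/mu.
by ring.
Qed.

Let Er_ge0 f : (forall k, 0 <= f k) -> 0 <= Er (fun w => f (V w)).
Proof.
move=> f0; rewrite -(Er_cst P 0); apply: (@ler_Er _ _ _ P n X) => //.
exact: ball_bfun_cst.
Qed.

(** A law on finitely many integers charges one of them; were it not the mean, the
    variance would be positive. *)
Lemma variance0_cst : Er (fun w => (V w)%:R * (V w)%:R) - mu ^+ 2 = 0 ->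
  exists2 k0 : nat, mu = k0%:R & Er (fun w => (V w != k0)%:R) = 0.
Proof.
rewrite -Er_sq_dist => v0.
have bsq := bV (fun k => (k%:R - mu) ^+ 2).
have [k0 muk] : exists k0 : nat, mu = k0%:R.
  apply: contrapT => /forallNP nomu.
  have : Er (fun=> 1) = 0 :> R; last by rewrite Er_cst => /eqP; rewrite oner_eq0.
  have -> : (fun=> 1) = fun w => \sum_(k < n.+1) (V w == k)%:R :> R.
    apply/funext => w; have Vn : (V w < n.+1)%N by rewrite ltnS.
    rewrite (bigD1 (Ordinal Vn)) //= eqxx big1 ?addr0 // => k.
    by rewrite -val_eqE /= eq_sym => /negbTE ->.
  rewrite (@Er_sum _ _ _ P n X); last by move=> k _; exact: (bV (fun i => (i == k)%:R)).
  apply: big1 => k _.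
  have kmu : k%:R - mu != 0 by rewrite subr_eq0 eq_sym; apply/eqP.
  apply/eqP; rewrite eq_le (Er_ge0 (f := fun i => (i == k)%:R)) // andbT.
  have k2 : 0 < (k%:R - mu) ^+ 2 by rewrite lt_neqAle sqr_ge0 eq_sym sqrf_eq0 kmu.
  rewrite -(ler_pM2l k2) mulr0 -(@ErZ _ _ _ P n X _ _ (bV (fun i => (i == k)%:R))) -v0.
  apply: (@ler_Er _ _ _ P n X) => //.
    exact: (bV (fun i => (k%:R - mu) ^+ 2 * (i == k)%:R)).
  by move=> w; case: eqP => [->|_]; rewrite ?mulr1 // mulr0 sqr_ge0.
exists k0 => //; apply/eqP; rewrite eq_le (Er_ge0 (f := fun k => (k != k0)%:R)) // andbT -v0.
apply: (@ler_Er _ _ _ P n X) => //; first exact: (bV (fun k => (k != k0)%:R)).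
move=> w; rewrite muk; case: eqP => [_|/eqP Vk]; first by rewrite sqr_ge0.
rewrite -real_normK ?num_real // -[leLHS](expr1n _ 2) ler_sqr ?nnegrE //.
have -> : (V w)%:R - k0%:R = ((V w)%:Z - k0%:Z)%:~R :> R by rewrite intrB.
rewrite -intr_norm ler1z; clear -Vk; lia.
Qed.

(** For v = 0 the shift is the floor of mu = k0, the rate is 0, and the Poisson law
    of rate 0 is the point mass at 0. *)
Lemma law_tp_degenerate (A : set int) :
  Er (fun w => (V w)%:R * (V w)%:R) - mu ^+ 2 = 0 ->
  fine (P [set w | A (V w)%:Z]) = fine (TP mu 0 A).
Proof.
move=> v0; have [k0 muk e0] := variance0_cst v0.
have sh : TP_shift mu 0 = k0%:Z by rewrite /TP_shift subr0 muk -[k0%:R]/(k0%:Z%:~R) intrKfloor.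
have -> : fine (TP mu 0 A) = (`[< A k0%:Z >])%:R.
  rewrite /TP /distribution /pushforward /= /poisson_prob /TP_rate sh muk subrr ltxx.
  rewrite diracE /=; congr ((nat_of_bool _)%:R).
  by apply/idP/asboolP; rewrite inE /= /shiftz addr0.
have bA := bV (fun k => (`[< A k%:Z >])%:R).
have -> : fine (P [set w | A (V w)%:Z]) = Er (fun w => (`[< A (V w)%:Z >])%:R).
  rewrite (@Er_indic_bool _ _ _ P n X); last by move=> w w' ww'; rewrite (dV ww').
  by congr (fine (P _)); apply/seteqP; split=> w /= /asboolP.
apply/eqP; rewrite -subr_eq0 -normr_le0 -[X in _ - X](Er_cst P).
have bc := @ball_bfun_cst _ _ _ P n X (`[< A k0%:Z >])%:R.
have bd : ball_bfun X (fun w => (`[< A (V w)%:Z >])%:R - (`[< A k0%:Z >])%:R).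
  exact: (bV (fun k => (`[< A k%:Z >])%:R - (`[< A k0%:Z >])%:R)).
rewrite -(@ErB _ _ _ P n X _ _ bA bc) (le_trans (ler_norm_Er bd)) // -e0.
apply: (@ler_Er _ _ _ P n X) => //.
- exact: ball_bfun_norm bd.
- exact: (bV (fun k => (k != k0)%:R)).
move=> w; case: eqP => [->|_]; first by rewrite subrr normr0.
by case: (`[< _ >]) (`[< _ >]) => -[]; rewrite ?subrr ?subr0 ?sub0r ?normrN ?normr0 ?normr1.
Qed.

End variance_zero.

Section distances_bounds.
Context {R : realType}.
Implicit Types (P Q : probability int R) (c : R).

Let abse_fine P Q A c : `|fine (P A) - fine (Q A)| <= c -> (`|P A - Q A| <= c%:E)%E.
Proof.
move=> h; rewrite -(@fineK _ (P A)) ?fin_num_measure // -(@fineK _ (Q A)) ?fin_num_measure //.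
Qed.

Lemma dTV_le P Q c : (forall A, `|fine (P A) - fine (Q A)| <= c) -> (dTV P Q <= c%:E)%E.
Proof. by move=> h; apply: ge_ereal_sup => _ [A _ <-]; exact: abse_fine. Qed.

Lemma dloc_le P Q c : (forall j, `|fine (P [set j]) - fine (Q [set j])| <= c) ->
  (dloc P Q <= c%:E)%E.
Proof. by move=> h; apply: ge_ereal_sup => _ [j _ <-]; exact: abse_fine. Qed.

Lemma prob_sub_le1 d (T : measurableType d) (P : probability T R) Q A B :
  measurable A -> `|fine (P A) - fine (Q B)| <= 1.
Proof.
move=> mA; have mB : measurable B by [].
have a0 : 0 <= fine (P A) by exact: fine_ge0.
have b0 : 0 <= fine (Q B) by exact: fine_ge0.
have a1 : fine (P A) <= 1 by rewrite -lee_fin fineK ?fin_num_measure // probability_le1.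
have b1 : fine (Q B) <= 1 by rewrite -lee_fin fineK ?fin_num_measure // probability_le1.
by rewrite ler_norml; apply/andP; split; lra.
Qed.

End distances_bounds.

Section approximation.
Context {R : realType} (p : nat -> R) (r : nat).
Hypothesis r_gt0 : (0 < r)%N.
Hypothesis p_gt0 : forall j, (1 <= j)%N -> 0 < p j.
Hypothesis p_noninc : forall j, (1 <= j)%N -> p j.+1 <= p j.
Hypothesis p_sum1 : (\sum_(1 <= j <oo) (p j)%:E = 1)%E.

(** Once v is below the constant C both bounds are at least 1. This is the case unless
    n >= N0 and v >= 32, as v <= n^2. The bounds for v = 0 read 0 on the right, by
    the convention for division by zero, and hold because the laws coincide. *)
Lemma law_close : exists C : R, forall n, (2 * r <= n)%N ->
  forall (d : measure_display) (T : measurableType d) (P : probability T R)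
    (X : 'I_n -> {RV P >-> nat}), is_occupancy_scheme p X ->
  let V := boxes_with X r in
  let mu := Er P (fun w => (V w)%:R) in
  let v := Er P (fun w => (V w)%:R * (V w)%:R) - mu ^+ 2 in
  0 <= v ->
  (forall A, `|fine (P [set w | A (V w)%:Z]) - fine (TP mu v A)| <= C / Num.sqrt v) /\
  (forall j, `|fine (P [set w | [set j] (V w)%:Z]) - fine (TP mu v [set j])| <= C / v).
Proof.
have [N0 bounds] := defect_bounds r_gt0 p_gt0 p_noninc p_sum1.
pose D : R := defect_cst r; have D0 : 0 <= D by exact: defect_cst_ge0.
have N2 : 0 <= N0%:R ^+ 2 :> R by rewrite sqr_ge0.
have [C [C1 CN C32 C2 C2D]] : exists C : R,
    [/\ 1 <= C, N0%:R ^+ 2 <= C, 32 <= C, 2 + D <= C & 2 + 2 * D <= C].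
  by exists (2 + 2 * D + 32 + N0%:R ^+ 2); split; lra.
exists C => n r2n d T P X scheme V mu v v_ge0.
have dV : ball_fun X V := @boxes_with_fun _ _ _ _ _ _ _.
have Vn w : (V w <= n)%N by exact: boxes_with_le.
move: v_ge0; rewrite le_eqVlt => /predU1P[v0|v_gt0].
  have e A : `|fine (P [set w | A (V w)%:Z]) - fine (TP mu v A)| = 0.
    by rewrite (law_tp_degenerate dV Vn A (esym v0)) -/mu -v0 subrr normr0.
  by split=> [A|j]; rewrite e -v0 ?sqrtr0 invr0 mulr0.
have sv_gt0 : 0 < Num.sqrt v by rewrite sqrtr_gt0.
have sv2 : v = Num.sqrt v * Num.sqrt v by rewrite -expr2 sqr_sqrtr // ltW.
have v_le : v <= n%:R ^+ 2.
  apply: (@le_trans _ _ (Er P (fun w => (V w)%:R * (V w)%:R))).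
    by rewrite /v lerBlDr lerDl sqr_ge0.
  rewrite -[leRHS](Er_cst P); apply: (@ler_Er _ _ _ P n X).
  - exact: (count_bfun (fun k => k%:R * k%:R) dV Vn).
  - exact: ball_bfun_cst.
  - by move=> w; rewrite expr2 ler_pM // ler_nat.
have mV (A : set int) : measurable [set w | A (V w)%:Z].
  by apply: (@ball_fun_measurable _ _ _ P n X) => w w' ww' /=; rewrite (dV _ _ ww').
have [vC|[nN0 v32]] : v <= C \/ ((N0 <= n)%N /\ 32 <= v).
  have [nN|nN] := leqP N0 n; last first.
    left; apply: (le_trans v_le); apply: (le_trans _ CN).
    by rewrite ler_sqr ?nnegrE // ler_nat ltnW.
  by have [v32|v32] := leP 32 v; [right|left; apply: ltW (lt_le_trans v32 C32)].
- have svC : Num.sqrt v <= C.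
    have C0 : 0 <= C by exact: le_trans C1.
    rewrite -[leRHS]ger0_norm // -sqrtr_sqr ler_sqrt ?sqr_ge0 //.
    by apply: (le_trans vC); rewrite expr2 ler_peMr.
  split=> [A|j]; apply: (le_trans (prob_sub_le1 P _ _ (mV _))).
  + by rewrite ler_pdivlMr // mul1r.
  + by rewrite ler_pdivlMr // mul1r.
have [binf bone] := bounds n nN0 r2n d T P X scheme v32.
pose lam := TP_rate mu v; pose a := TP_shift mu v.
have [_ /andP[lamv _]] : a%:~R + lam = mu /\ v <= lam < v + 1.
  by apply/(TP_specP mu v a lam).
have lam_gt0 : 0 < lam by exact: lt_le_trans lamv.
have inv_lam : lam^-1 <= v^-1 by rewrite lef_pV2 ?posrE.
split=> [A|j].
- apply: (le_trans (law_tp_le dV Vn v_gt0 A (D := D * v^-1 * Num.sqrt v) _)).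
    move=> N h h01; apply: binf => k.
    rewrite shifted_fdiff; last by rewrite /stein_sol big1 // => i _; rewrite stein_pt0 mulr0.
    apply: shifted_le => i; apply: le_trans inv_lam.
    exact: stein_sol_diff.
  rewrite -/mu -/v.
  have -> : 2 / v + D / v * Num.sqrt v = (2 / Num.sqrt v + D) / Num.sqrt v.
    have -> : v^-1 = (Num.sqrt v)^-1 * (Num.sqrt v)^-1 by rewrite -invfM -sv2.
    by field; rewrite gt_eqF.
  rewrite ler_wpM2r ?invr_ge0 ?(ltW sv_gt0) //.
  apply: (le_trans _ C2); rewrite lerD2r.
  rewrite ler_pdivrMr // ler_peMr // -sqrtr1 ler_sqrt // (le_trans _ v32) //.
  by rewrite ler1n.
- have HD k : `|stein_defect P V (shifted a (stein_pt lam k))| <= D * (2 / v).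
    apply: bone => N.
    under eq_bigr do rewrite shifted_fdiff ?stein_pt0 //.
    apply: shifted_sum_le => M; apply: (le_trans (stein_pt_variation lam_gt0 k M)).
    by rewrite ler_pM2l.
  have D2 : 0 <= D * (2 / v) by rewrite mulr_ge0 // divr_ge0 // ltW.
  apply: (le_trans (law_tp_pt_le dV Vn v_gt0 j HD D2)); rewrite -/mu -/v.
  have -> : 2 / v + D * (2 / v) = (2 + 2 * D) / v by ring.
  by rewrite ler_wpM2r ?invr_ge0 ?(ltW v_gt0).
Qed.

End approximation.

Theorem theorem1p2 (R : realType) (p : nat -> R)
    (p_gt0 : forall j, (1 <= j)%N -> 0 < p j)
    (p_noninc : forall j, (1 <= j)%N -> p j.+1 <= p j)
    (p_sum1 : (\sum_(1 <= j <oo) (p j)%:E = 1)%E)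
    (j0 n0 : nat) (j0P : is_j0 p j0) (n0P : is_n0 p j0 n0)
    (r : nat) (r_ge1 : (1 <= r)%N) :
  exists C : R, forall n : nat,
    (n0 <= n)%N -> expR (r%:R / 4) <= n%:R :> R -> (2 * r <= n)%N ->
    forall (d : measure_display) (T : measurableType d) (P : probability T R)
      (X : 'I_n -> {RV P >-> nat}),
    is_occupancy_scheme p X ->
    let mu := mean_boxes_with X r in
    let sigma := Num.sqrt (var_boxes_with X r) in
    (dTV (law_boxes_with X r) (TP mu (sigma ^+ 2)) <= (C * sigma^-1)%:E)%E /\
    (dloc (law_boxes_with X r) (TP mu (sigma ^+ 2)) <= (C * sigma ^- 2)%:E)%E.
Proof.
have [C close] := law_close r_ge1 p_gt0 p_noninc p_sum1.
exists C => n _ _ r2n d T P X scheme mu sigma.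
have bV : ball_bfun X (fun w => (boxes_with X r w)%:R : R).
  exact: (count_bfun (fun k => k%:R) (boxes_with_fun r) (boxes_with_le X r_ge1)).
have muE : mu = Er P (fun w => (boxes_with X r w)%:R) by exact: (fine_expectation_Er bV).
have s2 : sigma ^+ 2 = var_boxes_with X r.
  by rewrite sqr_sqrtr // fine_ge0 // variance_ge0.
have vE := fine_variance_Er bV.
have vge0 : 0 <= var_boxes_with X r by rewrite fine_ge0 // variance_ge0.
have lawE A : law_boxes_with X r A = P [set w | A (boxes_with X r w)%:Z].
  by congr (P _); apply/funext => w; rewrite /= /shiftz add0r.
have := close n r2n d T P X scheme; rewrite /= -vE -muE => /(_ vge0) [hA hj].
rewrite s2; split.
- by apply: dTV_le => A; rewrite lawE; exact: hA.
- by apply: dloc_le => j; rewrite lawE; exact: hj.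
Qed.
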